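(* Let $n=3r_0+2$ with $r_0$ an integer and $n\ge 7$, and let $G$ be a connected graph with $n$ vertices and less than $r_0+12$ cycles. Then $$m'(G)\le c(n,r_0)=4\cdot 3^{r_0-1}+2^{r_0-1},$$ with equality if and only if $G\cong C(n,r_0)$, where $C(n,r_0)=K_3*\bigl((r_0-1)K_3\uplus K_2\bigr)$.
   Context: All graphs are finite and simple. A maximum independent set is an independent set of vertices of largest cardinality among all independent sets of $G$; $m'(G)$ is the number of maximum independent sets of $G$. ''Number of cycles'' means the number of distinct cycle subgraphs. $\uplus$ is disjoint union, $tH$ is the disjoint union of $t$ copies of $H$, and $K_m$ is the complete graph on $m$ vertices. If $H$ is a graph all of whose components are complete, $K_m*H$ is the graph obtained from the disjoint union of $K_m$ and $H$ by picking a vertex $v_0$ of $K_m$ and joining it by an edge to exactly one vertex in each component of $H$. *)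

(* Defs.v *)
From mathcomp Require Import all_boot.

Set Implicit Arguments.
Unset Strict Implicit.
Unset Printing Implicit Defensive.

Record sgraph := SGraph {
  vertex :> finType;
  adj : rel vertex;
  adj_sym : symmetric adj;
  adj_irrefl : irreflexive adj }.

Definition sg_iso (G H : sgraph) : Prop :=
  exists2 f : G -> H, bijective f & forall x y : G, adj (f x) (f y) = adj x y.

Definition sg_connected (G : sgraph) : Prop :=
  forall x y : G, connect (@adj G) x y.

Definition component (G : sgraph) (x : G) : {set G} :=
  [set y | connect (@adj G) x y].

Definition components (G : sgraph) : {set {set G}} :=
  [set component x | x : G].

Definition independent (G : sgraph) (A : {set G}) : bool :=
  [forall x in A, forall y in A, ~~ adj x y].

Definition max_independent (G : sgraph) (A : {set G}) : bool :=
  independent A && [forall B : {set G}, independent B ==> (#|B| <= #|A|)].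

Definition num_max_independent (G : sgraph) : nat :=
  #|[set A : {set G} | max_independent A]|.

Definition cycle_edges (T : finType) (s : seq T) : {set {set T}} :=
  [set [set x; next s x] | x in s].

(* A cycle subgraph is identified with its edge set, so the rotations and    *)
(* reversals of a closed walk all give the same cycle. The lengths are       *)
(* bounded by #|G| only to keep the predicate boolean; see is_cycleP.        *)
Definition is_cycle (G : sgraph) (C : {set {set G}}) : bool :=
  [exists k : 'I_#|G|.+1, exists t : k.-tuple G,
    [&& 2 < k, ucycleb (@adj G) t & C == cycle_edges t]].

Lemma is_cycleP (G : sgraph) (C : {set {set G}}) :
  reflect (exists s : seq G,
             [/\ 2 < size s, ucycle (@adj G) s & C = cycle_edges s])
          (is_cycle C).
Proof.
apply: (iffP existsP) => [[k /existsP[t /and3P[k2 ct /eqP->]]]|[s [s2 cs ->]]].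
  by exists t; rewrite size_tuple.
have ss : size s < #|G|.+1.
  by rewrite ltnS -(card_uniqP (ucycle_uniq cs)) max_card.
exists (Ordinal ss); apply/existsP; exists (in_tuple s).
by rewrite s2 eqxx andbT.
Qed.

Definition num_cycles (G : sgraph) : nat :=
  #|[set C : {set {set G}} | is_cycle C]|.

Section Complete.
Variable m : nat.
Definition complete_adj : rel 'I_m := fun x y => x != y.
Fact complete_sym : symmetric complete_adj.
Proof. by move=> x y; rewrite /complete_adj eq_sym. Qed.
Fact complete_irrefl : irreflexive complete_adj.
Proof. by move=> x; rewrite /complete_adj eqxx. Qed.
Definition complete : sgraph := SGraph complete_sym complete_irrefl.
End Complete.

Section DisjointUnion.
Variables G H : sgraph.
Definition dunion_adj : rel (G + H) := fun u v =>
  match u, v with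
  | inl x, inl y => adj x y
  | inr x, inr y => adj x y
  | _, _ => false
  end.
Fact dunion_sym : symmetric dunion_adj.
Proof. by move=> [x|x] [y|y] //=; rewrite adj_sym. Qed.
Fact dunion_irrefl : irreflexive dunion_adj.
Proof. by move=> [x|x] /=; rewrite adj_irrefl. Qed.
Definition dunion : sgraph := SGraph dunion_sym dunion_irrefl.
End DisjointUnion.

Section Copies.
Variables (t : nat) (H : sgraph).
Definition copies_adj : rel ('I_t * H) := fun u v =>
  (u.1 == v.1) && adj u.2 v.2.
Fact copies_sym : symmetric copies_adj.
Proof. by move=> u v; rewrite /copies_adj eq_sym adj_sym. Qed.
Fact copies_irrefl : irreflexive copies_adj.
Proof. by move=> u; rewrite /copies_adj adj_irrefl andbF. Qed.
Definition copies : sgraph := SGraph copies_sym copies_irrefl.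
End Copies.

(* The disjoint union of K_m and H, with v0 joined to every vertex of S. *)
Section Attach.
Variables (m : nat) (v0 : 'I_m) (H : sgraph) (S : {set H}).
Definition attach_adj : rel ('I_m + H) := fun u v =>
  match u, v with
  | inl x, inl y => x != y
  | inr x, inr y => adj x y
  | inl x, inr y | inr y, inl x => (x == v0) && (y \in S)
  end.
Fact attach_sym : symmetric attach_adj.
Proof. by move=> [x|x] [y|y] //=; rewrite ?(eq_sym x) // adj_sym. Qed.
Fact attach_irrefl : irreflexive attach_adj.
Proof. by move=> [x|x] /=; rewrite ?eqxx ?adj_irrefl. Qed.
Definition attach : sgraph := SGraph attach_sym attach_irrefl.
End Attach.

(* K_m * H involves a choice of v0 and of one vertex in each component of H. *)
(* When the components of H are complete, all the choices give isomorphic    *)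
(* graphs, so that "G is isomorphic to K_m * H" is the following predicate.  *)
Definition iso_Kstar (m : nat) (H G : sgraph) : Prop :=
  exists (v0 : 'I_m) (S : {set H}),
    (forall B, B \in components H -> #|S :&: B| = 1) /\ sg_iso G (attach v0 S).

(* The order n = 3 * r0 + 2 of C(n, r0) is determined by r0. *)
Definition iso_C (r0 : nat) (G : sgraph) : Prop :=
  iso_Kstar 3 (dunion (copies (r0 - 1) (complete 3)) (complete 2)) G.

Definition c_val (r0 : nat) : nat := 4 * 3 ^ (r0 - 1) + 2 ^ (r0 - 1).

(* Main.v *)
Require Import Defs.
From mathcomp Require Import all_boot zify.

(** Write m(S) for the number of maximum independent sets of the subgraph
    induced by a vertex set S ([mis]), and N(v) for the neighbours of v. All
    estimates come from one recursion ([branchP]): a maximum independent set of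
    S avoids v or contains it, so m(S) is m(S - v), or m(S - v - N(v)), or the
    sum of the two, according to which of these sets keep the independence
    number.

    Without any hypothesis on cycles, m(S) is at most the Moon-Moser number
    [moon] of |S|, with equality only for disjoint unions of cliques, and at
    most [conn_bound] if S is connected. Both bounds are proved together by
    induction ([moon_factsP]). If S has a cut vertex, the vertex is chosen so
    that the largest component M that it leaves is as large as possible; every
    other component is then a single vertex or is attached by at least two
    edges, and branching at the cut vertex gives a recursive bound ([cutP]). If
    S has no cut vertex, then a vertex of large degree makes m(S - v - N(v))
    small, a vertex of degree two gives an explicit three-vertex reduction
    ([degree2P]), and a cubic S is handled by averaging over all vertices
    ([alpha_mis_average]).

    The value c(n, r0) is [sparse_bound] of n, which equals [conn_bound] unless
    n is 2 modulo 3; for n = 3 r0 + 2 the connected extremal graphs have many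
    cycles. With fewer than r0 + 12 cycles, the same case analysis
    ([few_cycles_tip]) ends with m(S) < c(n, r0), except when a piece of S of
    order 1 modulo 3 attains [conn_bound], or when some vertex y is such that
    S - y attains the Moon-Moser number of n - 1. The first exception contradicts
    the count of cycles, because a connected set of order 3 t + 1 > 1 that
    attains [conn_bound] contains at least t + 6 cycles ([extremal_cycles]). In the
    second one ([tip_bound]), S - y is a disjoint union of cliques, triangles
    together with either one K4 or two K2, and y is joined to each of them. The
    equation m(S) = m(S - y) + m(S - y - N(y)) requires that N(y) contains
    exactly one of these cliques. If there is a K4, then y either turns it into a
    K5 or turns a triangle into a second K4, and both force r0 + 12 cycles. In
    the remaining case m(S - y - N(y)) is at most 2 ^ (r0 - 1), with equality
    exactly when y swallows a K2 and has one neighbour in each other clique.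
    This is the graph C(n, r0), with y in the place of v0. *)

Set Implicit Arguments.
Unset Strict Implicit.
Unset Printing Implicit Defensive.

(** * Moon-Moser numbers and the bound for connected graphs *)

(** The largest number of maximum independent sets of a graph with n vertices:
    the largest product of positive integers with sum n. It is 3 ^ t, 4 * 3 ^ (t - 1)
    or 2 * 3 ^ t for n = 3 t, 3 t + 1 or 3 t + 2, from n = 2 on. *)
Fixpoint moon n := match n with
  | 0 => 1 | 1 => 1 | 2 => 2 | 3 => 3 | 4 => 4
  | ((_.+2) as n').+3 => 3 * moon n'
  end.

(** From n = 6 on, this is 2 ^ (t - 1), 2 ^ (t - 1) or 3 * 2 ^ (t - 2) for n = 3 t,
    3 t + 1 or 3 t + 2: what one vertex that is joined to an extremal disconnected
    graph on the other n - 1 vertices can add. *)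
Fixpoint excess n := match n with
  | 0 | 1 => 0 | 2 | 3 | 4 | 5 => 1 | 6 | 7 => 2 | 8 => 3
  | ((_.+4.+2) as n').+3 => 2 * excess n'
  end.

(** The largest number of maximum independent sets of a connected graph with n
    vertices. *)
Definition conn_bound n := moon n.-1 + excess n.

(** The value c(n, r0) as a function of n = 3 r0 + 2, continued to all n so that
    the recursion below can be used; see [c_val_sparse_bound]. *)
Definition sparse_bound n := moon n.-1 + 2 ^ (n %/ 3).-1.

Lemma moonD3 n : 1 < n -> moon n.+3 = 3 * moon n.
Proof. by case: n => [|[|n]]. Qed.

Lemma excessD3 n : 5 < n -> excess n.+3 = 2 * excess n.
Proof. by do 6! [case: n => [//|n]]. Qed.

Lemma conn_boundD3 n : 5 < n -> conn_bound n.+3 = 2 * conn_bound n + moon n.-1.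
Proof.
move=> n5; rewrite /conn_bound excessD3 //.
have -> : n.+3.-1 = n.-1.+3 by lia.
by rewrite moonD3; lia.
Qed.

Lemma sparse_boundD3 n : 2 < n -> sparse_bound n.+3 = 2 * sparse_bound n + moon n.-1.
Proof.
move=> n2; rewrite /sparse_bound.
have -> : n.+3.-1 = n.-1.+3 by lia.
rewrite moonD3; last by lia.
have -> : (n.+3 %/ 3).-1 = (n %/ 3).-1.+1 by lia.
by rewrite expnS; lia.
Qed.

(** All the functions of this part satisfy recursions of step 3, so that
    inequalities between them follow from three consecutive cases. *)
Lemma ind_step3 k (P : nat -> Prop) :
  (forall n, k <= n < k.+3 -> P n) -> (forall n, k <= n -> P n -> P n.+3) ->
  forall n, k <= n -> P n.
Proof.
move=> base step n; elim/ltn_ind: n => n IH kn.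
have [|kn3] := ltnP n k.+3; first by move=> nk; apply: base; rewrite kn.
have -> : n = (n - 3).+3 by lia.
by apply: step; [lia | apply: IH; lia].
Qed.

Ltac small n :=
  repeat match goal with H : context [n] |- _ => revert H end;
  do 20? [case: n => [|n] //].

(** A product of two products of integers is again such a product. This is what
    makes the bound by [moon] multiplicative over disjoint unions. *)
Lemma moon_mul a b : moon a * moon b <= moon (a + b).
Proof.
have base : forall a, a < 5 -> forall b, moon a * moon b <= moon (a + b).
  move=> {}a a5 {}b; have [b2|] := ltnP b 2; first by small a; small b.
  move: b; apply: ind_step3 => [b|b b2 IH]; first by small a; small b.
  by rewrite !addnS !moonD3; lia.
have [/base //|a5] := ltnP a 5.
have {a5}: 2 <= a by lia.
move: a; apply: ind_step3 => [a a5|a a2 IH]; first by apply: base; lia.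
by rewrite !addSn !moonD3; lia.
Qed.

Lemma moon_leS n : moon n <= moon n.+1.
Proof.
have [n2|] := ltnP n 2; first by small n.
by move: n; apply: ind_step3 => [n|n n2 IH]; [small n | rewrite !moonD3; lia].
Qed.

Lemma leq_moon a b : a <= b -> moon a <= moon b.
Proof. exact: (homo_leq (@leqnn) (@leq_trans) moon_leS). Qed.

Lemma moon_gt0 n : 0 < moon n.
Proof. exact: (leq_trans _ (leq_moon (leq0n n))). Qed.

Lemma conn_bound_moon n : conn_bound n <= moon n.
Proof.
have [n6|] := ltnP n 6; first by small n.
move: n; apply: ind_step3 => [n|n n6 IH]; first by small n.
by rewrite conn_boundD3 // moonD3; [have := @leq_moon n.-1 n; lia | lia].
Qed.

Lemma moonP_conn_bound n : moon n.-1 <= conn_bound n.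
Proof. exact: leq_addr. Qed.

Lemma conn_bound_lt_moon n : 4 < n -> conn_bound n < moon n.
Proof.
have [n6 n4|] := ltnP n 6; first by small n.
move=> + _; move: n; apply: ind_step3 => [n|n n6 IH]; first by small n.
by rewrite conn_boundD3 // moonD3; [have := @leq_moon n.-1 n; lia | lia].
Qed.

(** The base cases are a boolean conjunction, to be checked by computation. *)
Lemma ind_step3b k (P : pred nat) :
  all P (iota 0 k.+3) -> (forall n, k <= n -> P n -> P n.+3) -> forall n, P n.
Proof.
move=> /allP base step n; have [nk|kn] := ltnP n k.
  by apply: base; rewrite mem_iota; lia.
by move: n kn; apply: ind_step3 => // n nk; apply: base; rewrite mem_iota; lia.
Qed.

Lemma ind_step33b a b (P : nat -> pred nat) :
  all (fun k => all (P k) (iota 0 b.+3)) (iota 0 a.+3) ->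
  (forall k j, b <= j -> P k j -> P k j.+3) ->
  (forall k j, a <= k -> P k j -> P k.+3 j) -> forall k j, P k j.
Proof.
move=> /allP base stepj stepk k j; have small_k k' : k' < a.+3 -> P k' j.
  move=> ka; apply: (@ind_step3b b (P k')) => [|i bi]; last exact: stepj.
  by apply: base; rewrite mem_iota.
have [ka|ak] := ltnP k a; first by apply: small_k; lia.
by move: k ak; apply: ind_step3 => [k ak|k ak]; [apply: small_k; lia | apply: stepk].
Qed.

Lemma conn_bound_mul_moon a b : conn_bound a * moon b <= moon (a + b).
Proof. exact: leq_trans (leq_mul (conn_bound_moon a) (leqnn _)) (moon_mul a b). Qed.

(** The bound that branching at a cut vertex x gives when a component D with k
    vertices keeps its independence number after the removal of N(x), and the other
    components have j vertices in all. *)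
Definition pend k j := conn_bound k * moon j + moon (k - 2) * excess j.+1.

(** [pend], [bridge] and [split_bound] all grow, when a variable increases by 3, at
    most as fast as twice themselves plus a Moon-Moser number,
    which is the recursion of [conn_bound] and [sparse_bound]. The inequalities
    therefore reduce to finitely many pairs. *)
Lemma pend_stepj k j : 5 < j -> pend k j.+3 <= 2 * pend k j + moon (k + j).
Proof.
move=> j5; rewrite /pend moonD3 ?(@excessD3 j.+1); try lia.
have := conn_bound_mul_moon k j; lia.
Qed.

Lemma pend_stepk k j : 5 < k -> pend k.+3 j <= 2 * pend k j + moon (k + j).
Proof.
move=> k5; rewrite /pend conn_boundD3 //.
have -> : k.+3 - 2 = (k - 2).+3 by lia.
rewrite moonD3; last by lia.
suff : moon k.-1 * moon j + moon (k - 2) * excess j.+1 <= moon (k + j) by lia.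
apply: leq_trans (_ : moon k.-1 * conn_bound j.+1 <= _).
  by rewrite /conn_bound mulnDr leq_add2l leq_mul2r leq_moon ?orbT //; lia.
rewrite mulnC; apply: leq_trans (conn_bound_mul_moon _ _) _.
by apply: leq_moon; lia.
Qed.

Lemma pend_conn_bound k j : 2 < k -> 0 < j -> pend k j <= conn_bound (k + j).+1.
Proof.
move=> k2 j0.
suff: (2 < k) && (0 < j) ==> (pend k j <= conn_bound (k + j).+1) by rewrite k2 j0.
move: k j {k2 j0}; apply: (@ind_step33b 6 6) => [|k j j6|k j k6]; first by vm_compute.
  move=> /implyP H; apply/implyP => /andP[k2 _]; rewrite !addnS conn_boundD3; last lia.
  by have := pend_stepj k j6; have := H; rewrite k2 /=; lia.
move=> /implyP H; apply/implyP => /andP[k2 j0]; rewrite !addSn conn_boundD3; last lia.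
by have := pend_stepk j k6; have := H; rewrite j0 /=; lia.
Qed.

(** Equality holds for k = 4 and j divisible by 3, where D may be a K4; those pairs
    need the count of cycles and are excluded here. *)
Lemma pend_sparse_bound k j :
  2 < k -> 0 < j -> (k + j) %% 3 != 2 -> (k != 4) || ((k + j) %% 3 == 0) ->
  pend k j < sparse_bound (k + j).+1.
Proof.
pose P k j := [&& 2 < k, 0 < j, (k + j) %% 3 != 2 & (k != 4) || ((k + j) %% 3 == 0)]
  ==> (pend k j < sparse_bound (k + j).+1).
move=> k2 j0 kj k4; suff: P k j by rewrite /P k2 j0 kj k4.
move: k j {k2 j0 kj k4}; apply: (@ind_step33b 6 6) => [|k j j6|k j k6].
- by vm_compute.
- move=> /implyP H; apply/implyP => C; rewrite !addnS sparse_boundD3; last lia.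
  by have := pend_stepj k j6; have := H; rewrite ?succnK; lia.
move=> /implyP H; apply/implyP => C; rewrite !addSn sparse_boundD3; last lia.
by have := pend_stepk j k6; have := H; rewrite ?succnK; lia.
Qed.

(** The bound that branching at a cut vertex x gives when there are only two
    components, a component D with k vertices that loses one from its independence
    number with the removal of N(x), and a component with j vertices that does not. *)
Definition bridge k j := conn_bound k.+1 * moon j.-1 + conn_bound k * excess j.

Lemma bridge_stepj k j : 5 < j -> bridge k j.+3 <= 2 * bridge k j + moon (k + j).
Proof.
move=> j5; rewrite /bridge excessD3 //.
have -> : j.+3.-1 = j.-1.+3 by lia.
rewrite moonD3; last lia.
have := conn_bound_mul_moon k.+1 j.-1.
have -> : k.+1 + j.-1 = k + j by lia.
lia.
Qed.

Lemma bridge_stepk k j : 0 < j -> 5 < k -> bridge k.+3 j <= 2 * bridge k j + moon (k + j).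
Proof.
move=> j0 k5; rewrite /bridge (conn_boundD3 k5) (conn_boundD3 (leqW k5)).
suff : moon k * moon j.-1 + moon k.-1 * excess j <= moon (k + j) by rewrite ?succnK; lia.
apply: leq_trans (_ : moon k * conn_bound j <= _).
  by rewrite /conn_bound mulnDr leq_add2l leq_mul2r leq_moon ?orbT //; lia.
rewrite mulnC; apply: leq_trans (conn_bound_mul_moon _ _) _.
by apply: leq_moon; lia.
Qed.

Lemma bridge_conn_bound k j : 0 < k -> 0 < j -> bridge k j <= conn_bound (k + j).+1.
Proof.
move=> k0 j0.
suff: (0 < k) && (0 < j) ==> (bridge k j <= conn_bound (k + j).+1) by rewrite k0 j0.
move: k j {k0 j0}; apply: (@ind_step33b 6 6) => [|k j j6|k j k6]; first by vm_compute.
  move=> /implyP H; apply/implyP => /andP[k2 _]; rewrite !addnS conn_boundD3; last lia.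
  by have := bridge_stepj k j6; have := H; rewrite k2 /=; lia.
move=> /implyP H; apply/implyP => /andP[_ j0]; rewrite !addSn conn_boundD3; last lia.
by have := bridge_stepk j0 k6; have := H; rewrite j0 /=; lia.
Qed.

Lemma bridge_sparse_bound k j :
  0 < k <= j -> (k + j) %% 3 != 2 -> 2 < k + j ->
  (3 < k) || (k != 2) && (j != 3) && ((k + j) %% 3 == 0) ->
  bridge k j < sparse_bound (k + j).+1.
Proof.
(* The induction moves one variable at a time and leaves the region k <= j, which P
   therefore does not impose. The three pairs listed are those outside this region
   at which the strict inequality fails. *)
pose Q k j := [|| 3 < k | [&& k != 2, j != 3 & (k + j) %% 3 == 0]].
pose P k j := [&& 0 < k, 0 < j, 2 < k + j, (k + j) %% 3 != 2, Q k j &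
   (k, j) \notin [:: (4, 3); (6, 4); (7, 3)]] ==> (bridge k j < sparse_bound (k + j).+1).
move=> kj kj3 kj2 q; suff: P k j by move/implyP; apply; rewrite /Q !inE !xpair_eqE ?succnK; lia.
move: k j {kj kj3 kj2 q}; apply: (@ind_step33b 8 6) => [|k j j6|k j k6].
- by vm_compute.
- move=> /implyP H; apply/implyP => C; rewrite !addnS sparse_boundD3; last by move: C; rewrite /Q; lia.
  have := bridge_stepj k j6; have := H; move: C; rewrite /Q !inE !xpair_eqE ?succnK; lia.
move=> /implyP H; apply/implyP => C; rewrite !addSn sparse_boundD3; last by move: C; rewrite /Q; lia.
have j0 : 0 < j by move: C; lia.
have := @bridge_stepk k j j0; have := H; move: C; rewrite /Q !inE !xpair_eqE ?succnK; lia.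
Qed.

(** The bound given by a vertex of degree two whose closed neighbourhood separates
    the other vertices into two parts with x and y vertices. *)
Definition split_bound x y := 2 * (conn_bound x * conn_bound y) + moon (x - 2) * moon (y - 2).

Lemma split_boundC x y : split_bound x y = split_bound y x.
Proof. by rewrite /split_bound mulnC [in X in _ + X]mulnC (mulnC (conn_bound x)) mulnC. Qed.

Lemma split_step x y : 5 < x -> split_bound x.+3 y <= 2 * split_bound x y + moon (x + y).+2.
Proof.
move=> x5; rewrite /split_bound conn_boundD3 //.
have -> : x.+3 - 2 = (x - 2).+3 by lia.
rewrite moonD3; last lia.
suff : 2 * (moon x.-1 * conn_bound y) + moon (x - 2) * moon (y - 2) <= moon (x + y).+2 by lia.
have -> : (x + y).+2 = (x + y).-1.+3 by lia.
rewrite moonD3; last lia.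
have := conn_bound_mul_moon y x.-1; have := moon_mul (x - 2) (y - 2).
have := @leq_moon (x - 2 + (y - 2)) (x + y).-1; have -> : y + x.-1 = (x + y).-1 by lia.
lia.
Qed.

Lemma split_stepj x y : 5 < y -> split_bound x y.+3 <= 2 * split_bound x y + moon (x + y).+2.
Proof. by rewrite (split_boundC x) (split_boundC x y) (addnC x); apply: split_step. Qed.

Lemma split_conn_bound x y : 0 < x -> 0 < y -> split_bound x y <= conn_bound (x + y).+3.
Proof.
move=> x0 y0; suff: (0 < x) && (0 < y) ==> (split_bound x y <= conn_bound (x + y).+3).
  by rewrite x0 y0.
move: x y {x0 y0}; apply: (@ind_step33b 6 6) => [|k j j6|k j k6]; first by vm_compute.
  move=> /implyP H; apply/implyP => /andP[k2 _]; rewrite !addnS conn_boundD3; last lia.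
  by have := split_stepj k j6; have := H; rewrite k2 /=; lia.
move=> /implyP H; apply/implyP => /andP[_ j0]; rewrite !addSn conn_boundD3; last lia.
by have := split_step j k6; have := H; rewrite j0 /=; lia.
Qed.

Lemma split_sparse_bound x y :
  0 < x -> 0 < y -> (x + y) %% 3 != 0 -> split_bound x y < sparse_bound (x + y).+3.
Proof.
pose P x y := [&& 0 < x, 0 < y & (x + y) %% 3 != 0] ==> (split_bound x y < sparse_bound (x + y).+3).
move=> x0 y0 xy; suff: P x y by rewrite /P x0 y0 xy.
move: x y {x0 y0 xy}; apply: (@ind_step33b 6 6) => [|k j j6|k j k6].
- by vm_compute.
- move=> /implyP H; apply/implyP => C; rewrite !addnS sparse_boundD3; last lia.
  by have := split_stepj k j6; have := H; rewrite ?succnK; lia.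
move=> /implyP H; apply/implyP => C; rewrite !addSn sparse_boundD3; last lia.
by have := split_step j k6; have := H; rewrite ?succnK; lia.
Qed.

(** * Numerical inequalities in one variable *)

Lemma sparse_conn_bound n : 2 < n -> sparse_bound n <= conn_bound n.
Proof.
move=> n2; suff: (2 < n) ==> (sparse_bound n <= conn_bound n) by rewrite n2.
move: n {n2}; apply: (@ind_step3b 6) => [|n n6 H]; first by vm_compute.
by rewrite sparse_boundD3 ?conn_boundD3; lia.
Qed.

Lemma sparse_conn_boundE n : 2 < n -> n %% 3 != 2 -> sparse_bound n = conn_bound n.
Proof.
move=> n2 n3; apply/eqP.
suff: (2 < n) && (n %% 3 != 2) ==> (sparse_bound n == conn_bound n) by rewrite n2 n3.
move: n {n2 n3}; apply: (@ind_step3b 6) => [|n n6 H]; first by vm_compute.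
by rewrite sparse_boundD3 ?conn_boundD3; lia.
Qed.

Lemma moonP_sparse_bound n : moon n.-1 < sparse_bound n.
Proof. by rewrite /sparse_bound -[X in X < _]addn0 ltn_add2l expn_gt0. Qed.

Ltac step3 n k :=
  revert n; apply (@ind_step3b k); [by vm_compute | ].

(** One unrolling of every recursion at once, in the form that linear arithmetic
    needs for the inductive steps of this part. *)
Lemma step3_facts n : 5 < n ->
  [/\ [/\ sparse_bound n.+3 = 2 * sparse_bound n + moon n.-1,
          sparse_bound n.+4.+2 = 2 * sparse_bound n.+3 + moon n.+2
        & conn_bound n.+3 = 2 * conn_bound n + moon n.-1],
      [/\ conn_bound n.+4 = 2 * conn_bound n.+1 + moon n,
         conn_bound n.+4.+2 = 2 * conn_bound n.+3 + moon n.+2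
       & excess n.+4 = 2 * excess n.+1],
      [/\ moon n.+2 = 3 * moon n.-1, moon n.+3 = 3 * moon n & moon n.+4 = 3 * moon n.+1]
    & [/\ moon n.-1 <= moon n, moon n <= moon n.+1 & moon n.+1 <= moon n.+2]].
Proof.
move=> n5; have E : n.+2 = n.-1.+3 by lia.
have M : moon n.+2 = 3 * moon n.-1 by rewrite E moonD3; lia.
have L a b : a <= b -> moon a <= moon b := @leq_moon a b.
split; split; rewrite ?L ?M ?(@sparse_boundD3 n.+3) ?(@conn_boundD3 n.+3) ?M //; try lia.
- by apply: sparse_boundD3; lia.
- exact: conn_boundD3.
- by apply: conn_boundD3; lia.
- by apply: excessD3; lia.
- by apply: moonD3; lia.
by apply: moonD3; lia.
Qed.

Lemma moon_pred3 n : (2 < n) && (n %% 3 != 1) -> moon n.-1 + moon (n - 3) <= moon n.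
Proof.
apply/implyP; step3 n 6; move=> n nk H.
have [_ _ [+ + +] _] := @step3_facts n ltac:(lia).
move: H; have -> : n.+3 - 3 = (n - 3).+3 by lia.
by rewrite (@moonD3 (n - 3)); rewrite ?succnK; lia.
Qed.

Lemma moon_pred4 n : (3 < n) && (n %% 3 == 1) -> moon n.-1 + moon (n - 4) <= moon n.
Proof.
apply/implyP; step3 n 6; move=> n nk H.
have [_ _ [+ + +] _] := @step3_facts n ltac:(lia).
move: H; have -> : n.+3 - 4 = (n - 4).+3 by lia.
by rewrite (@moonD3 (n - 4)); rewrite ?succnK; lia.
Qed.

Lemma simplicial2_conn_bound n : 0 < n -> conn_bound n + 2 * moon n.-1 <= conn_bound n.+3.
Proof.
apply/implyP; step3 n 6; move=> n nk H.
have [[] + + + [] + + + [] + + + [] + + +] := @step3_facts n ltac:(lia).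
move: H; rewrite ?succnK; lia.
Qed.

Lemma simplicial2_sparse_bound n :
  (3 < n) && (n %% 3 != 0) -> conn_bound n + 2 * moon n.-1 < sparse_bound n.+3.
Proof.
apply/implyP; step3 n 6; move=> n nk H.
have [[] + + + [] + + + [] + + + [] + + +] := @step3_facts n ltac:(lia).
move: H; rewrite ?succnK; lia.
Qed.

Lemma cherry_conn_bound n : 1 < n -> 2 * conn_bound n + moon (n - 2) <= conn_bound n.+3.
Proof.
apply/implyP; step3 n 6; move=> n nk H.
have [[] + + + [] + + + [] + + + [] + + +] := @step3_facts n ltac:(lia).
move: H; have -> : n.+3 - 2 = (n - 2).+3 by lia.
rewrite (@moonD3 (n - 2)); last lia.
have := @leq_moon (n - 2) n.-1; lia.
Qed.

Lemma cherry_sparse_bound n :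
  (3 < n) && (n %% 3 != 0) -> 2 * conn_bound n + moon (n - 2) < sparse_bound n.+3.
Proof.
apply/implyP; step3 n 6; move=> n nk H.
have [[] + + + [] + + + [] + + + [] + + +] := @step3_facts n ltac:(lia).
move: H; have -> : n.+3 - 2 = (n - 2).+3 by lia.
rewrite (@moonD3 (n - 2)); last lia.
have := @leq_moon (n - 2) n.-1; lia.
Qed.

Lemma delete3_conn_bound n :
  (2 < n) && (n %% 3 != 1) -> conn_bound n + moon (n - 3) <= conn_bound n.+1.
Proof.
apply/implyP; step3 n 6; move=> n nk H.
have [[] + + + [] + + + [] + + + [] + + +] := @step3_facts n ltac:(lia).
move: H; have -> : n.+3 - 3 = (n - 3).+3 by lia.
rewrite (@moonD3 (n - 3)); last lia.
have := @moon_pred3 n; lia.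
Qed.

Lemma delete4_sparse_bound n :
  (3 < n) && (n %% 3 == 1) -> conn_bound n + moon (n - 4) <= sparse_bound n.+1.
Proof.
apply/implyP; step3 n 6; move=> n nk H.
have [[] + + + [] + + + [] + + + [] + + +] := @step3_facts n ltac:(lia).
move: H; have -> : n.+3 - 4 = (n - 4).+3 by lia.
rewrite (@moonD3 (n - 4)); last lia.
have := @sparse_boundD3 n.+1; rewrite ?succnK; have := @moon_pred3 n; have := @moon_pred4 n; have := @leq_moon (n - 4) (n - 3); lia.
Qed.

Lemma delete5_sparse_bound n :
  (6 < n) && (n %% 3 == 1) -> conn_bound n + moon (n - 5) < sparse_bound n.+1.
Proof.
apply/implyP; step3 n 7; move=> n nk H.
have [[] + + + [] + + + [] + + + [] + + +] := @step3_facts n ltac:(lia).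
move: H; have -> : n.+3 - 5 = (n - 5).+3 by lia.
rewrite (@moonD3 (n - 5)); last lia.
have := @sparse_boundD3 n.+1; rewrite ?succnK; have := @moon_pred4 n; have := @leq_moon (n - 5) (n - 4); lia.
Qed.

Lemma delete4_sparse_bound1 n :
  (5 < n) && (n %% 3 == 0) -> conn_bound n + moon (n - 4) < sparse_bound n.+1.
Proof.
apply/implyP; step3 n 6; move=> n nk H.
have [[] + + + [] + + + [] + + + [] + + +] := @step3_facts n ltac:(lia).
move: H; have -> : n.+3 - 4 = (n - 4).+3 by lia.
rewrite (@moonD3 (n - 4)); last lia.
have := @sparse_boundD3 n.+1; rewrite ?succnK; have := @moon_pred3 n; have := @moon_pred4 n; have := @leq_moon (n - 4) (n - 3); lia.
Qed.

Lemma moon_double n : n %% 3 == 2 -> moon n.+2 == 2 * moon n.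
Proof.
apply/implyP; step3 n 6; move=> n nk H.
have [_ _ [+ + +] _] := @step3_facts n ltac:(lia).
by move: H; rewrite (@moonD3 n.+2); lia.
Qed.

Lemma leaf_sparse_bound j :
  (2 < j) && (j %% 3 == 0) -> conn_bound j + moon j.-1 = sparse_bound j.+2.
Proof.
move=> Hj; apply/eqP; move: Hj; apply/implyP; step3 j 6; move=> j jk H.
have [[] + + + [] + + + [] + + + [] + + +] := @step3_facts j ltac:(lia).
have := @sparse_boundD3 j.+2; move: H; rewrite ?succnK.
by have := @moon_double j.-1; rewrite (_ : j.-1.+2 = j.+1); lia.
Qed.

Lemma pend4_sparse_bound j :
  (2 < j) && (j %% 3 == 0) -> 3 * moon j + 2 * excess j.+1 < sparse_bound j.+4.+1.
Proof.
apply/implyP; step3 j 6; move=> j jk H.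
have [[] + + + [] + + + [] + + + [] + + +] := @step3_facts j ltac:(lia).
move: H; rewrite (@sparse_boundD3 j.+4.+1) // succnK; lia.
Qed.

Lemma clique4_sparse_bound j :
  (2 < j) && (j %% 3 == 0) -> 2 * conn_bound j.+1 + 2 * moon j <= sparse_bound j.+4.+1.
Proof.
apply/implyP; step3 j 6; move=> j jk H.
have [[] + + + [] + + + [] + + + [] + + +] := @step3_facts j ltac:(lia).
have := moon_mul 4 j; rewrite !addSn add0n (_ : moon 4 = 4) //.
move: H; rewrite (@sparse_boundD3 j.+4.+1) // succnK; lia.
Qed.

Lemma path3_sparse_bound j :
  (3 < j) && (j %% 3 == 1) -> 2 * conn_bound j + moon j.-1 < sparse_bound j.+4.
Proof.
apply/implyP; step3 j 6; move=> j jk H.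
have [[] + + + [] + + + [] + + + [] + + +] := @step3_facts j ltac:(lia).
move: H; rewrite (@sparse_boundD3 j.+4) // ?succnK; lia.
Qed.

(** For D a triangle inside N(x), m(S) is 3 * m(H) + m(H - N(x)). With m(H) at most
    [conn_bound] - 1 and m(H - N(x)) at most 8/9 of the Moon-Moser number, this is the
    resulting estimate cleared of denominators. *)
Lemma clique3_sparse_bound j :
  (3 < j) && (j %% 3 == 1) ->
  27 * conn_bound j + 8 * moon j.-1 < 9 * sparse_bound j.+4 + 27.
Proof.
apply/implyP; step3 j 10; move=> j jk H.
have [[] + + + [] + + + [] + + + [] + + +] := @step3_facts j ltac:(lia).
(* From j = 10 on, the term 27 is absorbed by a Moon-Moser number. *)
have m9 : moon 9 <= moon j.-1 by apply: leq_moon; lia.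
have m27 : 27 <= moon j.-1 by apply: leq_trans m9.
have := moon_mul 4 j.-1; have -> : 4 + j.-1 = j.+3 by lia.
have -> : moon 4 = 4 by [].
move: H; rewrite (@sparse_boundD3 j.+4) // ?succnK; lia.
Qed.

(** The smallest case is the worst one, with 8 against 9 at order 6. *)
Lemma conn_bound_gap n : (5 < n) && (n %% 3 == 0) -> 9 * conn_bound n <= 8 * moon n.
Proof.
apply/implyP; step3 n 6; move=> n nk H.
have [[] + + + [] + + + [] + + + [] + + +] := @step3_facts n ltac:(lia).
have := @moon_pred3 n; have : moon n = 3 * moon (n - 3).
  by rewrite -moonD3; [congr moon; lia | lia].
move: H; rewrite ?succnK; lia.
Qed.

(** Factors 4 and 2 can be replaced by 3 and 3, and factors 4 and 4 by 3, 3 and 2;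
    each replacement multiplies the product by 9/8. A single vertex wastes more. *)
Lemma moon_mul_gap a b :
  (a %% 3 == 1) && (b %% 3 != 0) -> 9 * (moon a * moon b) <= 8 * moon (a + b).
Proof.
have base : forall a, a < 5 -> forall b, (a %% 3 == 1) && (b %% 3 != 0) ->
    9 * (moon a * moon b) <= 8 * moon (a + b).
  move=> {}a a5 {}b; apply/implyP; have [b3|] := ltnP b 3; first by small a; small b.
  move: b; apply: ind_step3 => [b|b b2 IH]; first by small a; small b.
  by move: IH; rewrite !addnS !moonD3; lia.
have [/base H|a5] := ltnP a 5; first exact: H.
have {a5}: 2 <= a by lia.
move: a; apply: ind_step3 => [a a5|a a2 IH]; first by apply: base; lia.
by move: IH; rewrite !addSn !moonD3; lia.
Qed.

(** * Maximum independent sets inside a vertex set *)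

Section Basics.
Variable G : sgraph.
Implicit Types (A B C S I W D H X Y : {set G}) (u v x y : G).

Definition nbr v : {set G} := [set u | adj v u].
Definition cnbr v : {set G} := v |: nbr v.

Definition indep_sets S k : {set {set G}} :=
  [set A : {set G} | [&& A \subset S, independent A & #|A| == k]].
Definition alpha S := \max_(A : {set G} | (A \subset S) && independent A) #|A|.
Definition mis S := #|indep_sets S (alpha S)|.

Definition apart A B := [disjoint A & B] && [forall a in A, forall b in B, ~~ adj a b].

Lemma indepP A : reflect {in A &, forall x y, ~~ adj x y} (independent A).
Proof.
apply: (iffP forall_inP) => [H x y xA yA|H x xA]; first by have /forall_inP := H x xA; apply.
by apply/forall_inP => y yA; apply: H.
Qed.

Lemma indepS A B : A \subset B -> independent B -> independent A.
Proof. by move=> /subsetP AB /indepP H; apply/indepP => x y /AB xB /AB yB; apply: H. Qed.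

Lemma indep0 : independent (set0 : {set G}).
Proof. by apply/indepP => x y; rewrite inE. Qed.

Lemma indep1 v : independent [set v].
Proof. by apply/indepP => x y /set1P-> /set1P->; rewrite adj_irrefl. Qed.

Lemma indepU1 v A : independent (v |: A) = independent A && [disjoint A & nbr v].
Proof.
apply/indepP/andP => [H|[/indepP HA /pred0P HN] x y].
  split; first by apply/indepP => x y xA yA; apply: H; rewrite !inE ?xA ?yA orbT.
  apply/pred0P => x /=; apply/negP => /andP[xA]; rewrite inE.
  by apply/negP; apply: H; rewrite !inE ?eqxx ?xA ?orbT.
have N z : z \in A -> ~~ adj v z by move=> zA; have := HN z; rewrite /= zA inE => /= ->.
case/setU1P => [->|xA] /setU1P[->|yA]; rewrite ?adj_irrefl ?N //; first by rewrite adj_sym N.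
exact: HA.
Qed.

Lemma apartC A B : apart A B = apart B A.
Proof.
rewrite /apart disjoint_sym; congr (_ && _).
by apply/forall_inP/forall_inP => H x xA; apply/forall_inP => y yB; rewrite adj_sym;
  have /forall_inP := H y yB; apply.
Qed.

Lemma apartP A B : reflect ([disjoint A & B] /\ forall x y, x \in A -> y \in B -> ~~ adj x y)
  (apart A B).
Proof.
apply: (iffP andP) => [[d H]|[d H]]; split=> //.
  by move=> x y xA yB; have /forall_inP/(_ x xA)/forall_inP := H; apply.
by apply/forall_inP => x xA; apply/forall_inP => y; apply: H.
Qed.

Lemma apartS A B A' B' : A' \subset A -> B' \subset B -> apart A B -> apart A' B'.
Proof.
move=> sA sB /apartP[d H]; apply/apartP; split; first exact: disjointWl sA (disjointWr sB d).
by move=> x y /(subsetP sA) xA /(subsetP sB); apply: H.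
Qed.

Lemma apartUl A B C : apart A C -> apart B C -> apart (A :|: B) C.
Proof.
move=> /apartP[d H] /apartP[d' H']; apply/apartP; split; first by rewrite disjoints_subset subUset -!disjoints_subset d.
by move=> x y /setUP[xA|xB]; [apply: H | apply: H'].
Qed.

Lemma disjoint_cnbr v C : [disjoint C & cnbr v] = (v \notin C) && [disjoint C & nbr v].
Proof.
by rewrite -!setI_eq0 /cnbr setIUr setU_eq0 !setI_eq0 disjoint_sym disjoints1.
Qed.

Lemma leq_alpha A S : A \subset S -> independent A -> #|A| <= alpha S.
Proof. by move=> AS iA; apply: (@leq_bigmax_cond _ _ (fun A : {set G} => #|A|)); rewrite AS. Qed.

Lemma indep_sets_gt S k : alpha S < k -> #|indep_sets S k| = 0.
Proof.
move=> ak; apply: eq_card0 => A; rewrite !inE; apply/negP => /and3P[AS iA /eqP kA].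
by have := leq_alpha AS iA; lia.
Qed.

Lemma mis_gt0 S : 0 < mis S.
Proof.
have : 0 < #|[pred A : {set G} | (A \subset S) && independent A]|.
  by apply/card_gt0P; exists set0; rewrite !inE sub0set indep0.
case/(eq_bigmax_cond (fun A : {set G} => #|A|)) => A; rewrite inE => /andP[AS iA] E.
by apply/card_gt0P; exists A; rewrite inE AS iA /alpha E eqxx.
Qed.

Lemma indep_sets_alpha S k : 0 < #|indep_sets S k| -> k <= alpha S.
Proof. by move=> H; rewrite leqNgt; apply/negP => lt; rewrite (indep_sets_gt lt) in H. Qed.

Lemma alphaS A B : A \subset B -> alpha A <= alpha B.
Proof.
move=> AB; apply/bigmax_leqP => I /andP[IA iI]; apply: leq_alpha => //; exact: subset_trans AB.
Qed.

Lemma alpha_card S : alpha S <= #|S|.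
Proof. by apply/bigmax_leqP => I /andP[IA iI]; apply: subset_leq_card. Qed.

Lemma indep_sets0 S : #|indep_sets S 0| = 1.
Proof.
rewrite (_ : indep_sets S 0 = [set set0]) ?cards1 //; apply/setP => A; rewrite !inE cards_eq0.
by apply/and3P/eqP => [[_ _ /eqP]|->]; rewrite ?sub0set ?indep0.
Qed.

(** Removing v is a bijection between the independent sets of S that contain v
    and the independent sets that avoid v and its neighbours. *)
Lemma card_indep_sets_mem S v k : v \in S ->
  #|[set A in indep_sets S k.+1 | v \in A]| = #|indep_sets (S :\: cnbr v) k|.
Proof.
move=> vS.
have <- : #|[set v |: B | B in indep_sets (S :\: cnbr v) k]| = #|indep_sets (S :\: cnbr v) k|.
  apply: card_in_imset.
  move=> A B; rewrite !inE !subsetD => /and3P[/andP[_ dA] _ _] /and3P[/andP[_ dB] _ _] E.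
  have out (C : {set G}) : [disjoint C & cnbr v] -> v \notin C.
    by move/pred0P/(_ v); rewrite /= !inE eqxx andbT => ->.
  by rewrite -(setU1K (out _ dA)) -(setU1K (out _ dB)) E.
apply: eq_card => A; rewrite !inE; apply/andP/imsetP.
  case=> /and3P[AS iA /eqP kA] vA; exists (A :\ v); last by rewrite setD1K.
  move: iA; rewrite -{1}(setD1K vA) indepU1 => /andP[iA dA].
  have kA' : #|A :\ v| == k by move: kA; rewrite (cardsD1 v A) vA; clear; lia.
  rewrite inE iA kA' !andbT subsetD.
  by rewrite (subset_trans (subD1set _ _) AS) /= disjoint_cnbr !inE eqxx dA.
case=> B; rewrite inE subsetD disjoint_cnbr => /and3P[/and3P[BS vB dB] iB /eqP kB ->].
rewrite setU11 indepU1 iB dB cardsU1 vB kB add1n eqxx.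
by rewrite subUset sub1set vS BS.
Qed.

Lemma indep_sets_rec S v k : v \in S ->
  #|indep_sets S k.+1| = #|indep_sets (S :\ v) k.+1| + #|indep_sets (S :\: cnbr v) k|.
Proof.
move=> vS; rewrite -(card_indep_sets_mem _ vS).
rewrite -(cardsID [set A : {set G} | v \in A] (indep_sets S k.+1)) addnC; congr (_ + _).
  apply: eq_card => A; rewrite !inE subsetD1; case: (A \subset S) => //=.
  by rewrite !andbF.
by apply: eq_card => A; rewrite !inE.
Qed.

Lemma alphaD1 S v : alpha (S :\ v) <= alpha S.
Proof. exact: alphaS (subD1set _ _). Qed.

Lemma alphaD_cnbr S v : v \in S -> alpha (S :\: cnbr v) < alpha S.
Proof.
move=> vS; apply: indep_sets_alpha; rewrite (indep_sets_rec _ vS).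
by have := mis_gt0 (S :\: cnbr v); rewrite /mis; lia.
Qed.

Variant branch_spec S v : Prop :=
| BranchOut of alpha S = alpha (S :\ v) & alpha (S :\: cnbr v) < (alpha S).-1 & mis S = mis (S :\ v)
| BranchIn of alpha S = (alpha (S :\: cnbr v)).+1 & alpha (S :\ v) < alpha S &
    mis S = mis (S :\: cnbr v)
| BranchBoth of alpha S = alpha (S :\ v) & alpha S = (alpha (S :\: cnbr v)).+1 &
    mis S = mis (S :\ v) + mis (S :\: cnbr v).

Lemma branchP S v : v \in S -> branch_spec S v.
Proof.
move=> vS; have a1 := alphaD1 S v; have a2 := alphaD_cnbr vS.
have m0 := mis_gt0 S; have rec := indep_sets_rec (alpha S).-1 vS.
have aE : (alpha S).-1.+1 = alpha S by lia.
rewrite aE in rec.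
have [lt1|ge1] := ltnP (alpha (S :\ v)) (alpha S).
  move: rec; rewrite (indep_sets_gt lt1) add0n => rec.
  have E : alpha S = (alpha (S :\: cnbr v)).+1.
    have := @indep_sets_gt (S :\: cnbr v) (alpha S).-1; rewrite -rec; rewrite /mis in m0; lia.
  by apply: BranchIn => //; rewrite /mis rec {1}E.
have E1 : alpha S = alpha (S :\ v) by lia.
have [lt2|ge2] := ltnP (alpha (S :\: cnbr v)) (alpha S).-1.
  by apply: BranchOut => //; rewrite /mis rec (indep_sets_gt lt2) addn0 {1}E1.
have E2 : alpha S = (alpha (S :\: cnbr v)).+1 by lia.
by apply: BranchBoth => //; rewrite /mis rec {1}E1 {1}E2.
Qed.

Lemma mis_branch S v : v \in S -> mis S <= mis (S :\ v) + mis (S :\: cnbr v).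
Proof. by move=> vS; case: (branchP vS) => _ _ ->; lia. Qed.

(** Sets of size k larger than alpha do not exist, so that upper bounds need not
    know whether a branch keeps the independence number. *)
Lemma indep_sets_leq_mis S k : alpha S <= k -> #|indep_sets S k| <= mis S.
Proof. by rewrite leq_eqVlt => /orP[/eqP<-//|/indep_sets_gt->]. Qed.

Lemma mis0 : mis set0 = 1.
Proof.
have a0 : alpha set0 = 0 by apply/eqP; have := alpha_card set0; rewrite cards0; lia.
by rewrite /mis a0 indep_sets0.
Qed.

Lemma alpha0 : alpha set0 = 0.
Proof. by apply/eqP; have := alpha_card set0; rewrite cards0; lia. Qed.

(** Independence splits over sets without edges between them; with it, the choice
    of a maximum independent set in a disjoint union is a pair of independent
    choices. *)
Lemma apart_indep A B I : apart A B -> I \subset A :|: B ->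
  independent I = independent (I :&: A) && independent (I :&: B).
Proof.
move=> /apartP[_ H] IAB; apply/idP/andP => [iI|[/indepP iA /indepP iB]].
  by split; apply: indepS iI; apply: subsetIl.
apply/indepP => x y xI yI; have := subsetP IAB x xI; have := subsetP IAB y yI.
rewrite !inE => /orP[yA|yB] /orP[xA|xB].
- by apply: iA; rewrite inE ?xI ?yI.
- by rewrite adj_sym H.
- exact: H.
- by apply: iB; rewrite inE ?xI ?yI.
Qed.

Lemma alpha_witness S : exists2 I : {set G}, (I \subset S) && independent I & #|I| = alpha S.
Proof.
by have /card_gt0P[I] := mis_gt0 S; rewrite inE => /and3P[IS iI /eqP cI]; exists I; rewrite ?IS.
Qed.

Lemma card_cap A B I : apart A B -> I \subset A :|: B -> #|I| = #|I :&: A| + #|I :&: B|.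
Proof.
move=> /apartP[d _] IAB; rewrite -cardsUI -setIUr (setIidPl IAB).
by rewrite setIACA setIid (disjoint_setI0 d) setI0 cards0 addn0.
Qed.

Lemma alphaU A B : apart A B -> alpha (A :|: B) = alpha A + alpha B.
Proof.
move=> AB; have d : [disjoint A & B] by case/apartP: AB.
apply/eqP; rewrite eqn_leq; apply/andP; split.
  apply/bigmax_leqP => I /andP[IAB]; rewrite (apart_indep AB IAB) => /andP[iA iB].
  by rewrite (card_cap AB IAB); apply: leq_add; apply: leq_alpha => //; apply: subsetIr.
have [I /andP[IA iI] <-] := alpha_witness A; have [J /andP[JB iJ] <-] := alpha_witness B.
have IJ : I :|: J \subset A :|: B by apply: setUSS.
have EI : (I :|: J) :&: A = I.
  rewrite setIUl (setIidPl IA) (_ : J :&: A = set0) ?setU0 //; apply: disjoint_setI0.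
  by rewrite disjoint_sym; apply: disjointWr JB d.
have EJ : (I :|: J) :&: B = J.
  rewrite setIUl (setIidPl JB) (_ : I :&: B = set0) ?set0U //; apply: disjoint_setI0.
  exact: disjointWl IA d.
have := card_cap AB IJ; rewrite EI EJ => <-; apply: leq_alpha => //.
by rewrite (apart_indep AB IJ) EI EJ iI.
Qed.

Lemma misU A B : apart A B -> mis (A :|: B) = mis A * mis B.
Proof.
move=> AB; have d : [disjoint A & B] by case/apartP: AB.
rewrite /mis (alphaU AB) -cardsX.
pose P := setX (indep_sets A (alpha A)) (indep_sets B (alpha B)).
have <- : #|[set p.1 :|: p.2 | p in P]| = #|P|.
  apply: card_in_imset.
  move=> [I J] [I' J']; rewrite !in_setX /= !inE => /andP[/and3P[IA _ _] /and3P[JB _ _]].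
  move=> /andP[/and3P[IA' _ _] /and3P[JB' _ _]] /= E.
  have cap (I0 J0 : {set G}) : I0 \subset A -> J0 \subset B ->
      (I0 = (I0 :|: J0) :&: A) * (J0 = (I0 :|: J0) :&: B).
    move=> IA0 JB0; rewrite !setIUl (setIidPl IA0) (setIidPl JB0).
    have -> : J0 :&: A = set0 by apply: disjoint_setI0; rewrite disjoint_sym; apply: disjointWr JB0 d.
    have -> : I0 :&: B = set0 by apply: disjoint_setI0; apply: disjointWl IA0 d.
    by rewrite setU0 set0U.
  have [e1 e2] := cap _ _ IA JB; have [e3 e4] := cap _ _ IA' JB'.
  by congr pair; [rewrite e1 e3 | rewrite e2 e4]; rewrite E.
apply: eq_card => I; apply/idP/imsetP.
  rewrite inE => /and3P[IAB]; rewrite (apart_indep AB IAB) (card_cap AB IAB) => /andP[iA iB] /eqP E.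
  exists (I :&: A, I :&: B); last by rewrite /= -setIUr (setIidPl IAB).
  have lA := leq_alpha (subsetIr I A) iA; have lB := leq_alpha (subsetIr I B) iB.
  by rewrite /P in_setX /= !inE iA iB !subsetIr; lia.
case=> -[I' J']; rewrite in_setX /= !inE => /andP[/and3P[IA iI /eqP cI] /and3P[JB iJ /eqP cJ]] ->.
have IJ : I' :|: J' \subset A :|: B by apply: setUSS.
have EI : (I' :|: J') :&: A = I'.
  rewrite setIUl (setIidPl IA) (_ : J' :&: A = set0) ?setU0 //; apply: disjoint_setI0.
  by rewrite disjoint_sym; apply: disjointWr JB d.
have EJ : (I' :|: J') :&: B = J'.
  rewrite setIUl (setIidPl JB) (_ : I' :&: B = set0) ?set0U //; apply: disjoint_setI0.
  exact: disjointWl IA d.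
by rewrite IJ (apart_indep AB IJ) EI EJ iI iJ (card_cap AB IJ) EI EJ cI cJ eqxx.
Qed.

End Basics.

(** * Connected vertex sets and cut vertices *)

Section Connectivity.
Variable G : sgraph.
Implicit Types (A B C S I W D H X Y M : {set G}) (u v x y : G).

(** A is a union of connected components of S. *)
Definition closed_in A S :=
  (A \subset S) && [forall a in A, forall b in S :\: A, ~~ adj a b].
(** Connectedness through unions of components rather than paths, because the
    arguments below only ever split sets. *)
Definition conn S :=
  (S != set0) && [forall A : {set G}, closed_in A S ==> (A == set0) || (A == S)].

Lemma closed_inP A S :
  reflect (A \subset S /\ forall a b, a \in A -> b \in S -> b \notin A -> ~~ adj a b)
    (closed_in A S).
Proof.
apply: (iffP andP) => -[AS H]; split=> //.
  move=> a b aA bS bA; have /forall_inP/(_ b) := forall_inP H a aA.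
  by apply; rewrite inE bA.
apply/forall_inP => a aA; apply/forall_inP => b; rewrite inE => /andP[bA bS].
exact: H.
Qed.

Lemma connP S :
  reflect (S != set0 /\ forall A, closed_in A S -> A = set0 \/ A = S) (conn S).
Proof.
apply: (iffP andP) => -[S0 H]; split=> //.
  by move=> A cA; have /implyP/(_ cA)/orP[/eqP|/eqP] := forallP H A; [left | right].
by apply/forallP => A; apply/implyP => /H[]->; rewrite eqxx ?orbT.
Qed.

Lemma closed_inD A S : closed_in A S -> closed_in (S :\: A) S.
Proof.
move=> /closed_inP[AS H]; apply/closed_inP; split=> [|a b]; first exact: subsetDl.
rewrite !inE => /andP[aA aS] bS; rewrite bS andbT negbK adj_sym => bA; exact: H.
Qed.

Lemma closed_in_apart A S : closed_in A S -> apart A (S :\: A).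
Proof.
move=> /closed_inP[AS H]; apply/apartP; split=> [|a b aA]; last by rewrite inE => /andP[? ?]; apply: H.
by rewrite -setI_eq0 setIDA setDIl setDv set0I.
Qed.

Lemma apart_closed_in A B : apart A B -> closed_in A (A :|: B).
Proof.
move=> /apartP[d H]; apply/closed_inP; split=> [|a b aA]; first exact: subsetUl.
by case/setUP => [->//|bB _]; apply: H.
Qed.

Lemma closed_in_trans A B S : closed_in A B -> closed_in B S -> closed_in A S.
Proof.
move=> /closed_inP[AB H] /closed_inP[BS K]; apply/closed_inP; split; first exact: subset_trans BS.
move=> a b aA bS bA; have [bB|bB] := boolP (b \in B); first exact: H.
by apply: K => //; apply: (subsetP AB).
Qed.

Lemma closed_in_sub A B S : closed_in A S -> A \subset B -> B \subset S -> closed_in A B.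
Proof.
move=> /closed_inP[AS H] AB BS; apply/closed_inP; split=> // a b aA bB; apply: H => //.
exact: (subsetP BS).
Qed.

Lemma closed_in_refl S : closed_in S S.
Proof. by apply/closed_inP; split=> // a b _ ->. Qed.

Lemma conn_edge S A : conn S -> A \subset S -> A != set0 -> A != S ->
  exists a b, [/\ a \in A, b \in S, b \notin A & adj a b].
Proof.
move=> /connP[S0 H] AS A0 AnS.
have [|nc] := boolP (closed_in A S); first by case/H => E; rewrite E eqxx in A0 AnS.
move: nc; rewrite /closed_in AS /= => /forall_inPn[a aA /forall_inPn[b]].
by rewrite inE => /andP[bA bS] /negPn ab; exists a, b.
Qed.

Lemma component_in S W : closed_in W S -> W != set0 ->
  exists D, [/\ D \subset W, closed_in D S & conn D].
Proof.
move=> cW W0; pose P (D : {set G}) := closed_in D S && (D != set0).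
have PW : P W by rewrite /P cW.
have [D /minsetP[/andP[cD D0] Dmin] DW] := minset_exists PW; exists D; split=> //.
apply/connP; split=> // A cA; have [->|A0] := eqVneq A set0; [by left | right].
apply: Dmin; last by case/closed_inP: cA.
by rewrite /P A0 (closed_in_trans cA cD).
Qed.

Lemma not_conn S : S != set0 -> ~~ conn S -> exists A, [/\ closed_in A S, A != set0 & A != S].
Proof.
move=> S0; rewrite /conn S0 /= => /forallPn[A]; rewrite negb_imply negb_or => /and3P[? ? ?].
by exists A.
Qed.

(** A union of components of S - x hangs on S through x only, so that its removal
    keeps S connected. *)
Lemma conn_setD S x D : conn S -> x \in S -> closed_in D (S :\ x) -> conn (S :\: D).
Proof.
move=> cS xS cD; have /closed_inP[DS HD] := cD; have /connP[S0 HS] := cS.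
have xD : x \notin D by apply/negP => /(subsetP DS); rewrite !inE eqxx.
have xSD : x \in S :\: D by rewrite inE xD.
have away A : closed_in A (S :\: D) -> x \notin A -> A = set0.
  move=> /closed_inP[AS HA] xA; suff cA : closed_in A S by case: (HS _ cA) => // E; rewrite E xS in xA.
  apply/closed_inP; split; first exact: subset_trans AS (subsetDl _ _).
  move=> a b aA bS bA; have [bD|bD] := boolP (b \in D); last by apply: HA => //; rewrite inE bD.
  rewrite adj_sym; have := subsetP AS a aA; rewrite inE => /andP[aD aS]; apply: HD => //.
  by rewrite !inE aS andbT; apply: contraNneq xA => <-.
apply/connP; split; first by apply/set0Pn; exists x.
move=> A cA; have [xA|/away] := boolP (x \in A); last by move=> /(_ cA); left.
right; have := away _ (closed_inD cA); rewrite inE xA => /(_ isT)/eqP; rewrite setD_eq0 => sub.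
by apply/eqP; rewrite eqEsubset sub andbT; case/closed_inP: cA.
Qed.

Lemma conn_setU1 S x H D : conn S -> x \in S -> S :\ x = D :|: H -> apart D H -> conn (x |: H).
Proof.
move=> cS xS E aDH; have -> : x |: H = S :\: D.
  have /apartP[d _] := aDH; have xD : x \notin D.
    by apply/negP => xD; have /setP/(_ x) := E; rewrite !inE eqxx xD.
  apply/setP => z; have /setP/(_ z) := E; rewrite !inE; case: (eqVneq z x) => [->|_] /=.
    by rewrite xS xD.
  by move=> ->; have := disjointFr d (x := z); case: (z \in D) => // ->.
by apply: conn_setD (xS) _ => //; rewrite E; apply: apart_closed_in.
Qed.

Lemma conn_nbr S x D : conn S -> x \in S -> closed_in D (S :\ x) -> D != set0 ->
  0 < #|nbr x :&: D|.
Proof.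
move=> cS xS /closed_inP[DS HD] D0.
have xD : x \notin D by apply/negP => /(subsetP DS); rewrite !inE eqxx.
have DnS : D != S by apply: contraNneq xD => ->.
have DsS : D \subset S by apply: subset_trans DS (subD1set _ _).
have [a [b [aD bS bD ab]]] := conn_edge cS DsS D0 DnS.
have [bx|bx] := eqVneq b x.
  by apply/card_gt0P; exists a; rewrite !inE aD -bx adj_sym ab.
by have := HD a b aD; rewrite !inE bx bS bD ab => /(_ isT isT).
Qed.

(** The pair (x, M) maximizes |M| among all cut vertices x and components M of
    S - x. If another component D with at least two vertices met N(x) in a single
    vertex p, then p would be a cut vertex, and its removal would leave M and x in
    one component, against the choice of (x, M). *)
Lemma cut_vertex_extremal S x0 : conn S -> x0 \in S -> 1 < #|S| -> ~~ conn (S :\ x0) ->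
  exists x M, [/\ x \in S, closed_in M (S :\ x), conn M, M != S :\ x
    & forall D, closed_in D (S :\ x) -> conn D -> [disjoint D & M] ->
        #|D| <= #|M| /\ (1 < #|D| -> 1 < #|nbr x :&: D|)].
Proof.
move=> cS x0S S1 nc.
pose Q (p : G * {set G}) := [&& p.1 \in S, closed_in p.2 (S :\ p.1), conn p.2 & p.2 != S :\ p.1].
have [p0 Qp0] : exists p, Q p.
  have n0 : S :\ x0 != set0 by rewrite -card_gt0; have := cardsD1 x0 S; rewrite x0S; lia.
  have [A [cA A0 AnS]] := not_conn n0 nc.
  have [D [DA cD connD]] := component_in cA A0; exists (x0, D).
  rewrite /Q /= x0S cD connD /=; apply: contraNneq AnS => E.
  by rewrite eqEsubset; case/closed_inP: cA => -> _; rewrite -E.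
have [[x M] /and4P[/= xS cM connM MnS] Mmax] := @arg_maxnP _ p0 Q (fun p => #|p.2|) Qp0.
exists x, M; split=> // D cD connD dDM.
have /closed_inP[DS HD] := cD; have /connP[D0 _] := connD; have /connP[M0 _] := connM.
have MS : M \subset S :\ x by case/closed_inP: cM.
split.
  apply: (Mmax (x, D)); rewrite /Q /= xS cD connD /=.
  apply: contraNneq M0 => E; apply/eqP; rewrite -(disjoint_setI0 dDM) E.
  by apply/esym/setIidPr.
move=> D1; rewrite ltnNge; apply/negP => N1.
have N0 := conn_nbr cS xS cD D0.
have /cards1P[p Ep] : #|nbr x :&: D| == 1 by rewrite eqn_leq N1 N0.
have [xp pD] : adj x p /\ p \in D.
  by have := set11 p; rewrite -Ep !inE => /andP.
have pS : p \in S by have := subsetP DS p pD; rewrite inE => /andP[].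
have cSD := conn_setD cS xS cD.
have : Q (p, S :\: D).
  rewrite /Q /= pS cSD /=; apply/andP; split.
    apply/closed_inP; split.
      by apply/subsetP => a; rewrite !inE => /andP[aD ->]; rewrite andbT; apply: contraNneq aD => ->.
    move=> a b; rewrite !inE => /andP[aD aS] /andP[bp bS]; rewrite bS andbT negbK => bD.
    have [ax|ax] := eqVneq a x.
      apply/negP => ab; move: bp; suff : b \in [set p] by rewrite inE => ->.
      by rewrite -Ep !inE bD andbT -ax.
    by rewrite adj_sym; apply: HD => //; rewrite !inE ax.
  have : 0 < #|D :\ p| by move: D1; rewrite (cardsD1 p D) pD.
  case/card_gt0P => d; rewrite inE => /andP[]; rewrite inE => dp dD.
  apply/eqP => /setP/(_ d); rewrite !inE dD dp /= => /esym.
  by have := subsetP DS d dD; rewrite inE => /andP[_ ->].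
move/Mmax => /=; apply/negP; rewrite -ltnNge; apply: proper_card; apply/properP; split.
  apply/subsetP => m mM; rewrite inE; have := subsetP MS m mM; rewrite inE => /andP[_ ->].
  by rewrite andbT; apply/negP => mD; have := disjointFr dDM mD; rewrite mM.
have xD : x \notin D by apply/negP => /(subsetP DS); rewrite !inE eqxx.
by exists x; [rewrite inE xD | apply/negP => /(subsetP MS); rewrite !inE eqxx].
Qed.

(** The hypothesis says that both kinds of maximum independent sets occur at x, so
    that the recursion is an equality. *)
Lemma mis_setU1 x H : x \notin H -> alpha H = (alpha (H :\: nbr x)).+1 ->
  mis (x |: H) = mis H + mis (H :\: nbr x).
Proof.
move=> xH E; have xS : x \in x |: H by rewrite setU11.
have E1 : (x |: H) :\ x = H by rewrite setU1K.
have E2 : (x |: H) :\: cnbr x = H :\: nbr x.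
  apply/setP => z; rewrite !inE; case: eqVneq => //= [->]; by rewrite (negbTE xH) andbF.
by case: (branchP xS); rewrite E1 E2; move: E; clear; lia.
Qed.

(** At a cut vertex x where both kinds of maximum independent sets occur, the
    independence numbers of the components of S - x drop by exactly one in total when
    N(x) is removed. Either some component D other than the large one drops by
    nothing, which is the pendant case with H the union of the other components; or
    the only component D besides the large one H drops, which is the bridge case. In
    the pendant case the recursion at x is also an equality for x and H, in the
    bridge case for x and D: this ties the two products in m(S) together. *)
Variant cut_spec S : Prop :=
| CutSmall W of #|W| < #|S| & mis S = mis W
| CutPendant x D H of x \in S & S :\ x = D :|: H & apart D H & conn D & H != set0
    & 1 < #|nbr x :&: D| & conn (x |: H)
    & alpha (D :\: nbr x) = alpha D
    & mis S = mis D * mis H + mis (D :\: nbr x) * mis (H :\: nbr x)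
    & mis (x |: H) = mis H + mis (H :\: nbr x)
| CutBridge x D H of x \in S & S :\ x = D :|: H & apart D H & conn D & conn H
    & (1 < #|D| -> 1 < #|nbr x :&: D|) & 0 < #|nbr x :&: H| & #|D| <= #|H|
    & alpha D = (alpha (D :\: nbr x)).+1
    & conn (x |: D)
    & mis S = mis D * mis H + mis (D :\: nbr x) * mis (H :\: nbr x)
    & mis (x |: D) = mis D + mis (D :\: nbr x).

Lemma cutP S x0 : conn S -> x0 \in S -> 1 < #|S| -> ~~ conn (S :\ x0) -> cut_spec S.
Proof.
move=> cS x0S S1 nc.
have [x [M [xS cM connM MnS HM]]] := cut_vertex_extremal cS x0S S1 nc.
have [_ _ m|aS aI m|aO aI m] := branchP xS.
- by apply: (@CutSmall _ (S :\ x)) => //; apply: proper_card (properD1 xS).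
- apply: (@CutSmall _ (S :\: cnbr x)) => //; apply: proper_card; apply/properP.
  by split; [exact: subsetDl | exists x; rewrite // !inE eqxx].
have split D : closed_in D (S :\ x) -> let H := (S :\ x) :\: D in
  [/\ S :\ x = D :|: H, apart D H, alpha S = alpha D + alpha H,
      alpha S = (alpha (D :\: nbr x) + alpha (H :\: nbr x)).+1
    & mis S = mis D * mis H + mis (D :\: nbr x) * mis (H :\: nbr x)].
  move=> cD H; have aDH := closed_in_apart cD; have DS : D \subset S :\ x by case/closed_inP: cD.
  have E : S :\ x = D :|: H.
    by rewrite /H -[LHS](setID (S :\ x) D) (setIidPr DS).
  have aN : apart (D :\: nbr x) (H :\: nbr x) by apply: apartS aDH; apply: subsetDl.
  have EN : S :\: cnbr x = (D :\: nbr x) :|: (H :\: nbr x).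
    rewrite -setDUl -E; apply/setP => z; rewrite !inE negb_or.
    by case: (z == x); case: (adj x z).
  split=> //; first by rewrite aO E alphaU.
    by rewrite aI EN alphaU.
  by rewrite m EN E !misU.
have pendant D : closed_in D (S :\ x) -> conn D -> [disjoint D & M] ->
    alpha (D :\: nbr x) = alpha D -> cut_spec S.
  move=> cD connD dDM aD; have [E aDH a1 a2 mS] := split D cD.
  set H := _ :\: D in E aDH a1 a2 mS.
  have [leM N1] := HM D cD connD dDM.
  have D0 : D != set0 by case/connP: connD.
  have N0 := conn_nbr cS xS cD D0.
  have xH : x \notin H by rewrite !inE eqxx andbF.
  have H0 : H != set0.
    have /connP[M0 _] := connM; apply: contraNneq M0 => H0.
    rewrite -(disjoint_setI0 dDM); apply/eqP/esym/setIidPr.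
    by move: E; rewrite H0 setU0 => <-; case/closed_inP: cM.
  apply: (@CutPendant _ x D H) => //.
  - have [D1|D1] := ltnP 1 #|D|; first exact: N1.
    have /cards1P[d Ed] : #|D| == 1 by rewrite eqn_leq D1 card_gt0.
    have ND : D :\: nbr x = set0.
      apply/eqP; rewrite setD_eq0; apply/subsetP => z; rewrite Ed inE => /eqP->.
      by case/card_gt0P: N0 => y; rewrite !inE Ed inE => /andP[+ /eqP<-].
    have := leq_alpha (_ : [set d] \subset D) (indep1 d).
    by rewrite cards1 -aD ND alpha0 Ed => /(_ (subxx _)).
  - exact: conn_setU1 E aDH.
  by apply: mis_setU1 => //; move: aD a1 a2; clear; lia.
pose R := (S :\ x) :\: M.
have cR : closed_in R (S :\ x) by apply: closed_inD.
have R0 : R != set0.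
  rewrite setD_eq0; apply: contra MnS => sub; rewrite eqEsubset sub andbT.
  by case/closed_inP: cM.
have dR D : D \subset R -> [disjoint D & M].
  by move=> DR; apply: disjointWl DR _; rewrite -setI_eq0 setIC setIDA setDIl setDv set0I.
have [D [DR cD connD]] := component_in cR R0.
have [E aDH a1 a2 mS] := split D cD.
have le1 := alphaS (subsetDl D (nbr x)).
set H := _ :\: D in E aDH a1 a2 mS; have le2 := alphaS (subsetDl H (nbr x)).
have [aE|aN] := eqVneq (alpha (D :\: nbr x)) (alpha D); first exact: pendant (dR _ DR) aE.
have aD : alpha D = (alpha (D :\: nbr x)).+1 by move: a1 a2 le1 le2 aN; clear; lia.
have aH : alpha (H :\: nbr x) = alpha H by move: a1 a2 aD; clear; lia.
have [DRE|DnR] := eqVneq D R.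
  have HM' : H = M.
    rewrite /H DRE /R setDDr setDv set0U; apply/setIidPr; by case/closed_inP: cM.
  have [leM N1] := HM D cD connD (dR _ DR).
  have D0 : D != set0 by case/connP: connD.
  apply: (@CutBridge _ x D H) => //; rewrite ?HM' //.
  - by apply: conn_nbr cS xS cM _; case/connP: connM.
  - by apply: (conn_setU1 cS xS _ (_ : apart H D)); rewrite 1?setUC 1?apartC.
  by apply: mis_setU1 => //; apply/negP => /(subsetP DR); rewrite !inE eqxx andbF.
have cR2 : closed_in (R :\: D) (S :\ x).
  apply: closed_in_trans cR; apply: closed_inD; apply: closed_in_sub cD DR _.
  exact: subsetDl.
have R20 : R :\: D != set0.
  by rewrite setD_eq0; apply: contra DnR => sub; rewrite eqEsubset DR sub.
have [D2 [D2R cD2 connD2]] := component_in cR2 R20.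
have D2R' : D2 \subset R by apply: subset_trans D2R (subsetDl _ _).
apply: (pendant D2) (dR _ D2R') _ => //.
have D2H : D2 \subset H.
  by apply: subset_trans D2R _; apply: setSD; apply: subsetDl.
have cD2H : closed_in D2 H by apply: closed_in_sub cD2 D2H _; apply: subsetDl.
have a3 := closed_in_apart cD2H.
have EH : H = D2 :|: (H :\: D2).
  by rewrite -[LHS](setID H D2) (setIidPr D2H).
have aHE := alphaU a3; rewrite -EH in aHE.
have a4 : apart (D2 :\: nbr x) ((H :\: D2) :\: nbr x) by apply: apartS a3; apply: subsetDl.
have aHNE := alphaU a4; rewrite -setDUl -EH in aHNE.
have := alphaS (subsetDl D2 (nbr x)); have := alphaS (subsetDl (H :\: D2) (nbr x)).
by move: aH aHE aHNE; clear; lia.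
Qed.

End Connectivity.

(** * Degrees, averaging, and vertices of degree two *)

Section Degrees.
Variable G : sgraph.
Implicit Types (A B C S I W Z D H X Y M J : {set G}) (u v x y a b : G).

Definition degree_in S v := #|nbr v :&: S|.
Definition biconn S := [forall v in S, conn (S :\ v)].

Lemma card_setD_cnbr S v : v \in S -> #|S :\: cnbr v| + (degree_in S v).+1 = #|S|.
Proof.
move=> vS; rewrite -(cardsID (cnbr v) S) addnC; congr (_ + _).
rewrite /degree_in (_ : S :&: cnbr v = v |: (nbr v :&: S)).
  by rewrite cardsU1 !inE adj_irrefl.
by apply/setP => z; rewrite !inE; case: eqVneq => [->|_] /=; [rewrite vS | rewrite andbC].
Qed.

Lemma degree_in_gt0 S v : conn S -> v \in S -> 1 < #|S| -> 0 < degree_in S v.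
Proof.
move=> cS vS S1.
have sub : [set v] \subset S by rewrite sub1set.
have n0 : [set v] != set0 by apply/set0Pn; exists v; rewrite inE.
have ne : [set v] != S by apply: contraTneq S1 => <-; rewrite cards1.
have [a [b [/set1P-> bS _ vb]]] := conn_edge cS sub n0 ne.
by apply/card_gt0P; exists b; rewrite !inE vb.
Qed.

Lemma biconnP S v : biconn S -> v \in S -> conn (S :\ v).
Proof. by move/forall_inP; apply. Qed.

Lemma biconn_degree S v : conn S -> biconn S -> 2 < #|S| -> v \in S -> 1 < degree_in S v.
Proof.
move=> cS bS S2 vS; rewrite ltnNge; apply/negP => d1.
have d0 : 0 < degree_in S v by apply: degree_in_gt0 => //; apply: ltnW.
have /cards1P[u Eu] : degree_in S v == 1 by rewrite eqn_leq d1 d0.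
have : u \in nbr v :&: S by rewrite Eu inE.
rewrite !inE => /andP[vu uS].
have vSu : v \in S :\ u by rewrite !inE vS andbT; apply: contraTneq vu => ->; rewrite adj_irrefl.
have := S2; rewrite (cardsD1 u) uS add1n ltnS => Su1.
have := degree_in_gt0 (biconnP bS uS) vSu Su1; rewrite /degree_in setIDA Eu.
by rewrite setDv cards0.
Qed.

Ltac btauto_set := repeat match goal with
  | |- context [?x == ?y] => case: (x == y)
  | |- context [adj ?x ?y] => case: (adj x y)
  | |- context [?x \in ?A] => case: (x \in A)
  end; by [].

(** Count the pairs of a maximum independent set and one of its vertices. *)
Lemma alpha_mis_average S : alpha S * mis S <= \sum_(v in S) mis (S :\: cnbr v).
Proof.
have [a0|a0] := posnP (alpha S); first by rewrite a0.
have -> : alpha S * mis S = \sum_(v in S) #|[set A in indep_sets S (alpha S) | v \in A]|.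
  rewrite mulnC /mis -sum_nat_const.
  under [RHS]eq_bigr => v _ do rewrite -sum1_card.
  rewrite (exchange_big_dep (fun A => A \in indep_sets S (alpha S))) /=; last first.
    by move=> v A _ /setIdP[].
  apply: eq_bigr => A AS; have := AS; rewrite sum1_card inE => /and3P[sub _ /eqP cA].
  rewrite -[LHS]cA.
  apply: eq_card => v.
  rewrite -[RHS]/((v \in S) && (A \in [set B in indep_sets S (alpha S) | v \in B])) in_set AS /=.
  by apply/idP/andP => [vA|[]//]; rewrite (subsetP sub).
apply: leq_sum => v vS; have -> : alpha S = (alpha S).-1.+1 by rewrite prednK.
rewrite card_indep_sets_mem //; apply: indep_sets_leq_mis.
by have := alphaD_cnbr vS; rewrite -(ltn_predK a0) ltnS.
Qed.

(** Greedy choice: a vertex of degree at most two costs at most three vertices. *)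
Lemma card_alpha_degenerate S :
  (forall A, A \subset S -> A != set0 -> exists2 v, v \in A & degree_in A v <= 2) ->
  #|S| <= 3 * alpha S.
Proof.
have [n] := ubnP #|S|; elim: n S => // n IH S; rewrite ltnS => Sn H.
have [->|S0] := eqVneq S set0; first by rewrite cards0.
have [v vS dv] := H S (subxx _) S0.
have c := card_setD_cnbr vS; have a := alphaD_cnbr vS.
have : #|S :\: cnbr v| <= 3 * alpha (S :\: cnbr v).
  apply: IH; first by move: c Sn; clear; lia.
  by move=> A AS; apply: H; apply: subset_trans AS (subsetDl _ _).
by move: c a dv; clear; lia.
Qed.

(** After the removal of the closed neighbourhood of one vertex, every remaining
    nonempty set has, by connectedness, an edge leaving it, hence a vertex of degree
    at most two, and the greedy choice applies. *)
Lemma card_alpha_cubic S : conn S -> (forall v, v \in S -> degree_in S v = 3) ->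
  #|S| <= 3 * alpha S + 1.
Proof.
move=> cS H; have /connP[/set0Pn[v vS] _] := cS.
have c := card_setD_cnbr vS; have a := alphaD_cnbr vS.
have : #|S :\: cnbr v| <= 3 * alpha (S :\: cnbr v).
  apply: card_alpha_degenerate => A AS A0.
  have AsS : A \subset S by apply: subset_trans AS (subsetDl _ _).
  have AnS : A != S by apply: contraTneq vS => <-; apply/negP => /(subsetP AS); rewrite !inE eqxx.
  have [x [y [xA yS yA xy]]] := conn_edge cS AsS A0 AnS; exists x => //.
  rewrite -ltnS -(H x (subsetP AsS x xA)); apply: proper_card; apply/properP; split.
    exact: setIS.
  by exists y; rewrite !inE ?xy ?yS ?(negbTE yA).
move: c a; rewrite H //; clear; lia.
Qed.

(** The reductions at a vertex v with two neighbours a and b in S, where J is S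
    without v, a and b: a and b are adjacent; or they are not, and J is connected; or
    they are not, and J is a union of two components X and Y. The sets A, B, W and Z
    are what remains after the removal of neighbours of a or b. *)
Variant degree2_spec S : Prop :=
| Degree2Triangle J A B of conn J & #|S| = #|J| + 3 & #|A| < #|J| & #|B| < #|J|
    & mis S <= mis J + mis A + mis B
| Degree2Cherry J W of conn J & #|S| = #|J| + 3 & #|W| <= #|J| - 2 & mis S <= 2 * mis J + mis W
| Degree2Split X Y W Z of conn X & conn Y & #|S| = #|X| + #|Y| + 3
    & #|W| <= #|X| - 2 & #|Z| <= #|Y| - 2
    & mis S <= 2 * (mis X * mis Y) + mis W * mis Z.

(** A maximum independent set contains exactly one of v, a and b, because v could
    be added to a set that avoids the other two. *)
Lemma mis_triangle S v a b : v \in S -> nbr v :&: S = [set a; b] -> adj a b ->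
  mis S <= mis (S :\: cnbr v) + mis ((S :\: cnbr v) :\: nbr a) + mis ((S :\: cnbr v) :\: nbr b).
Proof.
move=> vS Nv ab; set J := S :\: cnbr v.
have /setP NvE := Nv.
have [va aS] : adj v a /\ a \in S by have := NvE a; rewrite !inE eqxx => /andP.
have [vb bS] : adj v b /\ b \in S by have := NvE b; rewrite !inE eqxx orbT => /andP.
have anb : a != b by apply: contraTneq ab => ->; rewrite adj_irrefl.
have vna : v != a by apply: contraTneq va => ->; rewrite adj_irrefl.
have vnb : v != b by apply: contraTneq vb => ->; rewrite adj_irrefl.
have aJ := alphaD_cnbr vS; rewrite -/J in aJ.
have JE z : (z \in J) = [&& z \in S, z != v, z != a & z != b].
  by have := NvE z; rewrite !inE !negb_or; case: (z \in S); rewrite ?andbF ?andbT //= => ->;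
    rewrite negb_or.
have aSv : a \in S :\ v by rewrite !inE eq_sym vna.
have bSva : b \in (S :\ v) :\ a by rewrite !inE eq_sym anb eq_sym vnb.
have [k Ek] : exists k, alpha S = k.+1 by exists (alpha S).-1; rewrite (ltn_predK aJ).
have EJ : ((S :\ v) :\ a) :\ b = J by apply/setP => z; rewrite JE !inE; btauto_set.
have EA : (S :\ v) :\: cnbr a = J :\: nbr a.
  apply/setP => z; rewrite in_setD [in RHS]in_setD JE !inE negb_or.
  have [->|zb] := eqVneq z b; first by rewrite ab !andbF.
  btauto_set.
have EB : ((S :\ v) :\ a) :\: cnbr b = J :\: nbr b.
  apply/setP => z; rewrite in_setD [in RHS]in_setD JE !inE negb_or.
  btauto_set.
rewrite {1}/mis Ek (indep_sets_rec _ vS) (indep_sets_rec _ aSv) (indep_sets_rec _ bSva) EJ EA EB -/J.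
have leJ : alpha J <= k by rewrite -ltnS -Ek.
have leA X : X \subset J -> #|indep_sets X k| <= mis X.
  by move=> XJ; apply: indep_sets_leq_mis; apply: leq_trans (alphaS XJ) leJ.
rewrite (indep_sets_gt (_ : alpha J < k.+1)) //.
have := leA J (subxx _); have := leA _ (subsetDl J (nbr a)); have := leA _ (subsetDl J (nbr b)).
by clear; lia.
Qed.

(** A maximum independent set contains v alone, a alone, b alone, or a and b. The
    rests of the sets of the second and third kinds are all different: a rest that
    occurred for both a and b would avoid the neighbours of both, and adding a and b
    to it would give an independent set that is too large. Together these two kinds
    are therefore at most m(J), as are the sets of the first kind. *)
Lemma mis_cherry S v a b : v \in S -> nbr v :&: S = [set a; b] -> a != b -> ~~ adj a b ->
  mis S <= 2 * mis (S :\: cnbr v) + mis ((S :\: cnbr v) :\: (nbr a :|: nbr b)).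
Proof.
move=> vS Nv anb ab; set J := S :\: cnbr v.
have /setP NvE := Nv.
have [va aS] : adj v a /\ a \in S by have := NvE a; rewrite !inE eqxx => /andP.
have [vb bS] : adj v b /\ b \in S by have := NvE b; rewrite !inE eqxx orbT => /andP.
have vna : v != a by apply: contraTneq va => ->; rewrite adj_irrefl.
have vnb : v != b by apply: contraTneq vb => ->; rewrite adj_irrefl.
have aJ := alphaD_cnbr vS; rewrite -/J in aJ.
have JE z : (z \in J) = [&& z \in S, z != v, z != a & z != b].
  by have := NvE z; rewrite !inE !negb_or; case: (z \in S); rewrite ?andbF ?andbT //= => ->;
    rewrite negb_or.
have aSv : a \in S :\ v by rewrite !inE eq_sym vna.
have bSva : b \in (S :\ v) :\ a by rewrite !inE eq_sym anb eq_sym vnb.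
have bSNa : b \in (S :\ v) :\: cnbr a by rewrite !inE eq_sym (negbTE anb) (negbTE ab) eq_sym vnb.
have EJ : ((S :\ v) :\ a) :\ b = J by apply/setP => z; rewrite JE !inE; btauto_set.
have EA : ((S :\ v) :\: cnbr a) :\ b = J :\: nbr a.
  apply/setP => z; rewrite in_setD1 in_setD [in RHS]in_setD JE !inE negb_or.
  btauto_set.
have EB : ((S :\ v) :\ a) :\: cnbr b = J :\: nbr b.
  apply/setP => z; rewrite in_setD [in RHS]in_setD JE !inE negb_or.
  btauto_set.
have EW : ((S :\ v) :\: cnbr a) :\: cnbr b = J :\: (nbr a :|: nbr b).
  apply/setP => z; rewrite [in RHS]in_setD JE !inE !negb_or.
  btauto_set.
have a2 : alpha (J :\: (nbr a :|: nbr b)) < (alpha S).-1.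
  rewrite -EW; apply: leq_trans (alphaD_cnbr bSNa) _.
  rewrite -ltnS (ltn_predK aJ); apply: leq_trans (alphaD_cnbr aSv) (alphaD1 _ _).
have [k Ek] : exists k, alpha S = k.+2.
  by exists (alpha S).-2; move: a2; clear; case: (alpha S) => [|[]].
rewrite {1}/mis Ek (indep_sets_rec _ vS) (indep_sets_rec _ aSv) (indep_sets_rec _ bSva).
rewrite (indep_sets_rec _ bSNa) EJ EA EB EW -/J.
have leJ : alpha J <= k.+1 by rewrite -ltnS -Ek.
rewrite (indep_sets_gt (_ : alpha J < k.+2)) //.
have h1 := indep_sets_leq_mis leJ.
have h2 : #|indep_sets (J :\: (nbr a :|: nbr b)) k| <= mis (J :\: (nbr a :|: nbr b)).
  by apply: indep_sets_leq_mis; move: a2; rewrite Ek.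
have h3 : #|indep_sets (J :\: nbr a) k.+1| + #|indep_sets (J :\: nbr b) k.+1| <=
    #|indep_sets J k.+1|.
  have JS : J \subset S by apply: subsetDl.
  clearbody J; rewrite -cardsUI (_ : _ :&: _ = set0) ?cards0 ?addn0; last first.
    apply/setP => A; rewrite !inE !subsetD; apply/negP.
    move=> /andP[/and3P[/andP[AJ dA] iA /eqP cA] /and3P[/andP[_ dB] _ _]].
    have AS : A \subset S by apply: subset_trans AJ JS.
    have : independent (a |: (b |: A)).
      rewrite !indepU1 iA dB /=; rewrite -setI_eq0 setIUl setU_eq0 !setI_eq0 dA andbT.
      by rewrite disjoints1 inE.
    have sub : a |: (b |: A) \subset S by rewrite !subUset !sub1set aS bS.
    move/(leq_alpha sub); rewrite !cardsU1 !inE (negbTE anb) /=.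
    have := subsetP AJ a; have := subsetP AJ b; rewrite !JE !eqxx !andbF.
    by case: (b \in A) => [/(_ isT)//|_]; case: (a \in A) => [/(_ isT)//|_]; rewrite cA Ek ltnn.
  apply: subset_leq_card; rewrite subUset; apply/andP; split; apply/subsetP => A; rewrite !inE subsetD;
    by case/and3P => /andP[-> _] -> ->.
by move: h1 h2 h3; clear; lia.
Qed.

Lemma card_parts (N X Y : {set G}) : [disjoint X & Y] -> #|N :&: X| + #|N :&: Y| <= #|N|.
Proof.
move=> d; rewrite -cardsUI -!setIUr setIACA setIid (disjoint_setI0 d) setI0 cards0 addn0.
exact/subset_leq_card/subsetIl.
Qed.

(** With all degrees at most three, a and b send at most two edges each into J, and
    only one each if they are adjacent. As S minus any vertex is connected, every
    component of J is joined to both a and b, which bounds the number of components,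
    and, unless it is a single vertex, receives edges at two different vertices, which bounds W and Z. *)
Lemma degree2P S v : conn S -> biconn S -> 3 < #|S| -> v \in S -> degree_in S v = 2 ->
  (forall u, u \in S -> degree_in S u <= 3) -> degree2_spec S.
Proof.
move=> cS bS S3 vS dv d3.
have /eqP/cards2P[a [b [anb Nv]]] := dv.
have /setP NvE := Nv; pose J := S :\: cnbr v.
have cJ : #|S| = #|J| + 3 by rewrite -(card_setD_cnbr vS) dv.
have [va aS] : adj v a /\ a \in S by have := NvE a; rewrite !inE eqxx => /andP.
have [vb bS'] : adj v b /\ b \in S by have := NvE b; rewrite !inE eqxx orbT => /andP.
have JE z : (z \in J) = [&& z \in S, z != v, z != a & z != b].
  by have := NvE z; rewrite !inE !negb_or; case: (z \in S); rewrite ?andbF ?andbT //= => ->;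
    rewrite negb_or.
have J0 : J != set0 by rewrite -card_gt0; move: cJ S3; clear; lia.
have JS : J \subset S by apply: subsetDl.
have vJ z : z \in J -> ~~ adj v z.
  by rewrite !inE negb_or => /andP[/andP[]].
(* S - w is connected, so a union X of components of J still has, outside w, an
   edge that leaves it; such an edge can only end in a or b. *)
have attach w X : w \in S -> closed_in X J -> X :\ w != set0 ->
    exists z c, [/\ z \in X :\ w, c != w, adj c z & (c == a) || (c == b)].
  move=> wS /closed_inP[XJ HX] n0.
  have sub : X :\ w \subset S :\ w by apply: setSD; apply: subset_trans XJ JS.
  have [z0 z0X] := set0Pn _ n0.
  have ne : X :\ w != S :\ w.
    apply/eqP => E; have notin c : c \in S -> c \notin J -> c = w.
      move=> cS' cJ'; apply/eqP; have := in_setD1 c S w; rewrite -E !inE cS' andbT.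
      by case: eqVneq => //= _ /(subsetP XJ); rewrite (negbTE cJ').
    have Ea : a = w by apply: notin; rewrite ?JE ?eqxx ?andbF.
    by move: anb; rewrite Ea (notin b) ?eqxx // JE eqxx !andbF.
  have [z [c [zX]]] := conn_edge (biconnP bS wS) sub n0 ne.
  rewrite !inE => /andP[cw cS']; rewrite cw /= => cX zc; exists z, c; split=> //.
    by rewrite adj_sym.
  have zJ : z \in J by apply: (subsetP XJ); move: zX; rewrite inE => /andP[].
  have : c \notin J by apply/negP => cJ'; have := HX z c; move: zX; rewrite inE => /andP[_ ->];
    rewrite zc => /(_ isT cJ' cX).
  rewrite JE cS' /= !negb_and !negbK => /or3P[/eqP cv|->//|->]; last by rewrite orbT.
  by have := vJ z zJ; rewrite -cv adj_sym zc.
have onot c : c \in [set a; b] -> c \notin J.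
  by rewrite in_set2 => /orP[]/eqP->; rewrite JE eqxx !andbF.
have attach_ab X c d : closed_in X J -> X != set0 -> [set a; b] = [set c; d] -> c != d ->
    0 < #|nbr c :&: X|.
  move=> cX X0 Eab cd; have dS : d \in S.
    have : d \in [set a; b] by rewrite Eab !inE eqxx orbT.
    by rewrite !inE => /orP[]/eqP->.
  have dX : d \notin X.
    have dJ : d \notin J by apply: onot; rewrite Eab !inE eqxx orbT.
    by apply: contraNN dJ => dX; case/closed_inP: cX => XJ _; apply: (subsetP XJ).
  have XD : X :\ d = X by apply/setDidPl; rewrite disjoint_sym disjoints1.
  have [|z [c' [zX cd' cz]]] := attach d X dS cX; first by rewrite XD.
  have -> : (c' == a) || (c' == b) = (c' \in [set c; d]) by rewrite -Eab !inE.
  rewrite !inE (negbTE cd') orbF => /eqP Ec; apply/card_gt0P; exists z.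
  by rewrite !inE -Ec cz -XD.
have attach_a X : closed_in X J -> X != set0 -> 0 < #|nbr a :&: X|.
  by move=> cX X0; apply: (attach_ab X a b).
have attach_b X : closed_in X J -> X != set0 -> 0 < #|nbr b :&: X|.
  by move=> cX X0; apply: (attach_ab X b a) => //; rewrite 1?setUC // eq_sym.
have two X : closed_in X J -> #|X :\: (nbr a :|: nbr b)| <= #|X| - 2.
  move=> cX; have XJ : X \subset J by case/closed_inP: cX.
  have [->|X0] := eqVneq X set0; first by rewrite set0D cards0.
  have [X1|X1] := leqP #|X| 1.
    have /cards1P[z Ez] : #|X| == 1 by rewrite eqn_leq X1 card_gt0.
    have := attach_a X cX X0; rewrite Ez => /card_gt0P[y]; rewrite !inE => /andP[ay /eqP yz].
    rewrite (_ : [set z] :\: _ = set0) ?cards0 //; apply/eqP; rewrite setD_eq0 sub1set !inE -yz.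
    by rewrite ay.
  have cX' := cardsID (nbr a :|: nbr b) X.
  suff : 1 < #|X :&: (nbr a :|: nbr b)| by move: cX'; clear; lia.
  rewrite ltnNge; apply/negP => o1.
  have : 0 < #|X :&: (nbr a :|: nbr b)|.
    apply: leq_trans (attach_a X cX X0) _; apply: subset_leq_card; rewrite setIC.
    by apply: setIS; apply: subsetUl.
  rewrite leq_eqVlt ltnNge o1 orbF eq_sym => /cards1P[w Ew].
  have wX : w \in X by have := set11 w; rewrite -Ew inE => /andP[].
  have [|z [c [zX cw cz cab]]] := attach w X (subsetP JS w (subsetP XJ w wX)) cX.
    rewrite -card_gt0; move: X1; rewrite (cardsD1 w) wX; by [].
  move: zX; rewrite !inE => /andP[zw zX]; move: zw; apply/negP; rewrite negbK.
  have : z \in [set w]; last by rewrite inE.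
  by rewrite -Ew !inE zX; case/orP: cab => /eqP<-; rewrite cz ?orbT.
have Nva : #|nbr a :&: J| < degree_in S a.
  apply: proper_card; apply/properP; split; first exact: setIS.
  by exists v; rewrite !inE ?eqxx ?andbF // adj_sym va.
have parts A : closed_in A J -> A != set0 -> A != J ->
    [/\ closed_in (J :\: A) J, J :\: A != set0 & [disjoint A & J :\: A]].
  move=> cA A0 AnJ; split; first exact: closed_inD.
    rewrite setD_eq0; apply: contra AnJ => sub; rewrite eqEsubset sub andbT.
    by case/closed_inP: cA.
  by rewrite -setI_eq0 setIDA setDIl setDv set0I.
have [ab|ab] := boolP (adj a b).
  have bJ : b \notin J by apply: onot; rewrite !inE eqxx orbT.
  have vJn : v \notin J by rewrite JE eqxx andbF.
  have vb' : v != b by apply: contraTneq vb => ->; rewrite adj_irrefl.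
  have Na : #|nbr a :&: J| <= 1.
    rewrite -ltnS -ltnS; apply: leq_trans (d3 a aS); apply: leq_ltn_trans (_ : #|nbr a :&: (b |: J)| < _).
      rewrite (_ : nbr a :&: (b |: J) = b |: (nbr a :&: J)); last first.
        by rewrite setIUr; congr (_ :|: _); apply/setIidPr; rewrite sub1set inE.
      by rewrite cardsU1 inE (negbTE bJ) andbF add1n.
    apply: proper_card; apply/properP; split.
      by apply: setIS; rewrite subUset sub1set bS' JS.
    exists v; first by rewrite !inE adj_sym va vS.
    by rewrite in_setI in_setU1 (negbTE vb') (negbTE vJn) andbF.
  have connJ : conn J.
    apply/connP; split=> // A cA; have [->|A0] := eqVneq A set0; [by left | right].
    apply/eqP; apply/negPn/negP => AnJ; have [cB B0 dAB] := parts A cA A0 AnJ.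
    have := card_parts (nbr a :&: J) dAB.
    have /closed_inP[AJ _] := cA; have /closed_inP[BJ _] := cB.
    rewrite -!setIA (setIidPr AJ) (setIidPr BJ).
    by have := attach_a _ cA A0; have := attach_a _ cB B0; move: Na; clear; lia.
  have cJJ := closed_in_refl J.
  have less c : 0 < #|nbr c :&: J| -> #|J :\: nbr c| < #|J|.
    by have := cardsID (nbr c) J; rewrite setIC; clear; lia.
  apply: (@Degree2Triangle _ J (J :\: nbr a) (J :\: nbr b)) => //.
  - by apply: less; apply: attach_a.
  - by apply: less; apply: attach_b.
  exact: mis_triangle.
have bound := mis_cherry vS Nv anb ab; rewrite /= -/J in bound.
have [connJ|nconnJ] := boolP (conn J).
  by apply: (@Degree2Cherry _ J (J :\: (nbr a :|: nbr b))) => //; apply/two/closed_in_refl.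
have [X [cX X0 XnJ]] := not_conn J0 nconnJ.
have [cY Y0 dXY] := parts X cX X0 XnJ.
have Na : #|nbr a :&: J| <= 2 by rewrite -ltnS; apply: leq_trans Nva (d3 a aS).
have conn_part A B : closed_in A J -> closed_in B J -> A != set0 -> B != set0 -> [disjoint A & B] ->
    conn A.
  move=> cA cB A0 B0 dAB; apply/connP; split=> // C cC.
  have [->|C0] := eqVneq C set0; [by left | right].
  apply/eqP; apply/negPn/negP => CnA.
  have cD := closed_inD cC; have D0 : A :\: C != set0.
    rewrite setD_eq0; apply: contra CnA => sub; rewrite eqEsubset sub andbT.
    by case/closed_inP: cC.
  have dCD : [disjoint C & A :\: C] by rewrite -setI_eq0 setIDA setDIl setDv set0I.
  have h1 := attach_a _ (closed_in_trans cC cA) C0; have h2 := attach_a _ (closed_in_trans cD cA) D0.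
  have h3 := attach_a _ cB B0.
  have /closed_inP[AJ _] := cA; have /closed_inP[BJ _] := cB; have /closed_inP[CA _] := cC.
  have := card_parts (nbr a :&: J) dAB; rewrite -!setIA (setIidPr AJ) (setIidPr BJ).
  have := card_parts (nbr a :&: A) dCD; rewrite -!setIA (setIidPr CA) (setIidPr (subsetDl A C)).
  by move: h1 h2 h3 Na; clear; lia.
have EJ : J = X :|: (J :\: X).
  by rewrite -[LHS](setID J X); congr (_ :|: _); apply/setIidPr; case/closed_inP: cX.
have aXY := closed_in_apart cX.
have aW : apart (X :\: (nbr a :|: nbr b)) ((J :\: X) :\: (nbr a :|: nbr b)).
  by apply: apartS aXY; apply: subsetDl.
apply: (@Degree2Split _ X (J :\: X) (X :\: (nbr a :|: nbr b)) ((J :\: X) :\: (nbr a :|: nbr b))).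
- exact: conn_part dXY.
- by apply: conn_part (cY) (cX) _ _ _ => //; rewrite disjoint_sym.
- rewrite cJ {1}EJ -cardsUI (_ : X :&: _ = set0) ?cards0 ?addn0 //.
  exact: disjoint_setI0.
- exact: two.
- exact: two.
by rewrite -(misU aXY) -(misU aW) -setDUl -EJ.
Qed.

End Degrees.

(** * Disjoint unions of cliques and the bounds for arbitrary graphs *)

Section Clusters.
Variable G : sgraph.
Implicit Types (A B C S I W Z D H X Y M J K N : {set G}) (u v x y a b : G).

Definition clique K := [forall x in K, forall y in K, (x != y) ==> adj x y].

Lemma cliqueP K : reflect {in K &, forall x y, x != y -> adj x y} (clique K).
Proof.
apply: (iffP forall_inP) => [H x y xK yK|H x xK].
  by have /forall_inP/(_ y yK)/implyP := H x xK.
by apply/forall_inP => y yK; apply/implyP; apply: H.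
Qed.

Lemma cliqueS A B : A \subset B -> clique B -> clique A.
Proof. by move=> /subsetP AB /cliqueP H; apply/cliqueP => x y /AB xB /AB; apply: H. Qed.

Lemma alpha_gt0 S : S != set0 -> 0 < alpha S.
Proof.
case/set0Pn => v vS; rewrite -(cards1 v); apply: leq_alpha (indep1 v).
by rewrite sub1set.
Qed.

Lemma clique_alpha K : clique K -> alpha K <= 1.
Proof.
move=> /cliqueP H; apply/bigmax_leqP => A /andP[/subsetP AK /indepP iA].
rewrite leqNgt; apply/negP => /card_gt1P[x [y [xA yA xy]]].
by have := iA x y xA yA; rewrite H // AK.
Qed.

Lemma alpha_clique S : alpha S <= 1 -> clique S.
Proof.
move=> a1; apply/cliqueP => x y xS yS xy; apply/negPn/negP => nxy.
have sub : x |: [set y] \subset S by rewrite subUset !sub1set xS yS.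
have := leq_alpha sub; rewrite indepU1 indep1 disjoints1 inE nxy => /(_ isT).
by rewrite cardsU1 cards1 inE xy leqNgt ltnS a1.
Qed.

Lemma clique_alphaE K : clique K -> K != set0 -> alpha K = 1.
Proof. by move=> cK K0; apply/eqP; rewrite eqn_leq clique_alpha // alpha_gt0. Qed.

Lemma clique_misE K : clique K -> mis K = maxn 1 #|K|.
Proof.
have [->|K0 cK] := eqVneq K set0; first by rewrite mis0 cards0.
rewrite (maxn_idPr _) ?card_gt0 // /mis clique_alphaE //.
rewrite -(card_imset _ (@set1_inj G)); apply: eq_card => A; rewrite inE.
apply/and3P/imsetP => [[AK _ /cards1P[x Ax]]|[x xK ->]].
  by exists x => //; rewrite -sub1set -Ax.
by rewrite sub1set xK indep1 cards1.
Qed.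

(** S is a disjoint union of cliques without edges between them. The list records,
    for each clique, its size and the number of its vertices in N, which is all that
    the counts of S and of S minus N depend on. *)
Inductive cluster N : seq (nat * nat) -> {set G} -> Prop :=
| ClusterNil : cluster N [::] set0
| ClusterCons K l S : K != set0 -> clique K -> apart K S -> cluster N l S ->
    cluster N ((#|K|, #|N :&: K|) :: l) (K :|: S).

Lemma apart0 S : apart S set0.
Proof. by apply/apartP; split=> [|x y _]; rewrite ?inE // -setI_eq0 setI0. Qed.

Lemma cluster1 N K : K != set0 -> clique K -> cluster N [:: (#|K|, #|N :&: K|)] K.
Proof.
by move=> K0 cK; rewrite -[X in cluster N _ X]setU0; apply: ClusterCons (apart0 K) (ClusterNil N).
Qed.

Lemma cluster_cat N l1 l2 A B : cluster N l1 A -> cluster N l2 B -> apart A B ->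
  cluster N (l1 ++ l2) (A :|: B).
Proof.
elim=> [|K l S K0 cK aKS cS IH] cB aAB; first by rewrite set0U.
rewrite -setUA; apply: ClusterCons => //.
  rewrite apartC; apply: apartUl; first by rewrite apartC.
  by rewrite apartC; apply: apartS aAB; rewrite ?subsetUl.
by apply: IH => //; apply: apartS aAB; rewrite ?subsetUr.
Qed.

Lemma cluster_retype N N' l S : cluster N l S ->
  exists2 l', cluster N' l' S & unzip1 l' = unzip1 l.
Proof.
elim=> [|K {}l {}S K0 cK aKS _ [l' cS E]]; first by exists [::]; [apply: ClusterNil | ].
by exists ((#|K|, #|N' :&: K|) :: l'); [apply: ClusterCons | rewrite /= E].
Qed.

Lemma cluster_mem N l S p : cluster N l S -> p \in l ->
  exists K S', [/\ K != set0, clique K, apart K S', S = K :|: S' & cluster N (rem p l) S']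
    /\ p = (#|K|, #|N :&: K|).
Proof.
elim=> // K {}l {}S K0 cK aKS cS IH; rewrite inE; case: eqVneq => [-> _|pn /= pl].
  by exists K, S; split=> //; split=> //=; rewrite eqxx.
have [K' [S' [[K0' cK' a' E c'] Ep]]] := IH pl; exists K', (K :|: S'); split=> //; split=> //.
- rewrite apartC; apply: apartUl; last by rewrite apartC.
  by apply: apartS aKS; rewrite ?E ?subsetUl.
- by rewrite E setUCA.
rewrite /= eq_sym (negbTE pn); apply: ClusterCons => //.
by apply: apartS aKS; rewrite ?E ?subsetUr.
Qed.

Lemma cluster_perm N l l' S : perm_eq l l' -> cluster N l S -> cluster N l' S.
Proof.
elim: l' l S => [|p l' IH] l S; first by move=> /perm_nilP->.
move=> pl cS; have pin : p \in l by rewrite (perm_mem pl) inE eqxx.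
have [K [S' [[K0 cK aK -> c'] Ep]]] := cluster_mem cS pin.
rewrite Ep; apply: ClusterCons => //; apply: IH c'.
by rewrite -(perm_cons p); apply: perm_trans pl; rewrite perm_sym perm_to_rem.
Qed.

Lemma cluster_bound N l S : cluster N l S -> all (fun p => (0 < p.1) && (p.2 <= p.1)) l.
Proof.
elim=> //= K {}l {}S K0 _ _ _ ->; rewrite card_gt0 K0 andbT.
exact/subset_leq_card/subsetIr.
Qed.

Lemma cluster_card N l S : cluster N l S -> #|S| = sumn (unzip1 l).
Proof.
elim=> [|K {}l {}S _ _ aKS _ IH] /=; first by rewrite cards0.
by rewrite cardsU -IH (disjoint_setI0 _) ?cards0 ?subn0 //; case/apartP: aKS.
Qed.

Lemma cluster_alpha N l S : cluster N l S -> alpha S = size l.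
Proof.
by elim=> [|K {}l {}S K0 cK aKS _ IH] /=; rewrite ?alpha0 // alphaU // clique_alphaE // IH.
Qed.

Lemma cluster_mis N l S : cluster N l S -> mis S = \prod_(p <- l) p.1.
Proof.
elim=> [|K {}l {}S K0 cK aKS _ IH] /=; first by rewrite mis0 big_nil.
by rewrite misU // clique_misE // big_cons /= IH (maxn_idPr _) ?card_gt0.
Qed.

(** A clique contributes to the independence number of S minus N unless N swallows
    it. *)
Lemma cluster_alphaD N l S : cluster N l S -> alpha (S :\: N) = count (fun p => p.2 < p.1) l.
Proof.
elim=> [|K {}l {}S K0 cK aKS _ IH] /=; first by rewrite set0D alpha0.
rewrite setDUl alphaU; last by apply: apartS aKS; apply: subsetDl.
rewrite IH; congr (_ + _); have [E|K1] := eqVneq (K :\: N) set0.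
  by rewrite E alpha0 setIC -(cardsID N K) E cards0 addn0 ltnn.
rewrite clique_alphaE ?(cliqueS (subsetDl _ _)) //.
rewrite setIC -(cardsID N K) -[X in X < _]addn0 ltn_add2l card_gt0 K1 //.
Qed.

Lemma cluster_misD N l S : cluster N l S -> mis (S :\: N) = \prod_(p <- l) maxn 1 (p.1 - p.2).
Proof.
elim=> [|K {}l {}S K0 cK aKS _ IH] /=; first by rewrite set0D mis0 big_nil.
rewrite setDUl misU; last by apply: apartS aKS; apply: subsetDl.
rewrite big_cons IH clique_misE ?(cliqueS (subsetDl _ _)) //=; congr (maxn _ _ * _).
by rewrite cardsD setIC.
Qed.

(** The two bounds are proved together: deleting vertices from a connected set
    produces arbitrary sets, and branching at a cut vertex uses the connected bound
    for the components. *)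
Definition bounded S := mis S <= moon #|S| /\ (conn S -> mis S <= conn_bound #|S|).

(** A linear function of A and B, subject to A <= gj and A + B <= gj + ex, is
    largest at A = gj, B = ex if A has the larger weight; the other case is a
    consequence of the bounds on the weights. *)
Lemma weighted_sum_bound (a A b B ck gj ex g2 : nat) : a <= ck -> A <= gj -> A + B <= gj + ex ->
  b <= g2 -> g2 <= ck -> a * A + b * B <= ck * gj + g2 * ex.
Proof.
move=> ack Agj AB bg gc; have [ab|ba] := leqP a b.
  have : b * (A + B) <= b * (gj + ex) by rewrite leq_mul2l AB orbT.
  have : a * A <= b * A by rewrite leq_mul2r ab orbT.
  have : b * gj <= ck * gj by rewrite leq_mul2r (leq_trans bg gc) orbT.
  have : b * ex <= g2 * ex by rewrite leq_mul2r bg orbT.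
  by clear; lia.
have : b * (A + B) <= b * (gj + ex) by rewrite leq_mul2l AB orbT.
have : (a - b) * A <= (a - b) * gj by rewrite leq_mul2l Agj orbT.
have : a * gj <= ck * gj by rewrite leq_mul2r ack orbT.
have : b * ex <= g2 * ex by rewrite leq_mul2r bg orbT.
rewrite !mulnBl; have : b * A <= a * A by rewrite leq_mul2r (ltnW ba) orbT.
have : b * gj <= a * gj by rewrite leq_mul2r (ltnW ba) orbT.
by clear; lia.
Qed.

Lemma bridge_sum_bound (a h b B ck1 ck g ex : nat) : a <= ck -> a + b <= ck1 -> h <= g + ex ->
  B <= g -> a * h + b * B <= ck1 * g + ck * ex.
Proof.
move=> ack ab hge Bg; have : a * h <= a * (g + ex) by rewrite leq_mul2l hge orbT.
have : b * B <= b * g by rewrite leq_mul2l Bg orbT.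
have : (a + b) * g <= ck1 * g by rewrite leq_mul2r ab orbT.
have : a * ex <= ck * ex by rewrite leq_mul2r ack orbT.
by clear; lia.
Qed.

Lemma card_split x D H S : x \in S -> S :\ x = D :|: H -> apart D H -> #|S| = (#|D| + #|H|).+1.
Proof.
move=> xS E /apartP[d _]; rewrite (cardsD1 x) xS E cardsU (disjoint_setI0 d) cards0 subn0.
by rewrite add1n.
Qed.

(** The two products in m(S) are a linear function of m(H) and m(H - N(x)). Their
    sum is m of the connected set x and H, so it is subject to the connected bound,
    and the worst distribution gives [pend]. *)
Lemma pendant_mis_bound S x D H : x \in S -> S :\ x = D :|: H -> apart D H -> conn D -> H != set0 ->
  1 < #|nbr x :&: D| -> alpha (D :\: nbr x) = alpha D ->
  mis S = mis D * mis H + mis (D :\: nbr x) * mis (H :\: nbr x) ->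
  mis (x |: H) = mis H + mis (H :\: nbr x) ->
  mis D <= conn_bound #|D| -> mis (D :\: nbr x) <= moon #|D :\: nbr x| ->
  mis H <= moon #|H| -> mis (x |: H) <= conn_bound #|x |: H| ->
  [/\ 2 < #|D|, 0 < #|H|, #|S| = (#|D| + #|H|).+1 & mis S <= pend #|D| #|H|].
Proof.
move=> xS E aDH cD H0 N1 aD -> mU mD mDN mH; rewrite mU => mxH.
have /connP[D0 _] := cD; have cN : #|D :\: nbr x| + #|nbr x :&: D| = #|D|.
  by rewrite setIC addnC cardsID.
have DN0 : 0 < #|D :\: nbr x|.
  rewrite card_gt0; apply/eqP => E0; have := alpha_gt0 D0.
  by rewrite -aD E0 alpha0.
have D2 : 2 < #|D| by move: cN DN0 N1; clear; lia.
have xH : x \notin H by apply/negP => xH; have /setP/(_ x) := E; rewrite !inE eqxx xH orbT.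
split; rewrite ?card_gt0 ?(card_split xS E aDH) //.
apply: weighted_sum_bound => //.
- by move: mxH; rewrite cardsU1 xH add1n.
- apply: leq_trans mDN _; apply: leq_moon; move: cN N1; clear; lia.
by apply: leq_trans (moonP_conn_bound _); apply: leq_moon; move: D2; clear; lia.
Qed.

Lemma bridge_mis_bound S x D H : x \in S -> S :\ x = D :|: H -> apart D H -> conn D -> conn H ->
  0 < #|nbr x :&: H| ->
  mis S = mis D * mis H + mis (D :\: nbr x) * mis (H :\: nbr x) ->
  mis (x |: D) = mis D + mis (D :\: nbr x) ->
  mis D <= conn_bound #|D| -> mis H <= conn_bound #|H| ->
  mis (H :\: nbr x) <= moon #|H :\: nbr x| -> mis (x |: D) <= conn_bound #|x |: D| ->
  [/\ 0 < #|D|, 0 < #|H|, #|S| = (#|D| + #|H|).+1 & mis S <= bridge #|D| #|H|].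
Proof.
move=> xS E aDH cD cH N0 -> mU mD mH mHN; rewrite mU => mxD.
have /connP[D0 _] := cD; have /connP[H0 _] := cH.
have cN : #|H :\: nbr x| + #|nbr x :&: H| = #|H| by rewrite setIC addnC cardsID.
have xD : x \notin D by apply/negP => xH; have /setP/(_ x) := E; rewrite !inE eqxx xH.
split; rewrite ?card_gt0 ?(card_split xS E aDH) //.
have leB : mis (H :\: nbr x) <= moon #|H|.-1.
  by apply: leq_trans mHN _; apply: leq_moon; move: cN N0; clear; lia.
apply: bridge_sum_bound => //.
by move: mxD; rewrite cardsU1 xD add1n.
Qed.

(** In a cubic set each of the |S| terms of the average is a set of |S| - 4
    vertices. *)
Lemma cubic_mis_bound S : conn S -> (forall v, v \in S -> degree_in S v = 3) ->
  (forall W, #|W| < #|S| -> mis W <= moon #|W|) ->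
  alpha S * mis S <= #|S| * moon (#|S| - 4).
Proof.
move=> cS d3 IH; apply: leq_trans (alpha_mis_average S) _.
rewrite -sum_nat_const; apply: leq_sum => v vS.
have := card_setD_cnbr vS; rewrite d3 // => c; have <- : #|S :\: cnbr v| = #|S| - 4.
  by move: c; clear; lia.
by apply: IH; move: c; clear; lia.
Qed.

Lemma mis_degree_bound S v d : v \in S -> d <= degree_in S v ->
  (forall W, #|W| < #|S| -> mis W <= moon #|W|) ->
  mis S <= mis (S :\ v) + moon (#|S|.-1 - d).
Proof.
move=> vS dv IH; apply: leq_trans (mis_branch vS) _; rewrite leq_add2l.
have c := card_setD_cnbr vS; apply: leq_trans (IH _ _) _; first by move: c; clear; lia.
by apply: leq_moon; move: c dv; clear; lia.
Qed.

Lemma biconn3_mis_bound S : conn S -> biconn S -> 3 < #|S| ->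
  (forall v, v \in S -> degree_in S v <= 3) ->
  (forall v, v \in S -> degree_in S v = 3) \/ degree2_spec S.
Proof.
move=> cS bS S3 d3; have [/forall_inP H|/forall_inPn[v vS]] :=
  boolP [forall v in S, degree_in S v == 3]; first by left=> v /H/eqP.
move=> dn3; right; apply: (degree2P cS bS S3 vS) => //.
have := biconn_degree cS bS (ltnW S3) vS; have := d3 v vS; move: dn3; clear; lia.
Qed.

Lemma average_lt (n a m g g' : nat) : n %% 3 = 2 -> 0 < g -> 3 * g <= g' -> n <= 3 * a + 1 ->
  a * m <= n * g -> m < g'.
Proof.
move=> n3 g0 gg na am; rewrite ltnNge; apply/negP => g'm.
have : a * g' <= a * m by rewrite leq_mul2l g'm orbT.
have na' : n.+1 <= 3 * a by move: n3 na; clear; lia.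
have : n.+1 * g <= (3 * a) * g by rewrite leq_mul2r na' orbT.
have : a * (3 * g) <= a * g' by rewrite leq_mul2l gg orbT.
by move: am g0; clear; lia.
Qed.

(** The average over |S| vertices is divided by an independence number of at least
    (|S| - 1) / 3. As |S| is 2 modulo 3, this is at least (|S| + 1) / 3, and the
    quotient is less than 3, whereas 3 * moon (|S| - 4) is at most moon (|S| - 1). *)
Lemma cubic_mis S : #|S| %% 3 = 2 -> 4 < #|S| -> conn S ->
  (forall v, v \in S -> degree_in S v = 3) ->
  (forall W, #|W| < #|S| -> mis W <= moon #|W|) -> mis S < moon #|S|.-1.
Proof.
move=> S3 S4 cS d3 IH; apply: average_lt (cubic_mis_bound cS d3 IH) => //.
- exact: moon_gt0.
- apply: leq_trans (moon_mul 3 _) _; apply: leq_moon; move: S4; clear; lia.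
exact: card_alpha_cubic.
Qed.

Lemma degree2_conn_bound S : degree2_spec S ->
  (forall W, #|W| < #|S| -> mis W <= moon #|W|) ->
  (forall W, #|W| < #|S| -> conn W -> mis W <= conn_bound #|W|) ->
  mis S <= conn_bound #|S|.
Proof.
move=> + IHm IHc; case.
- move=> J A B cJ SJ AJ BJ bound.
  have JS : #|J| < #|S| by rewrite SJ; clear; lia.
  apply: leq_trans bound _; rewrite SJ addn3.
  have J0 : 0 < #|J| by apply: leq_trans AJ.
  apply: leq_trans (simplicial2_conn_bound J0).
  have := IHc J JS cJ; have := IHm A (ltn_trans AJ JS); have := IHm B (ltn_trans BJ JS).
  have : moon #|A| <= moon #|J|.-1 by apply: leq_moon; move: AJ; clear; lia.
  have : moon #|B| <= moon #|J|.-1 by apply: leq_moon; move: BJ; clear; lia.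
  by clear; lia.
- move=> J W cJ SJ WJ bound.
  have JS : #|J| < #|S| by rewrite SJ; clear; lia.
  apply: leq_trans bound _; rewrite SJ addn3.
  have /connP[J0 _] := cJ; rewrite -card_gt0 in J0.
  have := IHc J JS cJ; have : mis W <= moon (#|J| - 2).
    apply: leq_trans (IHm W _) (leq_moon WJ); move: WJ JS; clear; lia.
  have [J1|J1] := leqP #|J| 1.
    have -> : #|J| = 1 by move: J0 J1; clear; lia.
    by rewrite /conn_bound /=; clear; lia.
  by have := cherry_conn_bound J1; clear; lia.
move=> X Y W Z cX cY SXY WX ZY bound.
apply: leq_trans bound _; rewrite SXY addn3.
have /connP[X0 _] := cX; have /connP[Y0 _] := cY; rewrite -!card_gt0 in X0 Y0.
apply: leq_trans (split_conn_bound X0 Y0); rewrite /split_bound leq_add // ?leq_mul2l /=.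
  by apply: leq_mul; apply: IHc => //; rewrite SXY; clear; lia.
apply: leq_mul.
  by apply: leq_trans (IHm W _) (leq_moon WX); rewrite SXY; move: WX; clear; lia.
by apply: leq_trans (IHm Z _) (leq_moon ZY); rewrite SXY; move: ZY; clear; lia.
Qed.

Lemma small_mis S : #|S| <= 1 -> mis S = 1.
Proof.
move=> S1; rewrite clique_misE; first by apply/maxn_idPl.
by apply: alpha_clique; apply: leq_trans (alpha_card S) S1.
Qed.

(** Cut vertex, large degree, degree two, or cubic. The degree that suffices is 3,
    but 4 if |S| is 2 modulo 3; only in this last case can S be cubic. *)
Lemma conn_bounded_step S : conn S -> (forall W, #|W| < #|S| -> bounded W) ->
  mis S <= conn_bound #|S|.
Proof.
move=> cS IH; have IHm W : #|W| < #|S| -> mis W <= moon #|W| by move/IH => [].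
have IHc W : #|W| < #|S| -> conn W -> mis W <= conn_bound #|W| by move/IH => [_].
have /connP[S0 _] := cS; have S1 : 0 < #|S| by rewrite card_gt0.
have del v : v \in S -> #|S :\ v| = #|S|.-1 by move=> vS; rewrite (cardsD1 v S) vS.
have [v vS] := set0Pn _ S0.
have [S2|S2] := leqP #|S| 1; first by rewrite small_mis // (_ : #|S| = 1) //; move: S1 S2; clear; lia.
have dv : 0 < degree_in S v by apply: degree_in_gt0.
have [S3|S3] := leqP #|S| 2.
  have E : #|S| = 2 by move: S2 S3; clear; lia.
  have Sv1 : #|S :\ v| <= 1 by rewrite del // E.
  by have := mis_degree_bound vS dv IHm; rewrite (small_mis Sv1) E.
have [bS|] := boolP (biconn S); last first.
  move=> /forall_inPn[x0 x0S nc]; have [] := cutP cS x0S S2 nc.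
  - move=> W WS ->; apply: leq_trans (IHm W WS) _.
    by apply: leq_trans (moonP_conn_bound _); apply: leq_moon; move: WS; clear; lia.
  - move=> x D H xS E aDH cD H0 N1 cxH aD mS mxH.
    have cSS := card_split xS E aDH; rewrite -card_gt0 in H0.
    have D0 : 0 < #|D| by rewrite card_gt0; case/connP: cD.
    have sub W : W \subset D -> #|W| < #|S|.
      by move/subset_leq_card => WD; rewrite cSS; move: WD; clear; lia.
    have xH : x \notin H by apply/negP => xH; have /setP/(_ x) := E; rewrite !inE eqxx xH orbT.
    have [] := pendant_mis_bound xS E aDH cD _ N1 aD mS mxH; rewrite -?card_gt0 //.
    + by apply: IHc => //; apply: sub.
    + by apply: IHm => //; apply: sub; apply: subsetDl.
    + by apply: IHm; rewrite cSS; clear; lia.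
    + by apply: IHc => //; rewrite cardsU1 xH cSS; move: D0; clear; lia.
    move=> D2 _ -> bound; apply: leq_trans bound _.
    exact: pend_conn_bound.
  move=> x D H xS E aDH cD cH N1 NH _ _ cxD mS mxD.
  have cSS := card_split xS E aDH.
  have H0 : 0 < #|H| by rewrite card_gt0; case/connP: cH.
  have xD : x \notin D by apply/negP => xH; have /setP/(_ x) := E; rewrite !inE eqxx xH.
  have sub W : W \subset H -> #|W| < #|S|.
    by move/subset_leq_card => WD; rewrite cSS; move: WD; clear; lia.
  have [] := bridge_mis_bound xS E aDH cD cH NH mS mxD.
  - by apply: IHc => //; rewrite cSS; clear; lia.
  - by apply: IHc => //; apply: sub.
  - by apply: IHm => //; apply: sub; apply: subsetDl.
  - by apply: IHc => //; rewrite cardsU1 xD cSS; move: H0; clear; lia.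
  move=> D0 _ -> bound; apply: leq_trans bound _.
  exact: bridge_conn_bound.
have IHd u : u \in S -> mis (S :\ u) <= conn_bound #|S|.-1.
  by move=> uS; rewrite -(del u uS); apply: IHc (biconnP bS uS); rewrite del //; move: S1; clear; lia.
pose d := if #|S| %% 3 == 2 then 4 else 3.
have [/exists_inP[u uS du]|/exists_inPn Hd] := boolP [exists u in S, d <= degree_in S u].
  apply: leq_trans (mis_degree_bound uS du IHm) _.
  apply: leq_trans (leq_add (IHd u uS) (leqnn _)) _.
  have cu := card_setD_cnbr uS.
  have Sd : d < #|S| by move: cu du; clear; lia.
  move: Sd; rewrite /d; case: #|S| S3 => // n n2; case: eqP => n3 nd /=.
    apply: leq_trans (@delete4_sparse_bound n _) (sparse_conn_bound _) => //.
    by move: n3 nd; clear; lia.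
  by apply: delete3_conn_bound; move: n3 nd; clear; lia.
have Hd3 u : u \in S -> degree_in S u <= 3.
  by move/Hd; rewrite /d; case: ifP => _; clear; lia.
have [S4|S4] := leqP #|S| 3.
  have E : #|S| = 3 by move: S3 S4; clear; lia.
  have d2 := biconn_degree cS bS S3 vS.
  apply: leq_trans (mis_degree_bound vS d2 IHm) _.
  by apply: leq_trans (leq_add (IHd v vS) (leqnn _)) _; rewrite E.
have [d3|] := biconn3_mis_bound cS bS S4 Hd3; last by move/degree2_conn_bound; apply.
have n3 : #|S| %% 3 = 2.
  by have := Hd v vS; rewrite d3 // /d; case: eqP.
apply: leq_trans (ltnW _) (moonP_conn_bound _); apply: cubic_mis => //.
by move: n3 S4; clear; lia.
Qed.

(** Deleting a vertex of degree at least min(2, |S| - 1) leaves at most one vertex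
    in the second branch, so equality forces both branches to occur. The rest is then
    extremal and a clique by induction, and it has the same independence number as S. *)
Lemma small_clique S : (forall W, #|W| < #|S| -> mis W <= moon #|W|) ->
  S != set0 -> conn S || (#|S| <= 3) -> #|S| <= 4 -> mis S = moon #|S| -> clique S.
Proof.
have [n] := ubnP #|S|; elim: n S => // n IH S; rewrite ltnS => Sn IHm S0 cS S4 mS.
have S1 : 0 < #|S| by rewrite card_gt0.
have [nc|connS] := boolP (~~ conn S).
  move: cS; rewrite (negbTE nc) /= => S3.
  have [A [cA A0 AnS]] := not_conn S0 nc.
  have /closed_inP[AS _] := cA; have aA := closed_in_apart cA.
  have E : S = A :|: (S :\: A) by rewrite -[LHS](setID S A) (setIidPr AS).
  have c : #|S| = #|A| + #|S :\: A| by rewrite -(cardsID A S) (setIidPr AS).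
  have B0 : S :\: A != set0 by rewrite setD_eq0; apply: contra AnS => sub; rewrite eqEsubset AS.
  rewrite -card_gt0 in A0; rewrite -card_gt0 in B0.
  have := mS; rewrite {1}E misU // => mE.
  have lA := IHm A; have lB := IHm (S :\: A).
  have : mis A * mis (S :\: A) <= moon #|A| * moon #|S :\: A|.
    by apply: leq_mul; [apply: lA | apply: lB]; rewrite c; move: A0 B0; clear; lia.
  rewrite mE c; move: A0 B0 S3; rewrite c.
  by case: #|A| => [|[|[|a]]]; case: #|S :\: A| => [|[|[|b]]]; rewrite /=; clear; lia.
rewrite negbK in connS.
have del v : v \in S -> #|S :\ v| = #|S|.-1 by move=> vS; rewrite (cardsD1 v S) vS.
have [S2|S2] := leqP #|S| 1; first by apply: alpha_clique; apply: leq_trans (alpha_card S) S2.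
have [v vS dv] : exists2 v, v \in S & minn 2 #|S|.-1 <= degree_in S v.
  have [u uS] := set0Pn _ S0; have := degree_in_gt0 connS uS S2 => du.
  have [S3|S3] := leqP #|S| 2; first by exists u; [exact: uS | move: S3 du; clear; lia].
  have [w] := card_gt0P du; rewrite !inE => /andP[uw wS].
  have uw' : u != w by apply: contraTneq uw => ->; rewrite adj_irrefl.
  have uwS : u |: [set w] \subset S by rewrite subUset !sub1set uS wS.
  have uw0 : u |: [set w] != set0 by apply/set0Pn; exists u; rewrite !inE eqxx.
  have uwn : u |: [set w] != S by apply: contraTneq S3 => <-; rewrite cardsU1 cards1 inE uw'.
  have [a [b [aA bS bA ab]]] := conn_edge connS uwS uw0 uwn.
  have [c ac cS'] : exists2 c, adj a c & c \in u |: [set w].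
    move: aA; rewrite in_setU1 in_set1 => /orP[]/eqP->.
      by exists w; [exact: uw | rewrite !inE eqxx orbT].
    by exists u; [rewrite adj_sym; exact: uw | rewrite !inE eqxx].
  have aS : a \in S by apply: (subsetP uwS).
  exists a; first exact: aS.
  have : 1 < degree_in S a.
    apply/card_gt1P; exists b, c; rewrite !inE ab ac bS /=; split=> //.
      by move: cS'; rewrite !inE => /orP[]/eqP->.
    by apply: contraNneq bA => ->.
  by move: S4; clear; lia.
have c := card_setD_cnbr vS.
have small : #|S :\: cnbr v| <= 1 by move: c dv S4 S2; clear; lia.
have m1 := small_mis small.
have Sv0 : S :\ v != set0 by rewrite -card_gt0 del //; move: S2; clear; lia.
have lv : mis (S :\ v) <= moon #|S|.-1 by rewrite -(del v vS); apply: IHm; rewrite del //; move: S1; clear; lia.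
have lt4 : moon #|S| = (moon #|S|.-1).+1.
  have : [|| #|S| == 2, #|S| == 3 | #|S| == 4] by move: S2 S4; clear; lia.
  by case/or3P => /eqP->.
have m0 := moon_gt0 #|S|.-1.
have mbr := mis_branch vS.
have mv : mis (S :\ v) = moon #|S|.-1.
  by move: mS mbr lv; rewrite m1 lt4; clear; lia.
case: (branchP vS) => a1 a2 mE.
- by move: mE; rewrite mS mv lt4; clear; lia.
- have : moon #|S|.-1 < 1 by move: mE; rewrite mS m1 lt4; clear; lia.
  by move: m0; clear; lia.
have cv : clique (S :\ v).
  apply: IH => //; rewrite ?del //.
  - by move: Sn S1; clear; lia.
  - by move=> W WS; apply: IHm; move: WS; clear; lia.
  - by rewrite (_ : _ <= 3) ?orbT //; move: S4; clear; lia.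
  by move: S4; clear; lia.
by apply: alpha_clique; rewrite a1; apply: clique_alpha.
Qed.

Lemma moon_mul3 (a b : nat) : a %% 3 = 0 -> b %% 3 = 0 -> moon (a + b) = moon a * moon b.
Proof.
move=> a3 b3; have -> : a = 3 * (a %/ 3) by move: a3; clear; lia.
elim: (a %/ 3) => [|k IH]; first by rewrite muln0 mul1n.
have [b0|b2] : b = 0 \/ 2 < b by move: b3; clear; lia.
  by rewrite b0 addn0 muln1.
rewrite mulnS -addnA addSn add2n moonD3 ?IH; last by move: b2; clear; lia.
case: k {IH} => [|k]; first by rewrite muln0 mul1n.
rewrite mulnA addSn add2n moonD3 //; lia.
Qed.

Lemma mul_bound_eq (a b ga gb g : nat) : 0 < a -> 0 < b -> a <= ga -> b <= gb ->
  ga * gb <= g -> a * b = g -> a = ga /\ b = gb.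
Proof.
move=> a0 b0 aga bgb gg E; have : ga * gb <= a * b by rewrite E.
have : a * gb <= ga * gb by rewrite leq_mul2r aga orbT.
have : a * b <= a * gb by rewrite leq_mul2l bgb orbT.
move=> h1 h2 h3; have /eqP : a * b = a * gb by move: h1 h2 h3; clear; lia.
have /eqP : a * gb = ga * gb by move: h1 h2 h3; clear; lia.
rewrite eqn_mul2r eqn_mul2l; have -> : gb == 0 = false by move: b0 bgb; clear; lia.
by have -> : a == 0 = false; [move: a0; clear; lia | move=> /= /eqP-> /eqP->].
Qed.

(** Equality in the Moon-Moser bound, and the gap of 8/9 below it when 3 divides
    |S|, are proved in the same induction, since
    each passes from the parts of a disjoint union to the union. *)
Definition moon_facts S :=
  [/\ bounded S, mis S = moon #|S| -> exists l, cluster set0 l S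
    & #|S| %% 3 = 0 -> mis S = moon #|S| \/ 9 * mis S <= 8 * moon #|S| ].

Lemma moon_factsP S : moon_facts S.
Proof.
have [n] := ubnP #|S|; elim: n S => // n IH S; rewrite ltnS => Sn.
have IHS W : #|W| < #|S| -> moon_facts W by move=> WS; apply: IH; apply: leq_trans Sn.
have IHb W : #|W| < #|S| -> bounded W by case/IHS.
have IHm W : #|W| < #|S| -> mis W <= moon #|W| by case/IHb.
have [->|S0] := eqVneq S set0.
  rewrite /moon_facts /bounded mis0 cards0; split; [split | move=> _ | by left].
  - by [].
  - by rewrite /conn eqxx.
  by exists [::]; apply: ClusterNil.
have S1 : 0 < #|S| by rewrite card_gt0.
have [cS|nc] := boolP (conn S).
  have mb := conn_bounded_step cS IHb.
  split=> [|mS|S3]; first by split=> //; apply: leq_trans mb (conn_bound_moon _).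
    have S4 : #|S| <= 4.
      by rewrite leqNgt; apply/negP => /conn_bound_lt_moon; rewrite -mS ltnNge mb.
    have cl : clique S by apply: small_clique => //; rewrite cS.
    by exists [:: (#|S|, #|set0 :&: S|)]; apply: cluster1.
  have [S6|S6] := ltnP 5 #|S|; last first.
    have E : #|S| = 3 by move: S1 S3 S6; clear; lia.
    move: mb; rewrite E => mb; have : mis S = 3 \/ mis S <= 2 by move: mb; rewrite /conn_bound /=; clear; lia.
    by case=> [->|m2]; [left | right; move: m2; rewrite /=; clear; lia].
  have := @conn_bound_gap #|S|; rewrite S6 S3 /= => /(_ isT) gap; right.
  by move: mb gap; clear; lia.
have [A [cA A0 AnS]] := not_conn S0 nc.
have /closed_inP[AS _] := cA; have aA := closed_in_apart cA.
have E : S = A :|: (S :\: A) by rewrite -[LHS](setID S A) (setIidPr AS).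
have c : #|S| = #|A| + #|S :\: A| by rewrite -(cardsID A S) (setIidPr AS).
have B0 : S :\: A != set0 by rewrite setD_eq0; apply: contra AnS => sub; rewrite eqEsubset AS.
rewrite -card_gt0 in A0; rewrite -card_gt0 in B0.
have sA : #|A| < #|S| by rewrite c; move: B0; clear; lia.
have sB : #|S :\: A| < #|S| by rewrite c; move: A0; clear; lia.
have [[lA _] eA gA] := IHS _ sA; have [[lB _] eB gB] := IHS _ sB.
have mE := misU aA; rewrite -E in mE.
have gg := moon_mul #|A| #|S :\: A|; rewrite -c in gg.
split.
- split; last by rewrite (negbTE nc).
  by rewrite mE; apply: leq_trans gg; apply: leq_mul.
- move=> mS; rewrite mE in mS.
  have mA0 := mis_gt0 A; have mB0 := mis_gt0 (S :\: A).
  have [mA mB] : mis A = moon #|A| /\ mis (S :\: A) = moon #|S :\: A|.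
    exact: mul_bound_eq mA0 mB0 lA lB gg mS.
  have [l1 c1] := eA mA; have [l2 c2] := eB mB.
  by exists (l1 ++ l2); rewrite E; apply: cluster_cat.
move=> S3; rewrite mE.
have [A3|A3] := eqVneq (#|A| %% 3) 0.
  have B3 : #|S :\: A| %% 3 = 0 by move: S3 A3; rewrite c; clear; lia.
  rewrite c moon_mul3 //.
  case: (gA A3) => [->|hA]; last first.
    right; have : 9 * mis A * mis (S :\: A) <= 8 * moon #|A| * moon #|S :\: A| by apply: leq_mul.
    by rewrite !mulnA.
  case: (gB B3) => [->|hB]; [by left | right].
  by rewrite mulnCA [X in _ <= X]mulnCA leq_mul2l hB orbT.
right; have : mis A * mis (S :\: A) <= moon #|A| * moon #|S :\: A| by apply: leq_mul.
have [A1|A1] := eqVneq (#|A| %% 3) 1.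
  have B2 : #|S :\: A| %% 3 != 0 by move: S3 A1; rewrite c; clear; lia.
  by have := @moon_mul_gap #|A| #|S :\: A|; rewrite A1 B2 c => /(_ isT); clear; lia.
have B2 : #|S :\: A| %% 3 == 1 by move: S3 A1 A3; rewrite c; clear; lia.
have := @moon_mul_gap #|S :\: A| #|A|; rewrite A3 B2 c => /(_ isT).
by rewrite [moon #|A| * _]mulnC [#|A| + _]addnC; clear; lia.
Qed.

End Clusters.

(** * Counting cycles *)

Section Cycles.
Variable G : sgraph.
Implicit Types (A B S K N P : {set G}) (u v w x y z : G) (s p : seq G) (C : {set {set G}}).

(** A cycle is its set of edges, so its vertices are the cover. *)
Definition cycles_in S : {set {set {set G}}} := [set C | is_cycle C & cover C \subset S].
Definition cyc S := #|cycles_in S|.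
Definition ends_at v C : {set G} := [set z | [set v; z] \in C].

Lemma cyc_setT : cyc [set: G] = num_cycles G.
Proof. by apply: eq_card => C; rewrite !inE subsetT andbT. Qed.

Lemma cover_cycle_edges s : cover (cycle_edges s) = [set x in s].
Proof.
apply/setP => z; rewrite inE; apply/bigcupP/idP => [[E /imsetP[x xs ->]]|zs].
  by rewrite !inE => /orP[]/eqP->; rewrite ?mem_next.
by exists [set z; next s z]; rewrite ?inE ?eqxx //; apply/imsetP; exists z.
Qed.

Lemma is_cycle_edges s : 2 < size s -> ucycle (@adj G) s -> is_cycle (cycle_edges s).
Proof. by move=> s2 us; apply/is_cycleP; exists s. Qed.

Lemma cycU A B : [disjoint A & B] -> cyc A + cyc B <= cyc (A :|: B).
Proof.
move=> dAB; rewrite /cyc -cardsUI (_ : _ :&: _ = set0) ?cards0 ?addn0; last first.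
  apply/setP => C; rewrite !inE; apply/negP => /andP[/andP[cC CA] /andP[_ CB]].
  have /is_cycleP[s [s2 _ E]] := cC; case: s s2 E => // x s _ E.
  have xC : x \in cover C by rewrite E cover_cycle_edges inE mem_head.
  by have := disjointFr dAB (subsetP CA x xC); rewrite (subsetP CB x xC).
by apply: subset_leq_card; rewrite subUset; apply/andP; split; apply/subsetP => C; rewrite !inE;
  case/andP => -> /subset_trans; apply; rewrite ?subsetUl ?subsetUr.
Qed.

Lemma set2_eql v z x : [set v; z] = [set v; x] -> z = x.
Proof.
move=> E; have : z \in [set v; x] by rewrite -E !inE eqxx orbT.
rewrite !inE => /orP[/eqP zv|/eqP//].
have : x \in [set v; z] by rewrite E !inE eqxx orbT.
by rewrite zv !inE orbb => /eqP->.
Qed.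

(** The two neighbours of v on a cycle can be read off from its edges, so that cycles
    through v with different neighbours of v are different. *)
Lemma ends_at_cycle v p : uniq (v :: p) -> p != [::] ->
  ends_at v (cycle_edges (v :: p)) = [set head v p; last v p].
Proof.
move=> us p0; set s := v :: p.
have nv : next s v = head v p by rewrite /s; case: (p) => /= [|a q]; rewrite eqxx.
have pv : prev s v = last v p.
  have vp : v \notin p by case/andP: us.
  by rewrite /s prev_nth mem_head memNindex // -[size p]/(size (v :: p)).-1 nth_last.
have vs : v \in s by apply: mem_head.
apply/setP => z; rewrite !inE; apply/imsetP/orP.
  case=> x xs E; have : v \in [set x; next s x] by rewrite -E !inE eqxx.
  rewrite !inE => /orP[/eqP vx|/eqP vn]; [left | right].
    by move: E; rewrite -vx nv => /set2_eql->.
  have xE : x = last v p by rewrite -pv vn prev_next.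
  by move: E; rewrite -vn setUC [in RHS]setUC => E; apply/eqP; rewrite -xE;
    apply: (@set2_eql v); rewrite setUC E setUC.
case=> /eqP->; first by exists v; rewrite // nv.
by exists (last v p); rewrite -?pv ?mem_prev // next_prev // setUC.
Qed.

Lemma cycle_in S s : 2 < size s -> ucycle (@adj G) s -> {subset s <= S} ->
  cycle_edges s \in cycles_in S.
Proof.
move=> s2 us sS; rewrite inE is_cycle_edges // cover_cycle_edges.
by apply/subsetP => x; rewrite inE => /sS.
Qed.

Lemma cyc_triangle K : clique K -> #|K| = 3 -> 0 < cyc K.
Proof.
move=> /cliqueP cK K3; have : 2 < #|K| by rewrite K3.
case/card_gt2P => x [y [z [[xK yK zK] [xy yz zx]]]].
apply/card_gt0P; exists (cycle_edges [:: x; y; z]); apply: cycle_in => //.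
  by rewrite /ucycle /= !cK // !inE negb_or xy yz eq_sym zx.
by move=> t; rewrite !inE => /or3P[]/eqP->.
Qed.

Definition cycles_at v S : {set {set {set G}}} :=
  [set C | [&& is_cycle C, cover C \subset v |: S & v \in cover C]].

Lemma cyc_setU1 v S : v \notin S -> cyc S + #|cycles_at v S| <= cyc (v |: S).
Proof.
move=> vS; rewrite /cyc -cardsUI (_ : _ :&: _ = set0) ?cards0 ?addn0; last first.
  apply/setP => C; rewrite !inE; apply/negP => /andP[/andP[_ CS] /and3P[_ _ vC]].
  by rewrite (subsetP CS v vC) in vS.
apply: subset_leq_card; rewrite subUset; apply/andP; split; apply/subsetP => C; rewrite !inE.
  by case/andP => -> /subset_trans; apply; rewrite subsetUr.
by case/and3P => -> ->.
Qed.

Lemma conn_connect S u w : conn S -> u \in S -> w \in S ->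
  exists p, [/\ path (@adj G) u p, last u p = w, uniq (u :: p) & {subset u :: p <= S}].
Proof.
move=> cS uS wS; pose e := [rel x y | adj x y && (y \in S)].
pose A := [set x in S | connect e u x].
have uA : u \in A by rewrite inE uS connect0.
have AS : A = S.
  have /connP[_ H] := cS; have [|E|//] := H A; last by rewrite E inE in uA.
  apply/closed_inP; split; first by apply/subsetP => x; rewrite inE => /andP[].
  move=> a b; rewrite !inE => /andP[aS ua] bS; rewrite bS /= => nb.
  by apply: contraNN nb => ab; apply: connect_trans ua (connect1 _); rewrite /= ab bS.
have : w \in A by rewrite AS.
rewrite inE => /andP[_ /connectP[p pp Ew]].
case/shortenP: pp Ew => p' pp' up' _ Ew; exists p'; split=> //.
  by apply: sub_path pp' => a b /andP[].
move=> x; rewrite inE => /orP[/eqP->//|]; move: x.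
clear uS up' Ew uA AS A; elim: p' u pp' => //= a q IH u /andP[/andP[_ aS] pq] x.
by rewrite inE => /orP[/eqP->//|]; apply: IH pq x.
Qed.

(** Any two neighbours of v in the connected set S are joined by a path in S, which
    v closes to a cycle; the pair of neighbours is determined by the cycle. *)
Lemma cyc_conn_vertex v S : v \notin S -> conn S -> cyc S + 'C(#|nbr v :&: S|, 2) <= cyc (v |: S).
Proof.
move=> vS cS; apply: leq_trans (cyc_setU1 vS); rewrite leq_add2l.
rewrite -cards_draws; apply: leq_trans (leq_imset_card (ends_at v) _).
apply/subset_leq_card/subsetP => P; rewrite inE => /andP[PN /cards2P[u [w [uw EP]]]].
have [vu uS] : adj v u /\ u \in S.
  by have := subsetP PN u; rewrite EP !inE eqxx => /(_ isT)/andP.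
have [vw wS] : adj v w /\ w \in S.
  by have := subsetP PN w; rewrite EP !inE eqxx orbT => /(_ isT)/andP.
have [p [pp lp up sub]] := conn_connect cS uS wS.
have us : uniq (v :: u :: p) by rewrite cons_uniq up andbT; apply: contraNN vS => /sub.
apply/imsetP; exists (cycle_edges (v :: u :: p)); last by rewrite ends_at_cycle //= lp EP.
have p0 : 0 < size p by case: p lp {pp up sub us} => //= E; rewrite E eqxx in uw.
rewrite inE is_cycle_edges ?cover_cycle_edges //; last first.
  by rewrite /ucycle us andbT /= vu rcons_path pp /= lp adj_sym.
rewrite inE mem_head andbT; apply/subsetP => x; rewrite in_set in_cons in_setU1.
by case/orP => [->//|/sub->]; rewrite orbT.
Qed.

(** Among the cycles through a fixed vertex v there are, for each of the three
    pairs of neighbours of v, one of length 3 and one of length 4; a triangle avoids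
    v. *)
Lemma cyc_clique4 K : clique K -> #|K| = 4 -> 6 < cyc K.
Proof.
move=> cK K4; have [v vK] : exists v, v \in K by apply/card_gt0P; rewrite K4.
pose S := K :\ v; have vS : v \notin S by rewrite !inE eqxx.
have S3 : #|S| = 3 by apply/eqP; rewrite -(eqn_add2l 1) -[X in X == _]/(true + #|S|) -{1}vK -cardsD1 K4.
have cS : clique S by apply: cliqueS cK; apply: subD1set.
have vadj x : x \in S -> adj v x.
  by rewrite !inE => /andP[xv xK]; move/cliqueP: cK; apply; rewrite // eq_sym.
have adjS x y : x \in S -> y \in S -> x != y -> adj x y by move/cliqueP: cS => H *; apply: H.
suff H6 : 6 <= #|cycles_at v S|.
  have := cyc_setU1 vS; rewrite setD1K // => le; have := cyc_triangle cS S3.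
  by move: le H6; clear; lia.
(* A cycle through v is sent to the two neighbours of v on it and to whether its
   length is 3; all six combinations occur. *)
pose D := setX [set P : {set G} | P \subset S & #|P| == 2] [set: bool].
have D6 : #|D| = 6 by rewrite cardsX cards_draws S3 cardsT card_bool.
rewrite -D6; apply: leq_trans (leq_imset_card (fun C => (ends_at v C, #|cover C| == 3)) _).
apply/subset_leq_card/subsetP => -[P b]; rewrite in_setX !inE andbT => /= /andP[PS].
case/cards2P => x [y [xy EP]].
have xS : x \in S by apply: (subsetP PS); rewrite EP !inE eqxx.
have yS : y \in S by apply: (subsetP PS); rewrite EP !inE eqxx orbT.
have [z [zS zx zy]] : exists z, [/\ z \in S, z != x & z != y].
  have : 0 < #|S :\: P| by rewrite cardsD (setIidPr PS) S3 EP cards2 xy.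
  by case/card_gt0P => z; rewrite EP in_setD in_set2 negb_or => /andP[/andP[zx zy] zS]; exists z.
have nv t : t \in S -> v != t by move=> tS; apply: contraNneq vS => ->.
apply/imsetP; case: b.
  have us : uniq [:: v; x; y] by rewrite /= !inE negb_or !nv ?xy.
  exists (cycle_edges [:: v; x; y]).
    rewrite inE is_cycle_edges // ?cover_cycle_edges.
      rewrite inE mem_head andbT; apply/subsetP => t; rewrite in_set !in_cons in_nil orbF in_setU1.
      by case/or3P => /eqP->; rewrite ?eqxx // ?xS ?yS orbT.
    by rewrite /ucycle us /= vadj // adjS // adj_sym vadj.
  rewrite ends_at_cycle //= -EP cover_cycle_edges.
  by rewrite cardsE (card_uniqP us) eqxx.
have us : uniq [:: v; x; z; y] by rewrite /= !inE !negb_or !nv // xy eq_sym zx zy.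
exists (cycle_edges [:: v; x; z; y]).
  rewrite inE is_cycle_edges // ?cover_cycle_edges.
    rewrite inE mem_head andbT; apply/subsetP => t; rewrite in_set !in_cons in_nil orbF in_setU1.
    by case/or4P => /eqP->; rewrite ?eqxx // ?xS ?yS ?zS orbT.
  by rewrite /ucycle us /= vadj // adjS 1?eq_sym // adjS // adj_sym vadj.
by rewrite ends_at_cycle //= -EP cover_cycle_edges cardsE (card_uniqP us).
Qed.

(** The seven cycles of the K4, and at least one for each of the six pairs of
    neighbours of the fifth vertex. *)
Lemma cyc_clique5 v K : clique K -> #|K| = 4 -> v \notin K -> K \subset nbr v -> 12 < cyc (v |: K).
Proof.
move=> cK K4 vK KN; have connK : conn K.
  apply/connP; split=> [|A /closed_inP[AK HA]]; first by rewrite -card_gt0 K4.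
  have [->|/set0Pn[a aA]] := eqVneq A set0; [by left | right].
  apply/eqP; rewrite eqEsubset AK; apply/subsetP => b bK; apply/negPn/negP => bA.
  have := HA a b aA bK bA; move/cliqueP: cK => -> //; first exact: (subsetP AK).
  by apply: contraNneq bA => <-.
have := cyc_conn_vertex vK connK; rewrite (setIidPr KN) K4 => le.
by have := cyc_clique4 cK K4; move: le; rewrite (_ : 'C(4, 2) = 6) //; clear; lia.
Qed.

End Cycles.

(** * Factorizations that attain the Moon-Moser number *)

Lemma moon_ltS n : 0 < n -> moon n < moon n.+1.
Proof.
apply/implyP; move: n; apply: (@ind_step3b 2); first by vm_compute.
by move=> n n2 /implyP H; apply/implyP => _; rewrite !moonD3 // ?ltn_pmul2l //; [apply: H; lia | lia].
Qed.

Lemma moon_eqP n : moon n = n -> n <= 4.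
Proof.
move=> E; rewrite leqNgt; apply/negP => n5; move: E; apply/eqP.
suff: (4 < n) ==> (n < moon n) by rewrite n5 /= ltn_neqAle eq_sym => /andP[].
move: n {n5}; apply: (@ind_step3b 5); first by vm_compute.
by move=> n n5 H; rewrite moonD3; move: H n5; clear; lia.
Qed.

Lemma prod_leq_moon l : all (leq 1) l -> \prod_(k <- l) k <= moon (sumn l).
Proof.
have le_moon n : n <= moon n.
  move: n; apply: (@ind_step3b 2); first by vm_compute.
  by move=> n n2 H; rewrite moonD3 //; move: H n2; clear; lia.
elim: l => [|k l IH] /=; first by rewrite big_nil.
move=> /andP[k0 /IH H]; rewrite big_cons; apply: leq_trans (moon_mul _ _).
exact: leq_mul.
Qed.

(** By induction on the list, peeling off one factor k. Equality in the product
    forces moon k = k, hence k <= 4, and [moon_mul_gap] excludes the values of k that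
    do not fit the residue of the remaining sum. *)
Lemma prod_eq_moon l : all (leq 1) l -> \prod_(k <- l) k = moon (sumn l) ->
  [/\ sumn l %% 3 = 0 -> l = nseq (sumn l %/ 3) 3,
      sumn l %% 3 = 2 -> perm_eq l (2 :: nseq (sumn l %/ 3) 3)
    & sumn l %% 3 = 1 -> l = [:: 1] \/
        perm_eq l (4 :: nseq (sumn l %/ 3).-1 3) \/ perm_eq l (2 :: 2 :: nseq (sumn l %/ 3).-1 3)].
Proof.
elim: l => [|k l IH] /=; first by split.
move=> /andP[k0 l0]; rewrite big_cons => E.
have k_moon : k <= moon k by have := @prod_leq_moon [:: k]; rewrite /= k0 big_seq1 addn0; apply.
have p0 : 0 < \prod_(i <- l) i by rewrite big_seq prodn_cond_gt0 // => i il; apply: (allP l0).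
have [Ek El] := mul_bound_eq k0 p0 k_moon (prod_leq_moon l0) (moon_mul _ _) E.
have k4 : k <= 4 by apply: moon_eqP.
have {IH} [H0 H2 H1] := IH l0 El.
have [n En] : exists n, sumn l = n by exists (sumn l).
rewrite El En in E; rewrite En in H0 H2 H1 *.
have gap a : a %% 3 = 1 -> n %% 3 != 0 -> k = a -> False.
  move=> a1 n0 ka; have := @moon_mul_gap a n; rewrite a1 n0 -ka -E => /(_ isT).
  by rewrite -Ek; have := moon_gt0 n; move: k0; clear; nia.
case: k k0 k4 E Ek k_moon gap => [|[|[|[|[|k]]]]] // _ _ E _ _ gap.
- have n0 : n = 0.
    by apply/eqP; rewrite -leqn0 leqNgt; apply/negP => /moon_ltS; rewrite -add1n -E mul1n ltnn.
  rewrite n0 in H0 *; have -> : l = [::] by apply: H0.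
  by split=> // _; left.
- have n1 : n %% 3 != 1.
    apply/eqP => n1; have := @moon_mul_gap n 2; rewrite n1 => /(_ isT).
    by rewrite [n + 2]addnC -E -[moon 2]/2; have := moon_gt0 n; clear; lia.
  split=> n3; first by case/eqP: n1; move: n3; clear; lia.
    have -> : (2 + n) %/ 3 = n %/ 3 by move: n3; clear; lia.
    have n0 : n %% 3 = 0 by move: n3; clear; lia.
    by rewrite {1}(H0 n0).
  right; right; have -> : ((2 + n) %/ 3).-1 = n %/ 3 by move: n3; clear; lia.
  by rewrite perm_cons H2 //; move: n3; clear; lia.
- have -> : (3 + n) %/ 3 = (n %/ 3).+1 by clear; lia.
  split=> n3.
  + have n0 : n %% 3 = 0 by move: n3; clear; lia.
    by rewrite {1}(H0 n0).
  + apply: (@perm_trans _ (3 :: 2 :: nseq (n %/ 3) 3)).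
      by rewrite perm_cons H2 //; move: n3; clear; lia.
    by apply/permP => p /=; rewrite addnCA.
  have n31 : n %% 3 = 1 by move: n3; clear; lia.
  right; case: (H1 n31) => [l1|].
    by move: E; rewrite -En l1.
  have n0 : 1 < n \/ n = 1 by move: n31; clear; lia.
  case: n0 => [n0|n1]; last by case=> /perm_sumn; rewrite En n1.
  have -> : nseq (n %/ 3) 3 = 3 :: nseq (n %/ 3).-1 3 :> seq nat.
    by have -> : n %/ 3 = (n %/ 3).-1.+1 by move: n31 n0; clear; lia.
  case=> pl; [left | right].
    apply: (@perm_trans _ (3 :: 4 :: nseq (n %/ 3).-1 3)); first by rewrite perm_cons.
    by apply/permP => p /=; rewrite addnCA.
  apply: (@perm_trans _ (3 :: 2 :: 2 :: nseq (n %/ 3).-1 3)); first by rewrite perm_cons.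
  by apply/permP => p /=; rewrite addnCA [in RHS]addnCA.
have n0 : n %% 3 = 0.
  by apply/eqP/negPn/negP => n0; apply: (gap 4).
split=> n3; try by move: n3 n0; clear; lia.
right; left; have -> : ((4 + n) %/ 3).-1 = n %/ 3 by move: n0; clear; lia.
by rewrite {1}(H0 n0).
Qed.

(** * Vertices whose removal attains the Moon-Moser number *)

(** After the removal of marked vertices, a clique of size 2 with a mark contributes
    1, and a clique of size 3 contributes 2 exactly if it has a single mark. *)
Lemma prod_marks (r : seq (nat * nat)) :
  all (fun p => [&& 0 < p.2, p.2 < p.1 & p.1 <= 3]) r ->
  \prod_(p <- r) maxn 1 (p.1 - p.2) <= 2 ^ count_mem 3 (unzip1 r)
  /\ (\prod_(p <- r) maxn 1 (p.1 - p.2) = 2 ^ count_mem 3 (unzip1 r) -> all (fun p => p.2 == 1) r).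
Proof.
elim: r => [|[a b] r IH] /=; first by rewrite big_nil.
case/andP => /and3P[b0 ba a3] /IH[le eqP']; rewrite big_cons /= expnD.
have h0 : 0 < 2 ^ count_mem 3 (unzip1 r) by rewrite expn_gt0.
have {ba b0 a3}[[-> ->]|[[-> ->]|[-> ->]]] : (a = 2 /\ b = 1) \/ (a = 3 /\ b = 1) \/ (a = 3 /\ b = 2).
- by move: b0 ba a3; clear; lia.
- by rewrite /= !mul1n.
- rewrite -[maxn _ _]/2 -[2 ^ _]/2 leq_mul2l le /=; split=> // /eqP.
  by rewrite eqn_mul2l => /eqP.
rewrite -[maxn _ _]/1 -[2 ^ (_ == _)]/2 mul1n; move: le h0; clear.
move: (\prod_(_ <- _) _) (2 ^ count_mem 3 _) => P Q le h0.
by split=> [|E]; move: le h0; [|rewrite E]; clear; lia.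
Qed.

Section Tip.
Variable G : sgraph.
Implicit Types (A B S K N Q H D : {set G}) (u v w x y z : G).

Lemma mis_moon S : mis S <= moon #|S|.
Proof. by case: (moon_factsP S) => -[]. Qed.

Lemma mis_conn S : conn S -> mis S <= conn_bound #|S|.
Proof. by case: (moon_factsP S) => -[_]. Qed.

Lemma mis_gap S : #|S| %% 3 = 0 -> mis S = moon #|S| \/ 9 * mis S <= 8 * moon #|S|.
Proof. by case: (moon_factsP S) => _ _. Qed.

Lemma mis_moon_cluster S : mis S = moon #|S| -> exists l, cluster set0 l S.
Proof. by case: (moon_factsP S). Qed.

Lemma clique_setU1 y K : clique K -> K \subset nbr y -> clique (y |: K).
Proof.
move=> /cliqueP cK /subsetP KN; have adjy x : x \in K -> adj y x by move/KN; rewrite inE.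
apply/cliqueP => x z; rewrite !in_setU1 => /orP[/eqP->|xK] /orP[/eqP->|zK].
- by rewrite eqxx.
- by move=> _; apply: adjy.
- by move=> _; rewrite adj_sym; apply: adjy.
exact: cK.
Qed.

Lemma card_setU1_nbr y K : K \subset nbr y -> #|y |: K| = #|K|.+1.
Proof.
move=> /subsetP KN; rewrite cardsU1; case: (boolP (y \in K)) => // /KN.
by rewrite inE adj_irrefl.
Qed.

(** A triangle has one cycle and a K4 has seven. *)
Lemma cluster_cyc N l S : cluster N l S ->
  count_mem 3 (unzip1 l) + 7 * count_mem 4 (unzip1 l) <= cyc S.
Proof.
elim=> [|K {}l {}S K0 cK aKS _ IH] //=.
have /apartP[d _] := aKS; apply: leq_trans (cycU d); rewrite mulnDr addnACA.
apply: leq_add IH.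
case: (eqVneq #|K| 3) => [E|_]; first by rewrite E; apply: cyc_triangle.
by case: (eqVneq #|K| 4) => [E|_] //; apply: cyc_clique4.
Qed.

(** S - y attains the Moon-Moser number of an order that is 1 modulo 3, so it is a
    disjoint union of triangles with one K4 or two K2, each of which y meets. If some
    maximum independent sets contain y and others do not, then m(S) is the sum of m(S - y) and
    m(S - y - N(y)), and N(y) swallows exactly one clique K. The set y and K is again
    a clique, so a K4 among the cliques yields a K5, or a second K4, and too many
    cycles. The second term is thus at most 2 to the number of triangles outside
    K. *)
Lemma tip_bound S y s : conn S -> #|S| = 3 * s + 2 -> 1 < s -> y \in S ->
  mis (S :\ y) = moon #|S|.-1 -> cyc S < s + 12 ->
  mis S <= sparse_bound #|S| /\ (mis S = sparse_bound #|S| ->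
    cluster (nbr y) ((2, 2) :: (2, 1) :: nseq s.-1 (3, 1)) (S :\ y)).
Proof.
move=> cS Ss s1 yS mQ few; set Q := S :\ y in mQ *.
have Qs : #|Q| = 3 * s + 1 by move: Ss; rewrite (cardsD1 y) yS -/Q; clear; lia.
have SE : sparse_bound #|S| = moon #|S|.-1 + 2 ^ s.-1.
  by rewrite /sparse_bound; congr (_ + 2 ^ _.-1); rewrite Ss; clear; lia.
have pow0 : 0 < 2 ^ s.-1 by rewrite expn_gt0.
have EQ : #|S|.-1 = #|Q| by rewrite Qs Ss; clear; lia.
have [l0 cl0] : exists l, cluster set0 l Q by apply: mis_moon_cluster; rewrite mQ EQ.
have [l cl El] := cluster_retype (nbr y) cl0.
have lb := cluster_bound cl.
have mark0 p : p \in l -> 0 < p.2.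
  move=> pl; have [K [S' [[K0 cK aK EK _] ->]]] := cluster_mem cl pl.
  by apply: (conn_nbr cS yS) => //; rewrite -/Q EK; apply: apart_closed_in.
have sizes : [\/ perm_eq (unzip1 l) (4 :: nseq s.-1 3) | perm_eq (unzip1 l) (2 :: 2 :: nseq s.-1 3)].
  have l1 : all (leq 1) (unzip1 l) by rewrite all_map; apply: sub_all lb => p /andP[].
  have sl : sumn (unzip1 l) = 3 * s + 1 by rewrite -(cluster_card cl).
  have Ep : \prod_(k <- unzip1 l) k = moon (sumn (unzip1 l)).
    by rewrite big_map -(cluster_mis cl) mQ EQ sl Qs.
  have [_ _] := prod_eq_moon l1 Ep.
  rewrite sl; have -> : ((3 * s + 1) %/ 3) = s by clear; lia.
  have s3 : (3 * s + 1) %% 3 = 1 by clear; lia.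
  case/(_ s3) => [E|[]]; [|by left|by right].
  by move: sl s1; rewrite E /=; clear; lia.
have NQ : S :\: cnbr y = Q :\: nbr y.
  by apply/setP => z; rewrite !inE; case: (z == y); case: (adj y z).
have strict : mis S < sparse_bound #|S| -> mis S <= sparse_bound #|S| /\
    (mis S = sparse_bound #|S| -> cluster (nbr y) ((2, 2) :: (2, 1) :: nseq s.-1 (3, 1)) Q).
  by move=> lt; split=> [|E]; [exact: ltnW | rewrite E ltnn in lt].
case: (branchP yS) => a1 a2 mS.
- by apply: strict; rewrite mS -/Q mQ SE -[X in X < _]addn0 ltn_add2l.
- apply/strict/(leq_ltn_trans _ (moonP_sparse_bound _)).
  rewrite mS; apply: leq_trans (mis_moon _) (leq_moon _).
  by have := card_setD_cnbr yS; clear; lia.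
rewrite -/Q NQ in a1 a2 mS; rewrite a1 in a2.
rewrite (cluster_alpha cl) (cluster_alphaD cl) in a2.
rewrite mQ (cluster_misD cl) in mS.
(* The independence number drops by one, so exactly one clique p0 is swallowed. *)
have [p0 p0l p0n] : exists2 p, p \in l & ~~ (p.2 < p.1).
  by apply/allPn; rewrite all_count a2 -[X in X == _]addn0 -addn1 eqn_add2l.
set r := rem p0 l; have lr : perm_eq l (p0 :: r) by apply: perm_to_rem.
have p0E : p0.2 = p0.1.
  by apply/eqP; rewrite eqn_leq; have /andP[_ ->] := allP lb p0 p0l; rewrite leqNgt.
have rlt : all (fun p => p.2 < p.1) r.
  move: a2; rewrite all_count (permP lr) (perm_size lr) /= (negbTE p0n) add0n => -[->].
  by rewrite eqxx.
have rin p : p \in r -> p \in l by apply: mem_rem.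
have [K [S' [[K0 cK aK EK cr] Ep0]]] := cluster_mem cl p0l; rewrite -/r in cr.
have k1 : p0.1 = #|K| by rewrite Ep0.
have KN : K \subset nbr y.
  have : #|nbr y :&: K| = #|K| by rewrite -k1 -p0E Ep0.
  by move=> E; apply/setIidPr/eqP; rewrite eqEcard subsetIr E leqnn.
have dK : [disjoint (y |: K) & S'].
  have /apartP[d _] := aK; rewrite -setI_eq0 setIUl setU_eq0 !setI_eq0 d andbT disjoints1.
  apply/negP => yS'; have yQ : y \in Q by rewrite EK inE yS' orbT.
  by move: yQ; rewrite !inE eqxx.
have SU : S = (y |: K) :|: S' by rewrite -setUA -EK setD1K.
have cyc_ge : cyc (y |: K) + (count_mem 3 (unzip1 r) + 7 * count_mem 4 (unzip1 r)) <= cyc S.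
  by rewrite [in X in _ <= X]SU; apply: leq_trans (cycU dK); rewrite leq_add2l (cluster_cyc cr).
have cnt k : count_mem k (unzip1 l) = (p0.1 == k) + count_mem k (unzip1 r).
  by have /permP/(_ (pred1 k)) := perm_map (fun p : nat * nat => p.1) lr.
have cKy : clique (y |: K) by apply: clique_setU1.
have cardKy := card_setU1_nbr KN; rewrite -k1 in cardKy.
have yK : y \notin K by apply/negP => /(subsetP KN); rewrite inE adj_irrefl.
have pK : p0.1 \in unzip1 l by apply: map_f.
(* If there is a K4, a K5 arises from it or a second K4 from a triangle. *)
case: sizes => sz.
  have c3 := cnt 3; have c4 := cnt 4; rewrite !(permP sz) /= !count_nseq /= in c3 c4.
  move: pK; rewrite (perm_mem sz) inE mem_nseq => /orP[/eqP p4|/andP[_ /eqP p3]].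
    have c5 := cyc_clique5 cK (esym (etrans (esym p4) k1)) yK KN.
    rewrite p4 /= in c3 c4; move: c3 c4 c5 cyc_ge few s1; clear.
    by move: (count_mem 3 _) (count_mem 4 _) (cyc _) (cyc _); lia.
  have c5 := cyc_clique4 cKy (etrans cardKy (congr1 succn p3)).
  rewrite p3 /= in c3 c4; move: c3 c4 c5 cyc_ge few s1; clear.
  by move: (count_mem 3 _) (count_mem 4 _) (cyc _) (cyc _); lia.
have c3 := cnt 3; rewrite !(permP sz) /= !count_nseq /= in c3.
have le3 p : p \in l -> p.1 <= 3.
  move=> pl; have := map_f (fun p : nat * nat => p.1) pl; rewrite (perm_mem sz) !inE mem_nseq.
  by case/or3P => [/eqP->|/eqP->|/andP[_ /eqP->]].
have rmarks : all (fun p => [&& 0 < p.2, p.2 < p.1 & p.1 <= 3]) r.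
  by apply/allP => p pr; rewrite mark0 ?rin // le3 ?rin // (allP rlt).
have [ple peq] := prod_marks rmarks.
rewrite (perm_big _ lr) big_cons /= p0E subnn maxn0 mul1n in mS.
move: pK; rewrite (perm_mem sz) !inE mem_nseq orbA orbb.
case/orP => [/eqP p2|/andP[_ /eqP p3]].
  rewrite p2 /= mul1n !add0n in c3; rewrite -c3 in ple peq.
  rewrite mS SE; split; first by rewrite leq_add2l.
  move=> /eqP; rewrite eqn_add2l => /eqP/peq r1.
  apply: (cluster_perm _ cl); apply: (perm_trans lr).
  have -> : p0 = (2, 2) by rewrite [p0]surjective_pairing p0E p2.
  have pr : perm_eq (unzip1 r) (2 :: nseq s.-1 3).
    rewrite -(perm_cons 2) -[X in X :: unzip1 r]p2; apply: perm_trans sz; rewrite perm_sym.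
    exact: (perm_map (fun p : nat * nat => p.1) lr).
  have Er : map (fun k => (k, 1)) (unzip1 r) = r.
    by rewrite -map_comp -[RHS]map_id; apply/eq_in_map => -[a b] /(allP r1) /= /eqP->.
  rewrite perm_cons -Er; apply: perm_trans (perm_map _ pr) _.
  by rewrite /= map_nseq.
rewrite p3 /= mul1n !add0n in c3.
have lt : \prod_(p <- r) maxn 1 (p.1 - p.2) < 2 ^ s.-1.
  by apply: leq_ltn_trans ple _; rewrite ltn_exp2l // c3.
by apply: strict; rewrite mS SE ltn_add2l.
Qed.

End Tip.

(** * Connected extremal sets of order 1 modulo 3 *)

Lemma moonD4 (n : nat) : n %% 3 = 0 -> moon n.+4 = 4 * moon n.
Proof.
move=> n3; have -> : n = 3 * (n %/ 3) by move: n3; clear; lia.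
elim: (n %/ 3) => [|k IH]; first by [].
have -> : 3 * k.+1 = (3 * k).+3 by clear; lia.
rewrite -[LHS]/(moon ((3 * k).+4).+3) (@moonD3 (3 * k).+4) // IH.
case: k {IH} => [|k]; first by rewrite muln0.
by rewrite (@moonD3 (3 * k.+1)) 1?mulnCA //; clear; lia.
Qed.

(** Dropping one vertex from an order divisible by 3 replaces a factor 3 by 2. *)
Lemma moon_pred_gap m : 0 < m -> m %% 3 = 0 -> 9 * moon m.-1 <= 8 * moon m.
Proof.
move=> m0 m3; have := @moon_pred3 m; have m2 : 2 < m by move: m0 m3; clear; lia.
rewrite m2 m3 => /(_ isT); have [E|m5] : m = 3 \/ 5 < m by move: m0 m3; clear; lia.
  by rewrite E.
have -> : moon m = 3 * moon (m - 3).
  by rewrite -moonD3; [congr moon|]; move: m5; clear; lia.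
by clear; lia.
Qed.

Section Extremal.
Variable G : sgraph.
Implicit Types (A B S K N Q H D J W : {set G}) (u v w x y z : G).

Lemma clique_moon S : conn S -> #|S| <= 4 -> mis S = moon #|S| -> clique S.
Proof.
move=> cS S4 mS; apply: small_clique => //; last by rewrite cS.
  by move=> W _; apply: mis_moon.
by case/connP: cS.
Qed.

Lemma conn2_clique D : conn D -> #|D| = 2 -> clique D.
Proof.
move=> cD D2; have [a [b [ab E]]] : exists a b, a != b /\ D = [set a; b].
  by apply/cards2P; rewrite D2.
have aD : a \in D by rewrite E !inE eqxx.
have D1 : 1 < #|D| by rewrite D2.
have [c] := card_gt0P (degree_in_gt0 cD aD D1); rewrite E !inE => /andP[ac].
case/orP => /eqP Ec; first by rewrite Ec adj_irrefl in ac.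
rewrite -Ec; apply: clique_setU1; last by rewrite sub1set inE.
by apply/cliqueP => u v /set1P-> /set1P->; rewrite eqxx.
Qed.

Lemma split_coverl x S D H : x \in S -> S :\ x = D :|: H -> apart D H ->
  S = (x |: D) :|: H /\ [disjoint x |: D & H].
Proof.
move=> xS E /apartP[d _]; split; first by rewrite -setUA -E setD1K.
rewrite -setI_eq0 setIUl setU_eq0 !setI_eq0 d andbT disjoints1.
by apply/negP => xH; have /setP/(_ x) := E; rewrite !inE eqxx xH orbT.
Qed.

Lemma degree2_sparse_bound S : degree2_spec S -> 6 < #|S| -> #|S| %% 3 != 0 ->
  mis S < sparse_bound #|S|.
Proof.
move=> + S6 S3; case.
- move=> J A B cJ SJ AJ BJ bound; apply: leq_ltn_trans bound _.
  rewrite SJ addn3 in S6 S3 *.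
  have h : (3 < #|J|) && (#|J| %% 3 != 0) by move: S6 S3; clear; lia.
  apply: leq_ltn_trans (simplicial2_sparse_bound h).
  have := mis_conn cJ; have := mis_moon A; have := mis_moon B.
  have : moon #|A| <= moon #|J|.-1 by apply: leq_moon; move: AJ; clear; lia.
  have : moon #|B| <= moon #|J|.-1 by apply: leq_moon; move: BJ; clear; lia.
  by clear; lia.
- move=> J W cJ SJ WJ bound; apply: leq_ltn_trans bound _.
  rewrite SJ addn3 in S6 S3 *.
  have h : (3 < #|J|) && (#|J| %% 3 != 0) by move: S6 S3; clear; lia.
  apply: leq_ltn_trans (cherry_sparse_bound h).
  have := mis_conn cJ; have := leq_trans (mis_moon W) (leq_moon WJ).
  by clear; lia.
move=> X Y W Z cX cY SXY WX ZY bound; apply: leq_ltn_trans bound _.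
rewrite SXY addn3 in S6 S3 *.
have /connP[X0 _] := cX; have /connP[Y0 _] := cY; rewrite -!card_gt0 in X0 Y0.
have XY3 : (#|X| + #|Y|) %% 3 != 0 by move: S3; clear; lia.
apply: leq_ltn_trans (split_sparse_bound X0 Y0 XY3).
rewrite /split_bound leq_add // ?leq_mul2l /=.
  by apply: leq_mul; apply: mis_conn.
by apply: leq_mul; apply: leq_trans (mis_moon _) (leq_moon _).
Qed.

Lemma card2_sub_nbr x D : (1 < #|D| -> 1 < #|nbr x :&: D|) -> #|D| = 2 ->
  D \subset nbr x.
Proof.
move=> N1 D2; have := N1; rewrite D2 => /(_ isT) N2.
by apply/setIidPr/eqP; rewrite eqEcard subsetIr D2.
Qed.

(** If N(x) left a vertex of the clique D, the independence number of D would not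
    drop. *)
Lemma clique_sub_nbr x D : clique D -> alpha D = (alpha (D :\: nbr x)).+1 -> D \subset nbr x.
Proof.
move=> cD aD; have a0 : alpha (D :\: nbr x) = 0.
  by apply/eqP; rewrite -leqn0 -ltnS -aD; apply: clique_alpha.
rewrite -setD_eq0; apply/negPn/negP => /alpha_gt0; by rewrite a0.
Qed.

(** Count the edges between N(v) and the set J of vertices at distance at least
    two. Each vertex of J has degree 3 in S and 2 in J, so it sends exactly one edge;
    each of the three neighbours of v sends at most two, since one of its edges goes
    to v. *)
Lemma cubic_triangles S v : (forall u, u \in S -> degree_in S u = 3) -> v \in S ->
  (forall w, w \in S :\: cnbr v -> degree_in (S :\: cnbr v) w = 2) -> #|S :\: cnbr v| <= 6.
Proof.
move=> d3 vS d2; set J := S :\: cnbr v in d2 *; pose N := nbr v :&: S.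
have one w : w \in J -> #|nbr w :&: N| = 1.
  move=> wJ; have wS : w \in S by move: wJ; rewrite inE => /andP[].
  have E : nbr w :&: S = (nbr w :&: J) :|: (nbr w :&: N).
    apply/setP => z; rewrite !inE; have [->|_] /= := eqVneq z v.
      rewrite adj_irrefl /= !andbF orbF; apply/negP => /andP[wv _].
      by move: wJ; rewrite !inE adj_sym wv orbT.
    by case: (adj w z); case: (adj v z); case: (z \in S).
  have d : (nbr w :&: J) :&: (nbr w :&: N) = set0.
    apply/setP => z; rewrite !inE; by case: (adj v z); rewrite ?orbT ?andbF.
  have := d3 w wS; rewrite /degree_in E cardsU d cards0 subn0 -/(degree_in J w) d2 // add2n.
  by case.
have cN : #|N| = 3 by apply: d3.
have out a : a \in N -> #|nbr a :&: J| <= 2.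
  rewrite !inE => /andP[va aS]; rewrite -ltnS -(d3 a aS); apply: proper_card; apply/properP; split.
    by apply: setIS; apply: subsetDl.
  by exists v; rewrite !inE ?eqxx ?andbF // adj_sym va.
have E : #|J| = \sum_(w in J) #|nbr w :&: N|.
  by rewrite -sum1_card; apply: eq_bigr => w /one.
have E2 : \sum_(w in J) #|nbr w :&: N| = \sum_(a in N) #|nbr a :&: J|.
  transitivity (\sum_(w in J) \sum_(a in N) (adj w a : nat)).
    apply: eq_bigr => w _; rewrite -sum1_card big_mkcond [RHS]big_mkcond.
    by apply: eq_bigr => a _; rewrite !inE; case: (adj w a); case: (adj v a && (a \in S)).
  rewrite exchange_big /=; apply: eq_bigr => a _.
  rewrite -sum1_card big_mkcond [RHS]big_mkcond; apply: eq_bigr => w _.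
  by rewrite [in RHS]inE [w \in nbr a]inE adj_sym; case: (adj a w); case: (w \in J).
rewrite E E2; apply: (@leq_trans (\sum_(a in N) 2)); first exact: leq_sum.
by rewrite sum_nat_const cN.
Qed.

Lemma cluster_degree N l S v : cluster N l S -> all (fun p => p.1 == 3) l -> v \in S ->
  degree_in S v = 2.
Proof.
move=> cl; elim: cl v => [|K {}l {}S K0 cK aKS _ IH] v /=; first by rewrite inE.
move=> /andP[/eqP K3 l3]; have /apartP[d nadj] := aKS.
rewrite /degree_in setIUr; case/setUP => [vK|vS].
  have -> : nbr v :&: S = set0.
    by apply/setP => z; rewrite !inE; apply/negP => /andP[vz zS]; have := nadj v z vK zS; rewrite vz.
  rewrite setU0; have -> : nbr v :&: K = K :\ v.
    apply/setP => z; rewrite !inE; have [->|zv] /= := eqVneq z v; first by rewrite adj_irrefl.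
    by case zK: (z \in K); rewrite ?andbF // andbT; move/cliqueP: cK; apply; rewrite // eq_sym.
  by move: K3; rewrite (cardsD1 v) vK => -[].
have -> : nbr v :&: K = set0; last by rewrite set0U; apply: IH.
apply/setP => z; rewrite !inE; apply/negP => /andP[vz zK].
by have := nadj z v zK vS; rewrite adj_sym vz.
Qed.

(** If a cubic S attained the bound, then S minus the closed neighbourhood of v
    would attain the Moon-Moser number and be a disjoint union of triangles. By
    [cubic_triangles] there are at most two of them, and the orders 7 and 10 are
    excluded by the average. *)
Lemma extremal_cubic S : conn S -> biconn S -> #|S| %% 3 = 1 -> 4 < #|S| ->
  (forall u, u \in S -> degree_in S u = 3) -> mis S < conn_bound #|S|.
Proof.
move=> cS bS S3 S4 d3; have /connP[/set0Pn[v vS] _] := cS.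
have c := card_setD_cnbr vS; rewrite d3 // in c.
have cv := mis_conn (biconnP bS vS); have Sv : #|S :\ v| = #|S|.-1 by rewrite (cardsD1 v S) vS.
rewrite Sv in cv; have bound := mis_branch vS; set J := S :\: cnbr v in c bound.
have J3 : #|J| %% 3 = 0 by move: c S3; clear; lia.
have cJ : #|J| = #|S|.-1 - 3 by move: c; clear; lia.
have num : conn_bound #|S|.-1 + moon #|J| <= conn_bound #|S|.
  have -> : #|S| = #|S|.-1.+1 by move: S4; clear; lia.
  by rewrite cJ; apply: delete3_conn_bound; move: S3 S4; clear; lia.
have g0 := moon_gt0 #|J|.
case: (mis_gap J3) => gJ; last by move: gJ num bound cv g0; clear; lia.
have J6 : #|J| <= 6.
  apply: cubic_triangles => // w wJ; have [l cl] := mis_moon_cluster gJ.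
  apply: (cluster_degree cl) => //.
  have l1 : all (leq 1) (unzip1 l).
    by rewrite all_map; apply: sub_all (cluster_bound cl) => p /andP[].
  have Ep : \prod_(k <- unzip1 l) k = moon (sumn (unzip1 l)).
    by rewrite big_map -(cluster_mis cl) gJ (cluster_card cl).
  have [H _ _] := prod_eq_moon l1 Ep; rewrite -(cluster_card cl) in H.
  apply/allP => p pl; have : p.1 \in unzip1 l by apply: map_f.
  by rewrite (H J3) mem_nseq => /andP[_].
have IHm W : #|W| < #|S| -> mis W <= moon #|W| by move=> _; apply: mis_moon.
have := cubic_mis_bound cS d3 IHm; have := card_alpha_cubic cS d3.
have [E|E] : #|S| = 7 \/ #|S| = 10 by move: c S3 S4 J6; clear; lia.
  rewrite E -[moon _]/3 -[conn_bound _]/11; move: (alpha S) (mis S) => a m; clear.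
  by case: a => [|[|a]]; nia.
rewrite E -[moon _]/9 -[conn_bound _]/31; move: (alpha S) (mis S) => a m; clear.
by case: a => [|[|[|a]]]; nia.
Qed.

(** In the case analysis for the connected bound, equality with |S| = 1 modulo 3
    remains possible in three places only. If the cut vertex completes a component K2
    to a triangle, the other component attains the bound and the induction applies to
    it: the order drops by 3 and one cycle is lost. If S consists of the cut vertex
    and two triangles, one of them becomes a K4. If S is 2-connected, it is a K4. The
    last two have at least 8 and 7 cycles. *)
Lemma extremal_cycles S : conn S -> #|S| %% 3 = 1 -> 3 < #|S| -> mis S = conn_bound #|S| ->
  #|S| %/ 3 + 6 <= cyc S.
Proof.
have [n] := ubnP #|S|; elim: n S => // n IH S; rewrite ltnS => Sn cS S3 S4 mS.
have sE : sparse_bound #|S| = conn_bound #|S|.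
  by apply: sparse_conn_boundE; [move: S4 | move: S3]; clear; lia.
have no : mis S < sparse_bound #|S| -> #|S| %/ 3 + 6 <= cyc S by rewrite sE mS ltnn.
have [bS|] := boolP (biconn S); last first.
  move=> /forall_inPn[x0 x0S nc].
  have [||] := cutP cS x0S (ltn_trans (isT : 1 < 3) S4) nc.
  - move=> W WS mW; apply: no; apply: leq_ltn_trans (moonP_sparse_bound _); rewrite mW.
    by apply: leq_trans (mis_moon W) (leq_moon _); move: WS; clear; lia.
  - move=> x D H xS E aDH cD H0 N1 cxH aD mS' mxH; apply: no.
    have [||||D2 D0 SE le] := pendant_mis_bound xS E aDH cD H0 N1 aD mS' mxH.
    + exact: mis_conn.
    + exact: mis_moon.
    + exact: mis_moon.
    + exact: mis_conn.
    rewrite SE in S3 *; apply: leq_ltn_trans le _.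
    by apply: pend_sparse_bound => //; move: S3; clear; lia.
  move=> x D H xS E aDH cD cH N1 NH DH aD cxD mS' mxD.
  have [||||D0 H0 SE le] := bridge_mis_bound xS E aDH cD cH NH mS' mxD.
  - exact: mis_conn.
  - exact: mis_conn.
  - exact: mis_moon.
  - exact: mis_conn.
  have [SU dU] := split_coverl xS E aDH.
  have cycS' : cyc (x |: D) + cyc H <= cyc S by rewrite [in leqRHS]SU; apply: cycU.
  have xD : x \notin D by apply/negP => xH; have /setP/(_ x) := E; rewrite !inE eqxx xH.
  (* A component K2 of S - x, which x completes to a triangle. *)
  have [k2|k2] := eqVneq #|D| 2.
    have cl := conn2_clique cD k2; have DN := card2_sub_nbr N1 k2.
    have K3 : #|x |: D| = 3 by rewrite card_setU1_nbr // k2.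
    have c1 := cyc_triangle (clique_setU1 cl DN) K3.
    have j3 : #|H| %% 3 = 1 by move: S3; rewrite SE k2; clear; lia.
    have j4 : 3 < #|H| by move: j3 DH; rewrite k2; clear; lia.
    have hn : #|H| < n by move: Sn; rewrite SE k2; clear; lia.
    suff mH : mis H = conn_bound #|H|.
      by have := IH H hn cH j3 j4 mH; move: c1 cycS'; rewrite SE k2; clear; lia.
    apply/eqP; rewrite eqn_leq mis_conn //= leqNgt; apply/negP => lt.
    have := mS; rewrite mS' SE k2; have -> : mis (D :\: nbr x) = 1.
      by rewrite small_mis //; move: DN; rewrite -setD_eq0 => /eqP->; rewrite cards0.
    have mD : mis D = 2 by rewrite clique_misE // k2.
    have : mis (H :\: nbr x) <= moon #|H|.-1.
      apply: leq_trans (mis_moon _) (leq_moon _).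
      by have := cardsID (nbr x) H; rewrite setIC; move: NH; clear; lia.
    have := @sparse_boundD3 #|H|; rewrite !sparse_conn_boundE ?addSn ?add0n; try (move: j3 j4; clear; lia).
    by move: lt j4 mD; clear; move: (mis D) (mis H) (mis _) (conn_bound _) (conn_bound _); lia.
  (* Two triangles at x, in the only order where the estimate for the bridge case is
     attained. *)
  have [j3|j3] := eqVneq #|H| 3; last first.
    apply: no; rewrite SE; apply: leq_ltn_trans le _; apply: bridge_sparse_bound.
    - by rewrite D0 DH.
    - by move: S3; rewrite SE; clear; lia.
    - by move: S4; rewrite SE; clear; lia.
    by move: S3 j3 k2 D0; rewrite SE; clear; lia.
  have k3 : #|D| = 3 by move: DH S3 D0; rewrite SE j3; clear; lia.
  have mD3 := mis_moon D; rewrite k3 -[moon 3]/3 in mD3.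
  have mH3 := mis_moon H; rewrite j3 -[moon 3]/3 in mH3.
  have mxD4 := mis_conn cxD; rewrite cardsU1 xD k3 mxD -[conn_bound _]/4 in mxD4.
  have mHN : mis (H :\: nbr x) <= 2.
    apply: leq_trans (mis_moon _) (_ : _ <= moon 2); apply: leq_moon.
    by have := cardsID (nbr x) H; rewrite setIC j3; move: NH; clear; lia.
  have m11 : mis S = 11 by rewrite mS SE k3 j3.
  have [mD mH] : mis D = 3 /\ mis H = 3.
    have dN := mis_gt0 (D :\: nbr x).
    move: mS' mD3 mH3 mxD4 mHN dN; rewrite m11; clear.
    by move: (mis D) (mis H) (mis _) (mis _) => a h b B; nia.
  have clD : clique D by apply: clique_moon => //; rewrite ?k3 // mD.
  have clH : clique H by apply: clique_moon => //; rewrite ?j3 // mH.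
  have DN := clique_sub_nbr clD aD.
  have := cyc_clique4 (clique_setU1 clD DN); rewrite card_setU1_nbr // k3 => /(_ erefl).
  by have := cyc_triangle clH j3; move: cycS'; rewrite SE k3 j3; clear; lia.
have [S5|S5] := leqP #|S| 4.
  have E : #|S| = 4 by move: S4 S5; clear; lia.
  rewrite E; apply: cyc_clique4 => //; apply: clique_moon; rewrite ?E //.
  by rewrite mS E.
have S7 : 6 < #|S| by move: S3 S5; clear; lia.
have del u : u \in S -> #|S :\ u| = #|S|.-1 by move=> uS; rewrite (cardsD1 u S) uS.
have [/exists_inP[u uS du]|/exists_inPn Hd] := boolP [exists u in S, 4 <= degree_in S u].
  have IHm W : #|W| < #|S| -> mis W <= moon #|W| by move=> _; apply: mis_moon.
  apply: no; apply: leq_ltn_trans (mis_degree_bound uS du IHm) _.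
  have := mis_conn (biconnP bS uS); rewrite del // => cu.
  apply: leq_ltn_trans (leq_add cu (leqnn _)) _.
  have := @delete4_sparse_bound1 #|S|.-1; rewrite (ltn_predK S7); apply.
  by move: S3 S7; clear; lia.
have Hd3 u : u \in S -> degree_in S u <= 3 by move/Hd; rewrite -ltnNge.
have [d3|d2] := biconn3_mis_bound cS bS S4 Hd3.
  by have := extremal_cubic cS bS S3 S5 d3; rewrite mS ltnn.
by apply/no/degree2_sparse_bound => //; rewrite S3.
Qed.

End Extremal.

(** * Connected sets with few cycles *)

Section FewCycles.
Variable G : sgraph.
Implicit Types (A B S K N Q H D J W : {set G}) (u v w x y z : G).

(** H minus N(x) attains the Moon-Moser number of |H| - 1, so x has a single
    neighbour y in H. Removing y from S leaves two sets without edges between them: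
    x with D, and H minus y. *)
Lemma bridge_tip x S D H : x \in S -> S :\ x = D :|: H -> apart D H ->
  0 < #|nbr x :&: H| -> 2 < #|H| -> mis (H :\: nbr x) = moon #|H|.-1 ->
  exists2 y, y \in S & mis (S :\ y) = mis (x |: D) * moon #|H|.-1.
Proof.
move=> xS E aDH N0 H2 mHN; have /apartP[d nadj] := aDH.
have cN : #|H :\: nbr x| + #|nbr x :&: H| = #|H| by rewrite setIC addnC cardsID.
have N1 : #|nbr x :&: H| == 1.
  rewrite eqn_leq N0 andbT leqNgt; apply/negP => N2.
  have := mis_moon (H :\: nbr x); rewrite mHN leqNgt => /negP; apply.
  apply: leq_ltn_trans (_ : moon #|H|.-2 < _); first by apply: leq_moon; move: cN N2; clear; lia.
  have -> : #|H|.-1 = #|H|.-2.+1 by move: H2; clear; lia.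
  by apply: moon_ltS; move: H2; clear; lia.
have /cards1P[y Ey] := N1; have : y \in nbr x :&: H by rewrite Ey inE.
rewrite inE => /andP[xy yH]; exists y.
  have : y \in S :\ x by rewrite E inE yH orbT.
  by rewrite inE => /andP[].
have HN : H :\: nbr x = H :\ y.
  apply/setP => z; have /setP/(_ z) := Ey; rewrite !inE.
  by case: (z \in H); rewrite ?andbF // !andbT => ->.
have [SU dU] := split_coverl xS E aDH.
have yxD : y \notin x |: D by apply: contraTN yH => yxD; rewrite (disjointFr dU yxD).
have ES : S :\ y = (x |: D) :|: (H :\ y).
  by rewrite SU setDUl (setDidPl _) // disjoint_sym disjoints1.
rewrite -mHN HN ES misU //; apply/apartP; split.
  by apply: disjointWr dU; apply: subD1set.
move=> u v; rewrite -HN => /setU1P[->|uD]; rewrite inE => /andP[].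
  by rewrite inE.
by move=> _; apply: nadj.
Qed.

(** The case analysis for the connected bound once more. Equality with
    [sparse_bound], or a larger value, survives in two ways. A set of order 1 modulo 3
    attains [conn_bound] next to a K4, or inside S minus a vertex of degree four:
    [extremal_cycles] and the cycles of the K4, or the six cycles through that vertex,
    give too many cycles. Or S is a cut vertex x with a component D of one, two or
    three vertices, and the other component H minus N(x) attains the Moon-Moser
    number: [bridge_tip] gives y, as x with D is then extremal as well. *)
Lemma few_cycles_tip S : conn S -> #|S| %% 3 = 2 -> 7 < #|S| -> cyc S < #|S| %/ 3 + 12 ->
  mis S < sparse_bound #|S| \/ exists2 y, y \in S & mis (S :\ y) = moon #|S|.-1.
Proof.
have [n] := ubnP #|S|; elim: n S => // n IH S; rewrite ltnS => Sn cS S3 S8 few.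
have S1 : 1 < #|S| by move: S8; clear; lia.
have [bS|] := boolP (biconn S); last first.
  move=> /forall_inPn[x0 x0S nc].
  have [||] := cutP cS x0S S1 nc.
  - move=> W WS mW; left; apply: leq_ltn_trans (moonP_sparse_bound _); rewrite mW.
    by apply: leq_trans (mis_moon W) (leq_moon _); move: WS; clear; lia.
  - move=> x D H xS E aDH cD H0 N1 cxH aD mS mxH; left.
    have [||||D2 D0 SE le] := pendant_mis_bound xS E aDH cD H0 N1 aD mS mxH.
    + exact: mis_conn.
    + exact: mis_moon.
    + exact: mis_moon.
    + exact: mis_conn.
    have [k4|k4] := eqVneq #|D| 4; last first.
      rewrite SE in S3 *; apply: leq_ltn_trans le _.
      by apply: pend_sparse_bound => //; [move: S3; clear; lia | rewrite k4].
    have xH : x \notin H by apply/negP => xH; have /setP/(_ x) := E; rewrite !inE eqxx xH orbT.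
    have cxH' : #|x |: H| = #|H|.+1 by rewrite cardsU1 xH.
    have j3 : (2 < #|H|) && (#|H| %% 3 == 0) by move: S3 S8; rewrite SE k4; clear; lia.
    have b2 : mis (D :\: nbr x) <= 2.
      apply: leq_trans (mis_moon _) (_ : _ <= moon 2); apply: leq_moon.
      by have := cardsID (nbr x) D; rewrite setIC k4; move: N1; clear; lia.
    have AB := mis_conn cxH; rewrite cxH' mxH in AB.
    have [m3|m4] := leqP (mis D) 3.
      apply: leq_ltn_trans (_ : 3 * moon #|H| + 2 * excess #|H|.+1 < _).
        rewrite mS; apply: weighted_sum_bound => //; exact: mis_moon.
      by rewrite SE k4; apply: pend4_sparse_bound.
    have mD4 := mis_moon D; rewrite k4 -[moon 4]/4 in mD4.
    have mD : mis D = 4 by move: m4 mD4; clear; lia.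
    have clD : clique D by apply: clique_moon => //; rewrite ?k4 // mD.
    have dxH : [disjoint D & x |: H].
      rewrite setUC in E; rewrite apartC in aDH.
      by have [_] := split_coverl xS E aDH; rewrite disjoint_sym.
    have SU : S = D :|: (x |: H).
      by rewrite setUCA -E setD1K.
    have cycS' : cyc D + cyc (x |: H) <= cyc S by rewrite [in leqRHS]SU; apply: cycU.
    have ne : mis H + mis (H :\: nbr x) < conn_bound #|H|.+1.
      rewrite ltn_neqAle AB andbT; apply/eqP => eqc.
      have := @extremal_cycles _ (x |: H) cxH; rewrite cxH' mxH eqc.
      have -> : #|H|.+1 %% 3 = 1 by move: j3; clear; lia.
      have -> : 3 < #|H|.+1 by move: j3; clear; lia.
      move/(_ erefl isT erefl); have := cyc_clique4 clD k4.
      by move: few cycS' j3; rewrite SE k4; clear; lia.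
    have := clique4_sparse_bound j3; have := mis_moon H.
    move: mS ne b2; rewrite mD SE k4 -[(4 + _).+1]/(#|H|.+4.+1); clear.
    move: (mis S) (mis H) (mis (D :\: _)) (mis (H :\: _)) => m a b B -> ne b2 aH le.
    have : b * B <= 2 * B by rewrite leq_mul2r b2 orbT.
    by move: ne aH le; clear; lia.
  move=> x D H xS E aDH cD cH N1 NH DH aD cxD mS mxD.
  have [||||D0 H0 SE le] := bridge_mis_bound xS E aDH cD cH NH mS mxD.
  - exact: mis_conn.
  - exact: mis_conn.
  - exact: mis_moon.
  - exact: mis_conn.
  have [SU dU] := split_coverl xS E aDH.
  have cycS' : cyc (x |: D) + cyc H <= cyc S by rewrite [in leqRHS]SU; apply: cycU.
  have xD : x \notin D by apply/negP => xH; have /setP/(_ x) := E; rewrite !inE eqxx xH.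
  have [k4|k4] := ltnP 3 #|D|.
    left; rewrite SE; apply: leq_ltn_trans le _; apply: bridge_sparse_bound; rewrite ?k4 //.
    - by rewrite D0 DH.
    - by move: S3; rewrite SE; clear; lia.
    by move: S1 k4; clear; lia.
  have H2 : 2 < #|H| by move: k4 S8; rewrite SE; clear; lia.
  have cN : #|H :\: nbr x| + #|nbr x :&: H| = #|H| by rewrite setIC addnC cardsID.
  have leB : mis (H :\: nbr x) <= moon #|H|.-1.
    by apply: leq_trans (mis_moon _) (leq_moon _); move: cN NH; clear; lia.
  have tip : mis (H :\: nbr x) = moon #|H|.-1 ->
      mis (x |: D) * moon #|H|.-1 = moon #|S|.-1 ->
      exists2 y, y \in S & mis (S :\ y) = moon #|S|.-1.
    move=> eB em; have [y yS my] := bridge_tip xS E aDH NH H2 eB.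
    by exists y; rewrite // my em.
  have [k1|k1] := eqVneq #|D| 1.
    have mD : mis D = 1 by rewrite small_mis ?k1.
    have mDN : mis (D :\: nbr x) = 1.
      by rewrite small_mis // -k1; apply/subset_leq_card/subsetDl.
    have j3 : (2 < #|H|) && (#|H| %% 3 == 0) by move: S3 S8; rewrite SE k1; clear; lia.
    have mH := mis_conn cH; have := leaf_sparse_bound j3.
    rewrite mS mD mDN !mul1n SE k1 add1n => num.
    have [eB|nB] := eqVneq (mis (H :\: nbr x)) (moon #|H|.-1).
      right; have [|y yS my] := tip eB; last by exists y; rewrite // my SE k1.
      rewrite mxD mD mDN SE k1 add1n.
      have := @moon_double #|H|.-1; have -> : #|H|.-1 %% 3 == 2 by move: j3; clear; lia.
      have -> : #|H|.-1.+2 = #|H|.+1 by move: H2; clear; lia.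
      by move=> /(_ isT)/eqP->.
    left; rewrite -num; move: nB leB mH; clear; lia.
  have [k2|k2] := eqVneq #|D| 2.
    have cl := conn2_clique cD k2; have DN := card2_sub_nbr N1 k2.
    have K3 : #|x |: D| = 3 by rewrite card_setU1_nbr // k2.
    have clx := clique_setU1 cl DN.
    have c1 := cyc_triangle clx K3.
    have mD : mis D = 2 by rewrite clique_misE // k2.
    have mDN : mis (D :\: nbr x) = 1.
      by rewrite small_mis //; move: DN; rewrite -setD_eq0 => /eqP->; rewrite cards0.
    have j3 : #|H| %% 3 = 2 by move: S3; rewrite SE k2; clear; lia.
    have fewH : cyc H < #|H| %/ 3 + 12.
      by move: few cycS' c1; rewrite SE k2; clear; lia.
    have mH : mis H <= sparse_bound #|H|.
      have [j5|j5] := leqP #|H| 7.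
        have E5 : #|H| = 5 by move: j3 j5 H2; clear; lia.
        by have := mis_conn cH; rewrite E5.
      have hn : #|H| < n by move: Sn; rewrite SE; clear; lia.
      have [lt|[y yH my]] := IH H hn cH j3 j5 fewH; first exact: ltnW.
      have EH : #|H| = 3 * (#|H| %/ 3) + 2 by move: j3; clear; lia.
      have s1 : 1 < #|H| %/ 3 by move: j5; clear; lia.
      by have [] := tip_bound cH EH s1 yH my fewH.
    have num := @sparse_boundD3 #|H| H2.
    have [eB|nB] := eqVneq (mis (H :\: nbr x)) (moon #|H|.-1).
      right; apply: tip => //; rewrite clique_misE // K3 SE k2 -[maxn _ _]/3.
      rewrite -moonD3; last by move: H2; clear; lia.
      by congr moon; move: H2; clear; lia.
    left; rewrite mS mD mDN SE k2 -[(2 + _).+1]/(#|H|.+3) num; move: nB leB mH; clear; lia.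
  have k3 : #|D| = 3 by move: k4 k1 k2 D0; clear; lia.
  have j3 : (3 < #|H|) && (#|H| %% 3 == 1) by move: S3 S8; rewrite SE k3; clear; lia.
  have num1 := path3_sparse_bound j3; have num2 := clique3_sparse_bound j3.
  have SE' : #|S| = #|H|.+4 by rewrite SE k3.
  have mDN : mis (D :\: nbr x) = 1.
    rewrite small_mis //; have := cardsID (nbr x) D; rewrite setIC k3.
    by move: N1; rewrite k3 => /(_ isT); clear; lia.
  have mH := mis_conn cH.
  have mD3 := mis_moon D; rewrite k3 -[moon 3]/3 in mD3.
  have [m2|m3] := leqP (mis D) 2.
    left; rewrite mS mDN mul1n SE'; apply: leq_ltn_trans num1; apply: leq_add leB.
    exact: leq_mul.
  have mD : mis D = 3 by move: mD3 m3; clear; lia.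
  have clD : clique D by apply: clique_moon => //; rewrite ?k3 // mD.
  have DN := clique_sub_nbr clD aD.
  have clx := clique_setU1 clD DN; have K4 : #|x |: D| = 4 by rewrite card_setU1_nbr // k3.
  have [eB|nB] := eqVneq (mis (H :\: nbr x)) (moon #|H|.-1).
    right; apply: tip => //; rewrite clique_misE // K4 SE' -[maxn _ _]/4.
    rewrite -moonD4; last by move: j3; clear; lia.
    by congr moon; move: H2; clear; lia.
  have gap : 9 * mis (H :\: nbr x) <= 8 * moon #|H|.-1.
    have [N2|N2] := leqP #|nbr x :&: H| 1.
      have EN : #|H :\: nbr x| = #|H|.-1 by move: cN NH N2; clear; lia.
      have N3 : #|H :\: nbr x| %% 3 = 0 by rewrite EN; move: j3; clear; lia.
      by have := mis_gap N3; rewrite EN => -[E9|//]; rewrite E9 eqxx in nB.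
    apply: (@leq_trans (9 * moon #|H|.-2)).
      by rewrite leq_mul2l; apply: leq_trans (mis_moon _) (leq_moon _); move: cN N2; clear; lia.
    by apply: (@moon_pred_gap #|H|.-1); move: j3; clear; lia.
  have ne : mis H < conn_bound #|H|.
    rewrite ltn_neqAle mH andbT; apply/eqP => eqc.
    have h1 : #|H| %% 3 = 1 by move: j3; clear; lia.
    have h2 : 3 < #|H| by move: j3; clear; lia.
    have := extremal_cycles cH h1 h2 eqc; have := cyc_clique4 clx K4.
    by move: few cycS' h1; rewrite SE'; clear; lia.
  left; rewrite SE' mS mD mDN; move: num2 gap ne; clear.
  by move: (mis H) (mis (H :\: _)) => a B; lia.
have del u : u \in S -> #|S :\ u| = #|S|.-1 by move=> uS; rewrite (cardsD1 u S) uS.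
have IHm W : #|W| < #|S| -> mis W <= moon #|W| by move=> _; apply: mis_moon.
have IHd u : u \in S -> mis (S :\ u) <= conn_bound #|S|.-1.
  by move=> uS; rewrite -(del u uS); apply: mis_conn (biconnP bS uS).
have SP : #|S|.-1.+1 = #|S| := ltn_predK S8.
left.
have [/exists_inP[u uS du]|/exists_inPn Hd] := boolP [exists u in S, 5 <= degree_in S u].
  apply: leq_ltn_trans (mis_degree_bound uS du IHm) _.
  apply: leq_ltn_trans (leq_add (IHd u uS) (leqnn _)) _.
  have := @delete5_sparse_bound #|S|.-1; rewrite SP; apply.
  by move: S3 S8; clear; lia.
have [/exists_inP[u uS /eqP du]|/exists_inPn Hd4] := boolP [exists u in S, degree_in S u == 4].
  have du' : 4 <= degree_in S u by rewrite du.
  apply: leq_ltn_trans (mis_degree_bound uS du' IHm) _.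
  have num : conn_bound #|S|.-1 + moon (#|S|.-1 - 4) <= sparse_bound #|S|.
    have := @delete4_sparse_bound #|S|.-1; rewrite SP; apply.
    by move: S3 S8; clear; lia.
  apply: leq_trans num; rewrite ltn_add2r ltn_neqAle IHd // andbT; apply/eqP => eqc.
  have uSu : u \notin S :\ u by rewrite !inE eqxx.
  have := cyc_conn_vertex uSu (biconnP bS uS); rewrite setD1K //.
  have -> : nbr u :&: (S :\ u) = nbr u :&: S.
    by apply/setP => z; rewrite !inE; case: eqVneq => [->|//]; rewrite adj_irrefl.
  rewrite -/(degree_in S u) du -['C(4, 2)]/6.
  have := @extremal_cycles _ (S :\ u) (biconnP bS uS); rewrite del // eqc => /(_ _ _ erefl).
  by move: few S3 S8; clear; lia.
have Hd3 u : u \in S -> degree_in S u <= 3.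
  by move=> uS; have := Hd u uS; have := Hd4 u uS; clear; lia.
have S4 : 3 < #|S| by move: S8; clear; lia.
have [d3|d2] := biconn3_mis_bound cS bS S4 Hd3.
  by apply: ltn_trans (moonP_sparse_bound _); apply: cubic_mis => //; move: S8; clear; lia.
by apply: degree2_sparse_bound => //; [move: S8; clear; lia | rewrite S3].
Qed.

Lemma few_cycles_bound S s : conn S -> #|S| = 3 * s + 2 -> 1 < s -> cyc S < s + 12 ->
  mis S <= sparse_bound #|S| /\ (mis S = sparse_bound #|S| ->
    exists2 y, y \in S & cluster (nbr y) ((2, 2) :: (2, 1) :: nseq s.-1 (3, 1)) (S :\ y)).
Proof.
move=> cS Ss s1 few.
have S3 : #|S| %% 3 = 2 by rewrite Ss; clear; lia.
have S8 : 7 < #|S| by rewrite Ss; move: s1; clear; lia.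
have few' : cyc S < #|S| %/ 3 + 12.
  by rewrite (_ : #|S| %/ 3 = s) // Ss; clear; lia.
have [lt|[y yS my]] := few_cycles_tip cS S3 S8 few'.
  by split=> [|E]; [exact: ltnW | rewrite E ltnn in lt].
have [le eqP'] := tip_bound cS Ss s1 yS my few.
by split=> // /eqP'; exists y.
Qed.

End FewCycles.

(** * Recognition of C(n, r0) *)

Lemma sg_connected_conn (G : sgraph) : 0 < #|G| -> sg_connected G -> conn [set: G].
Proof.
move=> /card_gt0P[x0 _] cG; apply/connP; split; first by apply/set0Pn; exists x0.
move=> A /closed_inP[_ H]; have [->|/set0Pn[a aA]] := eqVneq A set0; [by left | right].
apply/eqP; rewrite eqEsubset subsetT; apply/subsetP => b _.
have /connectP[p pp ->] := cG a b; elim: p a aA pp => //= c p IH a aA /andP[ac pp].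
apply: IH pp; apply/negPn/negP => cA; have := H a c aA (in_setT c) cA.
by rewrite ac.
Qed.

Lemma num_max_independent_mis (G : sgraph) : num_max_independent G = mis [set: G].
Proof.
apply: eq_card => A; rewrite !inE subsetT /max_independent; case iA: (independent A) => //=.
apply/forallP/eqP => [H|E B]; last by apply/implyP => iB; rewrite E; apply: leq_alpha.
have [I /andP[_ iI] cI] := alpha_witness [set: G]; have /implyP/(_ iI) := H I; rewrite cI => le.
by apply/eqP; rewrite eqn_leq le andbT; apply: leq_alpha.
Qed.

Lemma c_val_sparse_bound r0 : 0 < r0 -> c_val r0 = sparse_bound (3 * r0 + 2).
Proof.
move=> r1; rewrite /c_val /sparse_bound; have -> : (3 * r0 + 2) %/ 3 = r0 by clear; lia.
rewrite subn1; congr (_ + _); case: r0 r1 => // r _; rewrite succnK.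
have -> : (3 * r.+1 + 2).-1 = (3 * r).+4 by clear; lia.
rewrite moonD4; last by clear; lia.
congr (4 * _); elim: r => // r IH; rewrite expnS IH.
have -> : 3 * r.+1 = (3 * r).+3 by clear; lia.
by case: r {IH} => // r; rewrite moonD3; [|clear; lia].
Qed.

Lemma iso_num_max (G H : sgraph) : sg_iso G H -> num_max_independent G = num_max_independent H.
Proof.
case=> f bf fadj; have [g fK gK] := bf; have fi := bij_inj bf.
have ind (A : {set G}) : independent (f @: A) = independent A.
  apply/indepP/indepP => iA x y.
    by move=> xA yA; rewrite -fadj; apply: iA; apply: imset_f.
  by move=> /imsetP[a aA ->] /imsetP[b bA ->]; rewrite fadj; apply: iA.
have img (B : {set H}) : B = f @: (g @: B).
  by rewrite -imset_comp -[LHS]imset_id; apply: eq_imset => x /=; rewrite gK.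
rewrite /num_max_independent -(card_imset _ (imset_inj fi)); apply: eq_card => B.
rewrite inE {1}[B]img (mem_imset _ _ (imset_inj fi)) inE {2}[B]img.
rewrite /max_independent ind (card_imset _ fi); congr (_ && _).
apply/forallP/forallP => M C; apply/implyP => iC.
  by have /implyP := M (g @: C); rewrite -ind -(card_imset (mem (g @: C)) fi) -img; apply.
by have /implyP := M (f @: C); rewrite ind (card_imset _ fi); apply.
Qed.

Section Target.
Variable t : nat.
Let H := dunion (copies t (complete 3)) (complete 2).

Definition block (z : H) : option 'I_t := if z is inl u then Some u.1 else None.

Lemma adj_block (u v : H) : adj u v = (block u == block v) && (u != v).
Proof.
case: u v => [[i j]|j] [[i' j']|j'] //=.
by rewrite /copies_adj /complete_adj /= (inj_eq (@Some_inj _)) (inj_eq (@inl_inj _ _)) xpair_eqE;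
  case: eqP.
Qed.

Lemma component_block (u : H) : component u = [set v | block u == block v].
Proof.
apply/setP => v; rewrite !inE; apply/connectP/eqP => [[p pp ->]|E].
  elim: p u pp => [|w p IH] u; first by [].
  move=> /andP[uw pp]; rewrite -[RHS]/(block (last w p)) -(IH w pp).
  by move: uw; rewrite adj_block => /andP[/eqP].
have [->|uv] := eqVneq u v; first by exists [::].
exists [:: v]; last by [].
by apply/andP; split; first by rewrite adj_block E eqxx uv.
Qed.

End Target.

Section Recognition.
Variable G : sgraph.
Implicit Types (N K S : {set G}) (y : G).

(** The marked vertex of the clique, if there is just one, comes first in the
    enumeration. *)
Lemma clique_enum N K k m : clique K -> #|K| = k.+1 -> #|N :&: K| = m -> (m == 1) || (m == k.+1) ->
  exists e : 'I_k.+1 -> G, [/\ forall x, x \in K -> exists j, x = e j,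
    forall j, e j \in K, forall i j, adj (e i) (e j) = (i != j) &
    forall j, (e j \in N) = ((m == k.+1) || (j == ord0))].
Proof.
move=> cK Kk Nm m1.
have [p [/setIP[pN pK] Nr]] : exists p, p \in N :&: K /\
    forall x, x \in K -> (x \in N) = (m == k.+1) || (x == p).
  have [mk|mk] := eqVneq m k.+1.
    have /eqP NK : N :&: K == K by rewrite eqEcard subsetIr Nm mk Kk leqnn.
    have /card_gt0P[p pK] : 0 < #|K| by rewrite Kk.
    by exists p; rewrite NK; split=> // x; rewrite -{1}NK => /setIP[->].
  rewrite (negbTE mk) orbF in m1; rewrite (eqP m1) in Nm.
  have /eqP/cards1P[p E] := Nm; exists p; rewrite E inE eqxx; split=> // x xK.
  by rewrite -in_set1 -E inE xK andbT.
pose s := p :: enum (K :\ p).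
have sK x : (x \in s) = (x \in K).
  by rewrite inE mem_enum in_setD1; case: eqVneq => // ->; rewrite pK.
have us : uniq s by rewrite /= mem_enum in_setD1 eqxx enum_uniq.
have zs : size s = k.+1 by rewrite -Kk -(eq_card sK); apply/esym/card_uniqP.
have eK (j : 'I_k.+1) : nth p s j \in K by rewrite -sK mem_nth // zs.
have ei (i j : 'I_k.+1) : (nth p s i == nth p s j) = (i == j) by rewrite nth_uniq ?zs.
exists (fun j => nth p s j); split=> // [x|i j|j].
- rewrite -sK => xs; have xk : index x s < k.+1 by rewrite -zs index_mem.
  by exists (Ordinal xk); rewrite nth_index.
- have [->|ij] := eqVneq i j; first by rewrite adj_irrefl.
  by apply: (cliqueP _ cK) => //; rewrite ei.
by rewrite Nr // -(ei j ord0).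
Qed.

Lemma cluster_enum N t S : cluster N (nseq t (3, 1)) S ->
  exists f : 'I_t * 'I_3 -> G, [/\ forall x, x \in S -> exists u, x = f u, forall u, f u \in S,
    forall u v, adj (f u) (f v) = (u.1 == v.1) && (u.2 != v.2) &
    forall u, (f u \in N) = (u.2 == ord0)].
Proof.
elim: t S => [|t IH] S cS.
  have f : 'I_0 * 'I_3 -> G by case=> [[]].
  exists f; split=> [x|[[]]|[[]]|[[]]] //.
  have /eqP := cluster_card cS; rewrite cards_eq0 => /eqP->; by rewrite inE.
have [K [S' [[_ cK aK -> cS'] [K3 NK]]]] := cluster_mem cS (mem_head _ _).
rewrite [rem _ _]/= in cS'.
have [f [fS Sf fadj fN]] := IH _ cS'.
have [e [eK Ke eadj eN]] := clique_enum cK (esym K3) (esym NK) isT.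
have /apartP[_ aKS] := aK.
exists (fun u => if unlift ord0 u.1 is Some i then f (i, u.2) else e u.2); split=> [x|u|u v|u].
- case/setUP => [/eK[j ->]|/fS[[i j] ->]].
    by exists (ord0, j); rewrite unlift_none.
  by exists (lift ord0 i, j); rewrite liftK.
- by case: unliftP => [i|] _; rewrite inE ?Sf ?Ke ?orbT.
- case: u v => [i j] [i' j'] /=.
  case: (unliftP ord0 i) => [k|] ->; case: (unliftP ord0 i') => [k'|] ->.
  + by rewrite fadj (inj_eq lift_inj).
  + by rewrite adj_sym (negbTE (aKS _ _ (Ke j') (Sf (k, j)))).
  + by rewrite (negbTE (aKS _ _ (Ke j) (Sf (k', j')))).
  by rewrite eadj eqxx.
by case: unliftP => [i|] _; rewrite ?fN ?eN.
Qed.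

(** The cliques of S - y are enumerated one after the other, the neighbours of y
    first. Together with the enumeration of y and of the clique that N(y) swallows
    this is an adjacency preserving map from K3 * ((r0 - 1) K3 + K2) onto G, which is
    bijective since both sides have the same order. *)
Lemma cluster_iso_C y t : cluster (nbr y) ((2, 2) :: (2, 1) :: nseq t (3, 1)) ([set: G] :\ y) ->
  iso_C t.+1 G.
Proof.
move=> cS; have cardG : #|G| = 3 * t + 5.
  rewrite -cardsT (cardsD1 y) inE (cluster_card cS) /=.
  have -> : sumn (unzip1 (nseq t (3, 1))) = 3 * t.
    by clear; elim: t => //= t ->; lia.
  by clear; lia.
have [K [S1 [[_ cK aK SE cS1] [K2 NK]]]] := cluster_mem cS (mem_head _ _).
rewrite [rem _ _]/= in cS1.
have [L [S2 [[_ cL aL SE1 cS2] [L2 NL]]]] := cluster_mem cS1 (mem_head _ _).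
rewrite [rem _ _]/= in cS2.
have [f [fS Sf fadj fN]] := cluster_enum cS2.
have [e [eK Ke eadj eN]] := clique_enum cK (esym K2) (esym NK) isT.
have [d [dL Ld dadj dN]] := clique_enum cL (esym L2) (esym NL) isT.
have yadj x : (x \in nbr y) = adj y x by rewrite inE.
have /apartP[_ aKS] := aK; have /apartP[_ aLS] := aL.
rewrite /iso_C subn1 succnK; pose H := dunion (copies t (complete 3)) (complete 2).
pose M : {set H} := [set z : H | match z with inl u => u.2 == ord0 | inr j => j == ord0 end].
pose tip (i : 'I_3) : G := if unlift ord0 i is Some j then e j else y.
pose leaf (z : H) : G := match z with inl u => f u | inr j => d j end.
have leafS1 z : leaf z \in S1 by rewrite SE1 inE; case: z => /= z; rewrite ?Sf ?Ld ?orbT.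
have leafadj z z' : adj (leaf z) (leaf z') = adj z z'.
  case: z z' => [u|j] [u'|j'] /=; rewrite ?fadj ?dadj //.
    by rewrite adj_sym (negbTE (aLS _ _ (Ld j') (Sf u))).
  by rewrite (negbTE (aLS _ _ (Ld j) (Sf u'))).
have tipadj i z : adj (tip i) (leaf z) = (i == ord0) && (z \in M).
  rewrite /tip; case: unliftP => [j|] ->.
    by rewrite (negbTE (aKS _ _ (Ke j) (leafS1 z))).
  by rewrite -yadj eqxx [z \in M]inE; case: z => z; rewrite [leaf _]/= ?fN ?dN.
pose F (w : @attach 3 ord0 H M) : G := match w with inl i => tip i | inr z => leaf z end.
have Fadj w w' : adj (F w) (F w') = adj w w'.
  case: w w' => [i|z] [i'|z']; last exact: leafadj.
  - rewrite -[RHS]/(i != i') /= /tip.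
    case: (unliftP ord0 i) => [j|] ->; case: (unliftP ord0 i') => [j'|] ->.
    + by rewrite eadj (inj_eq lift_inj).
    + by rewrite adj_sym -yadj eN.
    + by rewrite -yadj eN.
    by rewrite adj_irrefl.
  - exact: tipadj.
  by rewrite adj_sym; apply: tipadj.
have Fsurj x : exists w, x = F w.
  have [->|xy] := eqVneq x y; first by exists (inl ord0); rewrite /= /tip unlift_none.
  have : x \in [set: G] :\ y by rewrite !inE xy.
  rewrite SE SE1 => /setUP[/eK[j ->]|/setUP[/dL[j ->]|/fS[u ->]]].
  - by exists (inl (lift ord0 j)); rewrite /= /tip liftK.
  - by exists (inr (inr j)).
  by exists (inr (inl u)).
have cardA : #|@attach 3 ord0 H M| = #|G|.
  transitivity #|{: 'I_3 + ('I_t * 'I_3 + 'I_2)}|; first by [].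
  rewrite cardG !card_sum card_prod !card_ord; clear; lia.
have Finj : injective F.
  have FT : F @: [set: @attach 3 ord0 H M] = [set: G].
    by apply/setP => x; rewrite !inE; have [w ->] := Fsurj x; apply: imset_f.
  have /imset_injP Fi : #|F @: [set: @attach 3 ord0 H M]| == #|[set: @attach 3 ord0 H M]|.
    by rewrite FT !cardsT cardA.
  by move=> w w'; apply: Fi.
have [g FK gK] : bijective F by apply: inj_card_bij Finj _; rewrite cardA.
exists ord0, M; split; last first.
  by exists g; [exists F | move=> x x'; rewrite -Fadj !gK].
move=> B /imsetP[z _ ->]; rewrite component_block; apply/eqP/cards1P.
case: z => [[i j]|j].
  exists (inl (i, ord0)); apply/setP => -[[i' j']|j']; rewrite !inE //.
    by rewrite -[RHS]/((i', j') == (i, ord0)) xpair_eqE andbC /= eq_sym.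
  by rewrite andbF.
exists (inr ord0); apply/setP => -[[i' j']|j']; rewrite !inE ?andbF ?andbT //.
Qed.

End Recognition.

Section Extremal.
Variables (t : nat) (v0 : 'I_3).
Let H := dunion (copies t (complete 3)) (complete 2).
Variable M : {set H}.
Hypothesis M1 : forall B, B \in components H -> #|M :&: B| = 1.
Let A := attach v0 M.
Let y : A := inl v0.

Definition tail_block (b : option 'I_t) : {set A} :=
  [set w : A | if w is inr z then block (z : H) == b else false].

Lemma tail_block_imset b : tail_block b = inr @: [set z : H | block z == b].
Proof.
apply/setP => -[i|z]; first by rewrite inE; apply/esym/imsetP => -[].
rewrite (mem_imset _ _ (@inr_inj _ _)) !inE //.
Qed.

Lemma clique_tail_block b : clique (tail_block b).
Proof.
apply/cliqueP => -[i|z] [i'|z']; rewrite !inE // => /eqP zb /eqP z'b zz'.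
by rewrite -[adj _ _]/(adj z z') adj_block zb z'b eqxx.
Qed.

Lemma tail_block_apart b (S : {set A}) :
  (forall w, w \in S -> if w is inr z then block (z : H) != b else w != y) -> apart (tail_block b) S.
Proof.
move=> HS; apply/apartP; split.
  apply/pred0P => w /=; apply/negP => /andP[wb /HS]; case: w wb => z; rewrite inE //.
  by move=> ->.
case=> [i|z] w; rewrite inE // => /eqP zb /HS; case: w => [i|z'].
  by rewrite -[adj _ _]/((i == v0) && (z \in M)) => /eqP iy; case: eqP iy => [->|].
by rewrite -[adj _ _]/(adj z z') adj_block zb eq_sym => /negbTE->.
Qed.

Lemma card_nbr_tail_block z : #|nbr y :&: tail_block (block (z : H))| = 1.
Proof.
have cB : component z \in components H by apply: imset_f.
rewrite -(M1 cB) component_block -(card_imset _ (@inr_inj 'I_3 H)); apply: eq_card => -[i|w].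
  by rewrite !inE andbF; apply/esym/imsetP => -[].
by rewrite (mem_imset _ _ (@inr_inj _ _)) !inE -[adj _ _]/((v0 == v0) && (w \in M)) eqxx eq_sym.
Qed.

Lemma card_tail_block b : #|tail_block b| = if b is Some _ then 3 else 2.
Proof.
rewrite tail_block_imset (card_imset _ (@inr_inj _ _)); case: b => [i|].
  have -> : [set z : H | block z == Some i] = (fun j : 'I_3 => inl (i, j)) @: [set: 'I_3].
    apply/setP => -[[i' j]|j]; rewrite inE; last by rewrite -[LHS]/false; apply/esym/imsetP => -[].
    apply/eqP/imsetP => [[->]|[j' _ [-> _]]] //; by exists j.
  by rewrite card_imset ?cardsT ?card_ord // => j j' [].
have -> : [set z : H | block z == None] = inr @: [set: 'I_2].
  apply/setP => -[[i' j]|j]; rewrite inE; first by rewrite -[LHS]/false; apply/esym/imsetP => -[].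
  by rewrite (mem_imset _ _ (@inr_inj _ _)) inE.
by rewrite (card_imset _ (@inr_inj _ _)) cardsT card_ord.
Qed.

Lemma cluster_triangles (s : seq 'I_t) : uniq s -> cluster (nbr y) (nseq (size s) (3, 1))
  [set w : A | if w is inr z then (if block (z : H) is Some i then i \in s else false) else false].
Proof.
elim: s => [_|i s IH /andP[iS us]].
  rewrite (_ : [set _ | _] = set0); first exact: ClusterNil.
  by apply/setP => -[i|[[i j]|j]]; rewrite !inE.
set S := [set w | _].
pose S' := [set w : A |
  if w is inr z then (if block (z : H) is Some i then i \in s else false) else false].
have -> : S = tail_block (Some i) :|: S'.
  apply/setP => -[k|[[k j]|j]]; rewrite !inE //.
rewrite -[nseq _ _]/((3, 1) :: nseq (size s) (3, 1)).
have {1}-> : (3, 1) = (#|tail_block (Some i)|, #|nbr y :&: tail_block (Some i)|).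
  by rewrite card_tail_block -(@card_nbr_tail_block (inl (i, ord0))).
apply: ClusterCons; last exact: IH.
- by rewrite -card_gt0 card_tail_block.
- exact: clique_tail_block.
apply: tail_block_apart => -[k|[[k j]|j]]; rewrite !inE //= => ks.
by apply: contraNneq iS => -[<-].
Qed.

(** Seen from the vertex y = v0, the graph C(n, r0) has exactly the structure found
    in the case of equality, so that the counts for such unions of cliques give the
    value. *)
Lemma cluster_attach :
  cluster (nbr y) ((2, 2) :: (2, 1) :: nseq t (3, 1)) ([set: A] :\ y).
Proof.
pose K : {set A} := inl @: ([set: 'I_3] :\ v0).
pose T := [set w : A | if w is inr z then (if block (z : H) is Some i then i \in enum 'I_t else false) else false].
have -> : [set: A] :\ y = K :|: (tail_block None :|: T).
  apply/setP => -[k|[[i j]|j]]; rewrite !inE ?mem_enum ?orbT //.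
    by rewrite (mem_imset _ _ (@inl_inj _ _)) !inE !orbF andbT.
  by rewrite -[RHS]/([|| _, _ | i \in enum 'I_t]) mem_enum !orbT.
have K2 : #|K| = 2.
  rewrite (card_imset _ (@inl_inj _ _)); apply: succn_inj.
  by rewrite -[RHS](card_ord 3) -cardsT (cardsD1 v0 [set: _]) inE.
have NK : nbr y :&: K = K.
  apply/setIidPr/subsetP => w /imsetP[k kv ->].
  by move: kv; rewrite !inE andbT -[adj _ _]/(v0 != k) eq_sym.
have -> : (2, 2) = (#|K|, #|nbr y :&: K|) by rewrite NK K2.
have -> : (2, 1) = (#|tail_block None|, #|nbr y :&: tail_block None|).
  by rewrite card_tail_block -(@card_nbr_tail_block (inr ord0)).
apply: ClusterCons; first by rewrite -card_gt0 K2.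
- apply/cliqueP => w w' /imsetP[i _ ->] /imsetP[j _ ->].
  by rewrite (inj_eq (@inl_inj _ _)).
- apply/apartP; split.
    by apply/pred0P => w /=; apply/negP => /andP[/imsetP[i _ ->]]; rewrite !inE.
  move=> w [j|z] /imsetP[i]; rewrite !inE andbT // => iv -> _.
  by rewrite -[adj _ _]/((i == v0) && (z \in M)) (negbTE iv).
apply: ClusterCons.
- by rewrite -card_gt0 card_tail_block.
- exact: clique_tail_block.
- by apply: tail_block_apart => -[k|[[k j]|j]]; rewrite !inE.
by have := cluster_triangles (enum_uniq 'I_t); rewrite size_enum_ord.
Qed.

Lemma mis_attach : mis [set: A] = 4 * 3 ^ t + 2 ^ t.
Proof.
have cA := cluster_attach; have -> : [set: A] = y |: ([set: A] :\ y) by rewrite setD1K.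
rewrite mis_setU1 ?inE ?eqxx //.
  rewrite (cluster_mis cA) (cluster_misD cA) !big_cons !big_nseq /=.
  by rewrite !iter_muln_1 !mulnA !mul1n.
rewrite (cluster_alpha cA) (cluster_alphaD cA) /= count_nseq size_nseq /=; clear; lia.
Qed.

End Extremal.

Lemma iso_C_mis r0 (G : sgraph) : 0 < r0 -> iso_C r0 G -> num_max_independent G = c_val r0.
Proof.
case: r0 => // t _ [v0 [M [M1 isoG]]]; rewrite (iso_num_max isoG) num_max_independent_mis.
rewrite /c_val; move: M M1 {isoG}; rewrite subn1 succnK => M M1; exact: mis_attach.
Qed.

Theorem theorem4p1 (n r0 : nat) (hn : n = 3 * r0 + 2) (hn7 : 7 <= n)
    (G : sgraph) (hG : #|G| = n) (hconn : sg_connected G)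
    (hcyc : num_cycles G < r0 + 12) :
  num_max_independent G <= c_val r0 /\
  (num_max_independent G = c_val r0 <-> iso_C r0 G).
Proof.
have r1 : 1 < r0 by move: hn hn7; clear; lia.
have G0 : 0 < #|G| by rewrite hG; move: hn7; clear; lia.
have cT : #|[set: G]| = 3 * r0 + 2 by rewrite cardsT hG.
rewrite -cyc_setT in hcyc.
have [le eq] := few_cycles_bound (sg_connected_conn G0 hconn) cT r1 hcyc.
rewrite cT -c_val_sparse_bound ?(ltnW r1) // in le eq.
rewrite num_max_independent_mis; split=> //; split=> [/eq[y _]|iso].
  by case: r0 r1 {hn hcyc cT le eq} => // t _; apply: cluster_iso_C.
by rewrite -num_max_independent_mis; apply: iso_C_mis => //; apply: ltnW.
Qed.
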